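(* For any initial datum $\varphi\in L^\infty(\mathbb{R}^d)$ such that $0\leqslant \varphi\leqslant 1$ there exists a unique global mild solution $u\in C([0,\infty), L^\infty(\mathbb{R}^d))$ of the problem $$u_t=\Delta u-u+\sum_{k\geqslant 1}q_ku^k,\quad x\in\mathbb{R}^d,\ t>0,\qquad u(x,0)=\varphi(x),$$ that satisfies $0\leqslant u(x,t)\leqslant 1$ for every $x\in \mathbb{R}^d$, $t\geqslant 0$, and $$\|u(\cdot, t)\|_{L^\infty(\mathbb{R}^d)}\leqslant \|\varphi\|_{L^\infty(\mathbb{R}^d)}.$$ If in addition $\varphi\in L^1(\mathbb{R}^d)$ then $u\in C([0,\infty), L^1(\mathbb{R}^d)\cap L^\infty(\mathbb{R}^d))$ and $$\int_{\mathbb{R}^d} u(x,t)\, dx\leqslant \int _{\mathbb{R}^d}\varphi (x) \, dx .$$ Moreover, for any $\varphi_1,\varphi_2\in L^1(\mathbb{R}^d)$ with $0\leqslant \varphi_1,\varphi_2\leqslant 1$, the corresponding solutions $u_1$ and $u_2$ satisfy, for every $T>0$, $$\|u_1-u_2\|_{L^\infty ([0,T],L^1(\mathbb{R}^d))}\leqslant C(T, q) \|\varphi_1-\varphi_2\|_{L^1(\mathbb{R}^d)},$$ where $C(T,q)$ is a constant depending on $T$ and $q$.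
   Context: $d\geqslant 1$ is an integer. $(q_k)_{k\geqslant 1}$ is a sequence of nonnegative numbers with $\sum_{k\geqslant 1}q_k=1$ and $1<\sum_{k\geqslant 1}kq_k=q<\infty$. A mild solution is a solution of the integral (fixed point) equation $u(t)= S(t)\varphi +\int _0^t S(t-s) \big( \sum _{k\geqslant 1} q_ku^k(s)\big)ds$, where $S(t)\varphi=e^{-t}(K_t\ast \varphi)$ and $K_t(x)=(4\pi t)^{-d/2}e^{-|x|^2/(4t)}$ is the heat kernel.
   Formalization: For discontinuous φ, S(t)φ does not tend to φ in L^∞, so u∈C([0,∞),L^∞) fails at t=0; it is replaced by norm continuity for t>0, weak-* continuity on [0,∞), norm continuity of u−S(·)φ on [0,∞), and of u there whenever S(t)φ→φ in L^∞. *)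

(* Defs.v *)
From HB Require Import structures.
From mathcomp Require Import all_boot all_order all_algebra.
From mathcomp Require Import all_classical all_reals all_analysis.
Set Implicit Arguments.
Unset Strict Implicit.
Unset Printing Implicit Defensive.
Import Order.TTheory GRing.Theory Num.Theory.
Import numFieldNormedType.Exports.
Local Open Scope classical_set_scope.
Local Open Scope ring_scope.

Notation Rd R d := (d.-tuple (measurableTypeR R)).

Section euclidean.
Context (R : realType) (d : nat).
Implicit Types x y : Rd R d.

Definition rd_sub x y : Rd R d := [tuple (tnth x i : R) - tnth y i | i < d].

Definition rd_sqnorm x : R := \sum_(i < d) (tnth x i : R) ^+ 2.

End euclidean.

Section lebesgue_cons.
Context (R : realType) (d : nat) (m : {measure set (Rd R d) -> \bar R}).

Definition rd_cons (x : measurableTypeR R * Rd R d) : Rd R d.+1 :=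
  [tuple of x.1 :: x.2].

Lemma measurable_rd_cons : measurable_fun setT rd_cons.
Proof. exact: measurable_cons. Qed.

Definition lebesgue_cons : set (Rd R d.+1) -> \bar R :=
  pushforward (lebesgue_measure \x^ m)%E rd_cons.

Let lebesgue_cons0 : lebesgue_cons set0 = 0%E.
Proof. by rewrite /lebesgue_cons /pushforward preimage_set0 measure0. Qed.

Let lebesgue_cons_ge0 A : (0 <= lebesgue_cons A)%E.
Proof.
apply: integral_ge0 => y _; exact: measure_ge0.
Qed.

Let lebesgue_cons_sigma_additive : semi_sigma_additive lebesgue_cons.
Proof.
have mf := measurable_rd_cons.
move=> F mF tF mUF; rewrite /lebesgue_cons /pushforward preimage_bigcup.
apply: measure_semi_sigma_additive.
- by move=> n; rewrite -[X in measurable X]setTI; exact: mf.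
- apply/trivIsetP => /= i j _ _ ij; rewrite -preimage_setI.
  by move/trivIsetP : tF => /(_ _ _ _ _ ij) ->//; rewrite preimage_set0.
- by rewrite -preimage_bigcup -[X in measurable X]setTI; exact: mf.
Qed.

HB.instance Definition _ := isMeasure.Build _ _ _ lebesgue_cons
  lebesgue_cons0 lebesgue_cons_ge0 lebesgue_cons_sigma_additive.

End lebesgue_cons.

Fixpoint lebesgue_Rd_rec (R : realType) (d : nat) :
    {measure set (Rd R d) -> \bar R} :=
  match d with
  | 0 => [the measure _ _ of \d_([tuple] : Rd R 0)]
  | d'.+1 => [the measure _ _ of lebesgue_cons (lebesgue_Rd_rec R d')]
  end.

Section lebesgue_Rd.
Context (R : realType).

Definition lebesgue_Rd (d : nat) : set (Rd R d) -> \bar R :=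
  lebesgue_Rd_rec R d.

HB.instance Definition _ d := Measure.on (@lebesgue_Rd d).

Definition rd_box d (A : 'I_d -> set R) : set (Rd R d) :=
  [set x | forall i, A i (tnth x i)].

Lemma measurable_rd_box d (A : 'I_d -> set (measurableTypeR R)) :
  (forall i, measurable (A i)) -> measurable (rd_box A).
Proof.
move=> mA.
rewrite (_ : rd_box _ =
    \bigcap_(i in [set: 'I_d]) ((@tnth d _)^~ i @^-1` A i)); last first.
  by apply/seteqP; split => x /= H i => [_|]; exact: H.
apply: fin_bigcap_measurable => // i _.
by rewrite -[X in measurable X]setTI; exact: measurable_tnth.
Qed.

Lemma lebesgue_Rd_box d (A : 'I_d -> set (measurableTypeR R)) :
  (forall i, measurable (A i)) ->
  (lebesgue_Rd (rd_box A) = \prod_(i < d) lebesgue_measure (A i))%E.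
Proof.
elim: d A => [|d IH] A mA.
  rewrite big_ord0 /lebesgue_Rd /= diracE mem_set//.
  by case.
rewrite big_ord_recl -(IH (fun i => A (lift ord0 i)))//.
rewrite /lebesgue_Rd /= /lebesgue_cons /pushforward.
have -> : @rd_cons R d @^-1` rd_box A =
    A ord0 `*` rd_box (fun i => A (lift ord0 i)).
  apply/seteqP; split => -[a b] /=.
    move=> H; split; first by have := H ord0.
    by move=> i; have := H (lift ord0 i); rewrite tnthS; congr (A _ _); apply: val_inj.
  move=> [Ha Hb] i; case: (unliftP ord0 i) => [j ->|->] //.
  by rewrite tnthS; exact: Hb.
rewrite product_measure2E//.
exact: measurable_rd_box.
Qed.

Let sigma_finite_lebesgue_Rd d : sigma_finite setT (@lebesgue_Rd d).
Proof.
pose I (n : nat) : set (measurableTypeR R) := `[- n%:R, n%:R]%classic.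
exists (fun n => rd_box (fun _ : 'I_d => I n)).
  apply/esym; rewrite -subTset => x _.
  pose M := \big[maxn/0%N]_(i < d) (Num.truncn `|tnth x i : R|%R).+1%N.
  exists M => // i; rewrite /I /= in_itv /= -ler_norml.
  apply: (@le_trans _ _ (Num.truncn `|tnth x i : R|%R).+1%:R).
    exact/ltW/truncnS_gt.
  rewrite ler_nat.
  exact: (@leq_bigmax _ (fun i : 'I_d => (Num.truncn `|tnth x i : R|%R).+1)).
move=> n; split; first by apply: measurable_rd_box => i; exact: measurable_itv.
rewrite lebesgue_Rd_box; last by move=> i; exact: measurable_itv.
suff [] : (\prod_(i < d) lebesgue_measure (I n) < +oo /\
    0 <= \prod_(i < d) lebesgue_measure (I n))%E by [].
elim/big_ind: _ => [|a b [aoo a0] [boo b0]|i _].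
- by rewrite ltry.
- by split; [rewrite lte_mul_pinfty// ge0_fin_numE|exact: mule_ge0].
- split; last exact: measure_ge0.
  by rewrite lebesgue_measure_itv/=; case: ifP => // _; rewrite -EFinB ltry.
Qed.

HB.instance Definition _ d := Measure_isSigmaFinite.Build _ _ _
  (@lebesgue_Rd d) (@sigma_finite_lebesgue_Rd d).

End lebesgue_Rd.
Arguments lebesgue_Rd : clear implicits.

Section problem.
Context (R : realType) (d : nat).
Local Notation mu := (lebesgue_Rd R d).
Local Notation leb := (@lebesgue_measure R).
Implicit Types (phi : Rd R d -> R) (u : R -> Rd R d -> R) (t q : R)
  (qk : nat -> R).

(* The value at index 0 plays no role: the law lives on k >= 1. *)
Definition offspring_law qk q :=
  [/\ forall k, (1 <= k)%N -> 0 <= qk k,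
      (\sum_(1 <= k <oo) (qk k)%:E = 1)%E,
      (\sum_(1 <= k <oo) (k%:R * qk k)%:E = q%:E)%E
    & 1 < q].

Definition reaction qk (v : R) : R :=
  \big[+%R/0]_(1 <= k <oo) (qk k * v ^+ k).

Definition heat_kernel t (x : Rd R d) : R :=
  (4 * pi * t) `^ (- (d%:R / 2)) * expR (- (rd_sqnorm x / (4 * t))).

(* The convolution formula makes sense only for 0 < t; S(0) is the identity. *)
Definition heat_semigroup t phi (x : Rd R d) : R :=
  if t == 0 then phi x
  else expR (- t) * \int[mu]_y (heat_kernel t (rd_sub x y) * phi y).

(* Elements of Lp(R^d) are represented by measurable functions, so that equality
   in Lp is equality almost everywhere. For s < t the integrand is defined at
   every x and depends only on the class of u(s), so the time integral can be
   taken pointwise in x. *)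
Definition mild_solution qk phi u := forall t, 0 <= t ->
  {ae mu, forall x, u t x = heat_semigroup t phi x +
    \int[leb]_(s in `[0, t]) heat_semigroup (t - s) (reaction qk \o u s) x}.

Definition Lp_continuous_on (p : \bar R) (I : set R) u := forall t, I t ->
  'N[mu]_p[EFin \o (u s \- u t)%R]%E @[s --> within I (nbhs t)] --> 0%E.

Definition weakstar_continuous_on (I : set R) u :=
  forall t, I t -> forall g, g \in Lfun mu 1 ->
  (\int[mu]_x (u s x * g x)) @[s --> within I (nbhs t)]
    --> (\int[mu]_x (u t x * g x)).

(* The heat semigroup is not strongly continuous on L^oo(R^d) at t = 0: for
   discontinuous data, S(t)phi does not converge to phi in norm. Hence
   continuity in L^oo is in norm on ]0, +oo[ and weak-* up to t = 0. *)
Definition global_solution qk phi u :=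
  [/\ forall t, 0 <= t -> u t \in Lfun mu +oo%E,
      Lp_continuous_on +oo%E `]0, +oo[ u,
      weakstar_continuous_on `[0, +oo[ u,
      mild_solution qk phi u
    & forall t x, 0 <= t -> 0 <= u t x <= 1].

Definition LooL1_norm (T : R) u : \bar R :=
  ('N[mrestr leb (measurable_itv `[0%R, T])]_+oo[
    (fun t => 'N[mu]_1[EFin \o u t])])%E.

End problem.

(* Main.v *)
Require Import Defs.
From HB Require Import structures.
From mathcomp Require Import all_boot all_order all_algebra.
From mathcomp Require Import all_classical all_reals all_analysis.
From mathcomp Require Import measurable_realfun ess_sup_inf ring lra.
Import Order.TTheory GRing.Theory Num.Theory.
Import numFieldNormedType.Exports.
Local Open Scope classical_set_scope.
Local Open Scope ring_scope.
Set Implicit Arguments.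
Unset Strict Implicit.
Unset Printing Implicit Defensive.

(** The equation is solved by a contraction. Write S(t) for the heat semigroup
killed at rate 1, f for the reaction and D h (t) for the Duhamel term, the integral
over [0, t] of S(t - s) h(s). On [0, 1] the generating function f satisfies
0 <= f(v) <= v and is Lipschitz with constant its mean q ([reaction_le],
[reaction_lipschitz]). Since S(t) has mass exp(-t), replacing v by w changes
D (f o v) by at most half the weighted distance, for the weight exp((2 q - 1) t) on
the whole half-line ([duhamel_contraction]). The Picard iterates therefore converge
uniformly on bounded time intervals, and they attract every solution, which gives
existence ([picard_limitE]) and uniqueness ([picard_limit_unique]) together.

The interval [0, M] is invariant for every M <= 1: the semigroup contributes at most
M exp(-t) and the Duhamel term at most M (1 - exp(-t)), because f(v) <= v. With M the
essential supremum of the data this is the bound in L^oo. The same balance holds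
for the total mass, by the symmetry of the kernel and Tonelli ([picard_limit_mass]),
and for the L1 distance of two solutions with the weight exp((2 q - 1) t)
([picard_limit_dist_mass]), which gives C(T, q) = 2 exp((2 q - 1) T).

Regularity in time rests on one property of the Gaussian kernel, the bound
K(t) <= (t' / t)^d K(t') for t <= t': as the killed kernels lose mass in time, such a
one-sided comparison makes them close in L1 ([killed_kernel_dist]). Hence S(t) is
continuous in operator norm for t > 0, and the Duhamel term is continuous in L^oo and in L1 up to
t = 0, the singular times near the end of the integral being controlled by their
length ([duhamel_time_sup], [duhamel_time_mass]). At t = 0 there remains the
semigroup itself, which is strongly continuous on L1 ([heat_kernel_l1_regular]) and,
by duality, weak-* continuous on L^oo ([near_weak_semigroup]).

The mild equation does not require a solution to be jointly measurable in time and
space, so the time integral may be one of a nonmeasurable function. It is then a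
lower integral, and comparison with the measurable Picard iterates remains possible
([Rintegral_sandwich]).

The argument is run for an abstract symmetric Markov kernel on a sigma-finite space
([diffusion_kernel]), and the Gaussian kernel on R^d is shown to be an instance
([diffusion_heat_kernel]). *)

(** * Integrals of functions with no assumed measurability *)

Section integrals.
Context d (T : measurableType d) (R : realType).
Variable mu : {measure set T -> \bar R}.
Local Open Scope ereal_scope.

(** The integral of a nonnegative function is a supremum over the simple
functions below it, hence monotone even where measurability is unknown. *)
Lemma ge0_le_lower_integral (D : set T) (f g : T -> \bar R) :
  (forall x, D x -> 0 <= f x) -> (forall x, D x -> f x <= g x) ->
  \int[mu]_(x in D) f x <= \int[mu]_(x in D) g x.
Proof.
move=> f0 fg; have g0 x : D x -> 0 <= g x by move=> Dx; exact: le_trans (f0 _ Dx) (fg _ Dx).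
rewrite !ge0_integralE//; apply: ereal_sup_le => _ [h /= hf <-]; exists h => // x.
apply: le_trans (hf x) _; rewrite /patch; case: ifPn => // /set_mem.
exact: fg.
Qed.

(** Used with F the Duhamel integrand of an arbitrary solution, of which only the
time slices are known to be measurable: closeness to a measurable G is enough to
compare the integrals. *)
Lemma Rintegral_sandwich (D : set T) (F G H : T -> R) :
  measurable D -> mu D < +oo ->
  measurable_fun D G -> measurable_fun D H ->
  (forall x, D x -> 0 <= F x <= 1)%R -> (forall x, D x -> 0 <= G x <= 1)%R ->
  (forall x, D x -> `|F x - G x| <= H x)%R ->
  \int[mu]_(x in D) (H x)%:E < +oo ->
  (`|(\int[mu]_(x in D) F x) - (\int[mu]_(x in D) G x)|)%R%:E
    <= \int[mu]_(x in D) (H x)%:E.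
Proof.
move=> mD muD mG mH F01 G01 FG Hoo.
have bound (A : T -> R) : (forall x, D x -> 0 <= A x <= 1)%R ->
    \int[mu]_(x in D) (A x)%:E \is a fin_num.
  move=> A01; rewrite ge0_fin_numE; last first.
    by apply: integral_ge0 => x /A01 /andP[]; rewrite lee_fin.
  apply: (@le_lt_trans _ _ (\int[mu]_(x in D) 1)); last by rewrite integral_cst// mul1e.
  by apply: ge0_le_lower_integral => x /A01 /andP[]; rewrite !lee_fin.
have H0 x : D x -> (0 <= H x)%R by move=> Dx; exact: le_trans (FG _ Dx).
have H0E x : D x -> 0 <= (H x)%:E by move=> /H0; rewrite lee_fin.
have mHE : measurable_fun D (fun x => (H x)%:E) by exact/measurable_EFinP.
have mGE : measurable_fun D (fun x => (G x)%:E) by exact/measurable_EFinP.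
have HF : \int[mu]_(x in D) (H x)%:E \is a fin_num.
  by rewrite ge0_fin_numE// integral_ge0.
have FGE x : D x -> (F x - G x <= H x)%R /\ (G x - F x <= H x)%R.
  by move=> Dx; have := FG _ Dx; rewrite ler_norml => /andP[? ?]; split; lra.
have up : \int[mu]_(x in D) (F x)%:E <= \int[mu]_(x in D) (G x)%:E + \int[mu]_(x in D) (H x)%:E.
  rewrite -ge0_integralD//; last first.
  - by move=> x /G01 /andP[]; rewrite lee_fin.
  apply: ge0_le_lower_integral => x Dx; first by case/andP: (F01 x Dx).
  by rewrite -EFinD lee_fin; have := (FGE _ Dx).1; lra.
(* Additivity needs two measurable summands, and F is not one of them: F + H is
bounded below by the positive part of G - H, plus H. *)
have dn : \int[mu]_(x in D) (G x)%:E <= \int[mu]_(x in D) (F x)%:E + \int[mu]_(x in D) (H x)%:E.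
  pose P x := Num.max 0%R (G x - H x)%R.
  have mP : measurable_fun D P by apply: measurable_maxr => //; exact: measurable_funB.
  have P0 x : (0 <= P x)%R by rewrite le_max lexx.
  apply: (@le_trans _ _ (\int[mu]_(x in D) (P x)%:E + \int[mu]_(x in D) (H x)%:E)).
    rewrite -ge0_integralD//; last 2 first.
    - by move=> x _; rewrite lee_fin.
    - exact/measurable_EFinP.
    apply: ge0_le_lower_integral => x Dx; first by case/andP: (G01 x Dx).
    by rewrite -EFinD lee_fin -lerBlDr le_max lexx orbT.
  rewrite leeD2r//; apply: ge0_le_lower_integral => x Dx; first by rewrite lee_fin.
  rewrite lee_fin ge_max; case/andP: (F01 x Dx) => -> _ /=.
  by have := (FGE _ Dx).2; lra.
move: up dn; rewrite -(fineK (bound _ F01)) -(fineK (bound _ G01)) -(fineK HF).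
rewrite -!EFinD !lee_fin /Rintegral ler_norml => ? ?.
by apply/andP; split; lra.
Qed.

End integrals.

Section exponential_integral.
Context (R : realType).
Local Notation leb := (@lebesgue_measure R).

Lemma integral_expRM (a t : R) : 0 < a -> 0 <= t ->
  (\int[leb]_(s in `[0%R, t]) (expR (a * s))%:E = ((expR (a * t) - 1) / a)%:E)%E.
Proof.
move=> a0; rewrite le_eqVlt => /predU1P[<-|t0].
  by rewrite set_itv1 integral_set1 mulr0 expR0 subrr mul0r.
have dF (x : R) : is_derive x (1:R) (fun s => expR (a * s) / a) (expR (a * x)).
  apply: is_derive_eq; rewrite /GRing.scale /=.
  by field; rewrite gt_eqF.
have cE : continuous (fun s : R => expR (a * s)).
  by move=> x; apply: continuous_comp; [exact: mulrl_continuous|exact: continuous_expR].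
have cF : continuous (fun s : R => expR (a * s) / a).
  by move=> x; apply: cvgMr_tmp; exact: cE.
rewrite (@continuous_FTC2 _ (fun s => expR (a * s)) (fun s => expR (a * s) / a))//.
- by rewrite mulr0 expR0 -EFinB -mulrBl.
- exact: continuous_subspaceT.
- split; first by move=> x _; exact: ex_derive.
  + exact/cvg_at_right_filter/cF.
  + exact/cvg_at_left_filter/cF.
- by move=> x _; rewrite derive1E derive_val.
Qed.

End exponential_integral.

(** * The generating function of the offspring law *)

Section reaction_properties.
Context (R : realType) (qk : nat -> R) (q : R).
Hypothesis law : offspring_law qk q.
Implicit Types v w : R.

Let psum (c : nat -> R) n := \sum_(1 <= k < n) c k.

Let le_psum (c : nat -> R) (l : R) : (forall k, (1 <= k)%N -> 0 <= c k) ->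
  (\sum_(1 <= k <oo) (c k)%:E = l%:E)%E -> forall n, psum c n <= l.
Proof.
move=> c0 cl n; rewrite -lee_fin -cl /psum -sumEFin.
by apply: nneseries_lim_ge => k k1 _; rewrite lee_fin c0.
Qed.

Let qk0 k : (1 <= k)%N -> 0 <= qk k. Proof. by case: law => + _ _ _; apply. Qed.

(** Mean value inequality for the powers on [0, 1]; the factor k turns the sum of
the weights into the mean q in the Lipschitz bound below. *)
Lemma normr_subX_le v w k : 0 <= v <= 1 -> 0 <= w <= 1 ->
  `|v ^+ k - w ^+ k| <= k%:R * `|v - w|.
Proof.
move=> /andP[v0 v1] /andP[w0 w1]; elim: k => [|k IH].
  by rewrite !expr0 subrr normr0 mul0r.
rewrite (_ : _ - _ = v * (v ^+ k - w ^+ k) + w ^+ k * (v - w)); last first.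
  by rewrite !exprS; ring.
apply: le_trans (ler_normD _ _) _; rewrite !normrM -natr1 mulrDl mul1r.
rewrite (ger0_norm v0) (ger0_norm (exprn_ge0 _ w0)) lerD//.
  by apply: le_trans IH; rewrite ler_piMl.
by rewrite ler_piMl// exprn_ile1.
Qed.

Let psum_reaction_ge0 v n : 0 <= v -> 0 <= psum (fun k => qk k * v ^+ k) n.
Proof.
move=> v0; rewrite /psum big_nat; apply: sumr_ge0 => k /andP[k1 _].
by rewrite mulr_ge0 ?qk0 ?exprn_ge0.
Qed.

Let psum_reaction_le v n : 0 <= v <= 1 -> psum (fun k => qk k * v ^+ k) n <= v.
Proof.
move=> /andP[v0 v1]; apply: (@le_trans _ _ (psum qk n * v)).
  rewrite /psum mulr_suml big_nat [leRHS]big_nat; apply: ler_sum => k /andP[k1 _].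
  by rewrite ler_wpM2l ?qk0// -[leRHS]expr1 ler_wiXn2l.
rewrite ler_piMl//; apply: le_psum => //.
by case: law.
Qed.

Let is_cvg_reaction v : 0 <= v <= 1 ->
  cvgn (psum (fun k => qk k * v ^+ k)).
Proof.
move=> v01; apply: nondecreasing_is_cvgn.
  apply/nondecreasing_seqP => -[|n]; rewrite /psum.
    by rewrite !big_geq.
  rewrite [leRHS]big_nat_recr//= lerDl mulr_ge0 ?qk0//.
  by case/andP: v01 => ? _; rewrite exprn_ge0.
by exists v => _ [n _ <-]; exact: psum_reaction_le.
Qed.

Lemma reaction_ge0 v : 0 <= v <= 1 -> 0 <= reaction qk v.
Proof.
move=> v01; apply: limr_ge; first exact: is_cvg_reaction.
by apply: nearW => n; apply: psum_reaction_ge0; case/andP: v01.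
Qed.

Lemma reaction_le v : 0 <= v <= 1 -> reaction qk v <= v.
Proof.
move=> v01; apply: limr_le; first exact: is_cvg_reaction.
by apply: nearW => n; exact: psum_reaction_le.
Qed.

(** The derivative of the generating function is at most its value q at 1. *)
Lemma reaction_lipschitz v w : 0 <= v <= 1 -> 0 <= w <= 1 ->
  `|reaction qk v - reaction qk w| <= q * `|v - w|.
Proof.
move=> v01 w01; have := is_cvg_reaction v01; have := is_cvg_reaction w01.
move=> cw cv; pose S v n := psum (fun k => qk k * v ^+ k) n.
have cvw : `|S v n - S w n| @[n --> \oo] --> `|reaction qk v - reaction qk w|.
  by apply: cvg_norm; exact: (cvgB cv cw).
rewrite -(cvg_lim (@Rhausdorff R) cvw); apply: limr_le.
  by apply/cvg_ex; eexists; exact: cvw.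
apply: nearW => n /=; rewrite /S /psum -sumrB.
apply: le_trans (ler_norm_sum _ _ _) _.
apply: (@le_trans _ _ (psum (fun k => k%:R * qk k) n * `|v - w|)).
  rewrite /psum mulr_suml big_nat [leRHS]big_nat; apply: ler_sum => k /andP[k1 _].
  rewrite -mulrBr normrM ger0_norm ?qk0// mulrAC mulrC.
  by rewrite ler_wpM2r ?qk0// normr_subX_le.
rewrite ler_wpM2r//; apply: le_psum => [k k1|]; last by case: law.
by rewrite mulr_ge0 ?qk0.
Qed.

End reaction_properties.

(** * Schur tests for positive kernels *)

Section nonnegative_real_integrals.
Context (R : realType) d (X : measurableType d) (mu : {measure set X -> \bar R}).
Implicit Types (f g : X -> R) (c : R).

Lemma le_integral_EFin f g : measurable_fun setT f -> measurable_fun setT g ->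
  (forall x, 0 <= f x) -> (forall x, f x <= g x) ->
  (\int[mu]_x (f x)%:E <= \int[mu]_x (g x)%:E)%E.
Proof.
by move=> mf mg f0 fg; apply: ge0_le_integral => //;
  [move=> x _; rewrite lee_fin|exact/measurable_EFinP|exact/measurable_EFinP|
   move=> x _; rewrite lee_fin].
Qed.

Lemma integral_EFinD f g : measurable_fun setT f -> measurable_fun setT g ->
  (forall x, 0 <= f x) -> (forall x, 0 <= g x) ->
  (\int[mu]_x (f x + g x)%:E = \int[mu]_x (f x)%:E + \int[mu]_x (g x)%:E)%E.
Proof.
move=> mf mg f0 g0; under eq_integral do rewrite EFinD.
by apply: ge0_integralD => //; [move=> x _; rewrite lee_fin|exact/measurable_EFinP|
  move=> x _; rewrite lee_fin|exact/measurable_EFinP].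
Qed.

Lemma integral_EFinMl c f : measurable_fun setT f -> (forall x, 0 <= f x) ->
  0 <= c -> (\int[mu]_x (c * f x)%:E = c%:E * \int[mu]_x (f x)%:E)%E.
Proof.
move=> mf f0 c0; under eq_integral do rewrite EFinM.
by apply: ge0_integralZl => //; [exact/measurable_EFinP|move=> x _; rewrite lee_fin].
Qed.

Lemma integral_EFinMr c f : measurable_fun setT f -> (forall x, 0 <= f x) ->
  0 <= c -> (\int[mu]_x (f x * c)%:E = \int[mu]_x (f x)%:E * c%:E)%E.
Proof.
by move=> mf f0 c0; rewrite muleC -integral_EFinMl//; under eq_integral do rewrite mulrC.
Qed.

End nonnegative_real_integrals.

Lemma ge0_integral_dist (R : realType) d (X : measurableType d)
  (mu : {measure set X -> \bar R}) (A B : X -> R) :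
  measurable_fun [set: X] A -> measurable_fun [set: X] B ->
  (forall x, 0 <= A x) -> (forall x, 0 <= B x) ->
  (\int[mu]_x (A x)%:E < +oo)%E -> (\int[mu]_x (B x)%:E < +oo)%E ->
  ((`|fine (\int[mu]_x (A x)%:E) - fine (\int[mu]_x (B x)%:E)|)%:E <=
   \int[mu]_x (`|A x - B x|)%:E)%E.
Proof.
move=> mA mB A0 B0 Aoo Boo.
have int (C : X -> R) : measurable_fun setT C -> (forall x, 0 <= C x) ->
    (\int[mu]_x (C x)%:E < +oo)%E -> mu.-integrable setT (EFin \o C).
  move=> mC C0 Coo; apply/integrableP; split; first exact/measurable_EFinP.
  by under eq_integral => p _ do rewrite /= ger0_norm//.
have iA := int A mA A0 Aoo; have iB := int B mB B0 Boo.
rewrite -[X in (X%:E <= _)%E]/(`|\int[mu]_x A x - \int[mu]_x B x|) -RintegralB//.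
rewrite EFin_normr_Rintegral//; last first.
  by rewrite (_ : _ \o _ = (EFin \o A) \- (EFin \o B))%E//; exact: integrableB.
apply: le_trans (le_abse_integral _ _ _) _ => //.
by apply/measurable_EFinP; exact: measurable_funB.
Qed.

(** Schur's test: the mass of the image is controlled by the mass of the kernel
in its first variable. *)
Lemma kernel_mass (R : realType) d (X : measurableType d)
    (mu : {sigma_finite_measure set X -> \bar R}) (Q : X -> X -> R) (g : X -> R) (c : R) :
  measurable_fun [set: X * X] (fun p => Q p.1 p.2) -> measurable_fun setT g ->
  (forall x y, 0 <= Q x y) -> (forall y, 0 <= g y) ->
  (forall y, \int[mu]_x (Q x y)%:E <= c%:E)%E ->
  (\int[mu]_x \int[mu]_y (Q x y * g y)%:E <= c%:E * \int[mu]_y (g y)%:E)%E.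
Proof.
move=> mQ mg Q0 g0 Qc.
have c0 : 0 <= c.
  rewrite -lee_fin; apply: le_trans (Qc point).
  by apply: integral_ge0 => x _; rewrite lee_fin.
rewrite (fubini_tonelli (fun p : X * X => (Q p.1 p.2 * g p.2)%:E))//=; last 2 first.
- apply/measurable_EFinP; apply: measurable_funM => //; exact: measurableT_comp.
- by move=> p; rewrite lee_fin mulr_ge0.
have mQy y : measurable_fun setT (fun x => Q x y).
  exact: (measurableT_comp mQ (measurable_pair2 y)).
under eq_integral do rewrite integral_EFinMr//.
rewrite -integral_EFinMl//; apply: ge0_le_integral => //.
- by move=> y _; rewrite mule_ge0// ?lee_fin//; apply: integral_ge0 => x _; rewrite lee_fin.
- apply: emeasurable_funM; last exact/measurable_EFinP.
  apply: (measurable_fun_fubini_tonelli_G (fun p : X * X => (Q p.1 p.2)%:E)).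
  + exact/measurable_EFinP.
  + by move=> p; rewrite lee_fin.
- by apply/measurable_EFinP; exact: measurable_funM.
- by move=> y _; rewrite EFinM lee_wpmul2r// lee_fin.
Qed.

Section potentials.
Context (R : realType) d (X : measurableType d) dY (Y : measurableType dY).
Variable mu : {sigma_finite_measure set X -> \bar R}.
Variable nu : {sigma_finite_measure set Y -> \bar R}.
Local Open Scope ereal_scope.

Lemma measurable_iterated_integral dZ (Z : measurableType dZ) (A : Z -> Y -> X -> R) :
  measurable_fun [set: (Z * Y) * X] (fun p => A p.1.1 p.1.2 p.2) ->
  (forall z s y, 0 <= A z s y)%R ->
  measurable_fun [set: Z * Y] (fun p => \int[mu]_y (A p.1 p.2 y)%:E) /\
  measurable_fun [set: Z] (fun z => \int[nu]_s \int[mu]_y (A z s y)%:E).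
Proof.
move=> mA A0.
have mi : measurable_fun [set: Z * Y] (fun p => \int[mu]_y (A p.1 p.2 y)%:E).
  apply: (measurable_fun_fubini_tonelli_F (fun p : (Z * Y) * X => (A p.1.1 p.1.2 p.2)%:E)).
  - exact/measurable_EFinP.
  - by move=> p; rewrite lee_fin.
split=> //.
apply: (measurable_fun_fubini_tonelli_F (fun p : Z * Y => \int[mu]_y (A p.1 p.2 y)%:E)) => //.
by move=> p; apply: integral_ge0 => y _; rewrite lee_fin.
Qed.

Lemma measurable_inner_integral (A : Y -> X -> R) :
  measurable_fun [set: Y * X] (fun p => A p.1 p.2) ->
  (forall s y, 0 <= A s y)%R ->
  measurable_fun [set: Y] (fun s => \int[mu]_y (A s y)%:E).
Proof.
move=> mA A0.
apply: (measurable_fun_fubini_tonelli_F (fun p : Y * X => (A p.1 p.2)%:E)).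
- exact/measurable_EFinP.
- by move=> p; rewrite lee_fin.
Qed.

Lemma iterated_integral_dist (A B : Y -> X -> R) :
  measurable_fun [set: Y * X] (fun p => A p.1 p.2) ->
  measurable_fun [set: Y * X] (fun p => B p.1 p.2) ->
  (forall s y, 0 <= A s y)%R -> (forall s y, 0 <= B s y)%R ->
  \int[nu]_s \int[mu]_y (A s y)%:E < +oo ->
  \int[nu]_s \int[mu]_y (B s y)%:E < +oo ->
  (`|fine (\int[nu]_s \int[mu]_y (A s y)%:E) -
     fine (\int[nu]_s \int[mu]_y (B s y)%:E)|)%R%:E <=
  \int[nu]_s \int[mu]_y (`|A s y - B s y|)%R%:E.
Proof.
move=> mA mB A0 B0.
have iE (C : Y -> X -> R) : measurable_fun [set: Y * X] (fun p => C p.1 p.2) ->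
    (forall s y, 0 <= C s y)%R ->
    \int[nu]_s \int[mu]_y (C s y)%:E = \int[nu \x mu]_p (C p.1 p.2)%:E.
  move=> mC C0; rewrite (fubini_tonelli1 (fun p : Y * X => (C p.1 p.2)%:E))//.
  - exact/measurable_EFinP.
  - by move=> p; rewrite lee_fin.
have mAB : measurable_fun [set: Y * X] (fun p => `|A p.1 p.2 - B p.1 p.2|)%R.
  by apply: measurableT_comp => //; exact: measurable_funB.
rewrite (iE A)// (iE B)// (iE (fun s y => `|A s y - B s y|%R))//.
exact: ge0_integral_dist.
Qed.

(** Schur's test in the supremum norm and in L1: both norms of the operator are
controlled by the mass of the kernel, in the second and in the first space
variable respectively. *)
Lemma potential_le_sup (Q : Y -> X -> R) (h : Y -> X -> R) (om M : Y -> R) :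
  measurable_fun [set: Y * X] (fun p => Q p.1 p.2) ->
  measurable_fun [set: Y * X] (fun p => h p.1 p.2) ->
  measurable_fun [set: Y] om -> measurable_fun [set: Y] M ->
  (forall s y, 0 <= Q s y)%R -> (forall s y, 0 <= h s y <= M s)%R ->
  (forall s, \int[mu]_y (Q s y)%:E <= (om s)%:E) ->
  \int[nu]_s \int[mu]_y (Q s y * h s y)%:E <= \int[nu]_s (om s * M s)%:E.
Proof.
move=> mQ mh mom mM Q0 hM Qom.
have M0 s : (0 <= M s)%R by have /andP[/le_trans] := hM s point; apply.
have om0 s : (0 <= om s)%R.
  rewrite -lee_fin; apply: le_trans (Qom s).
  by apply: integral_ge0 => y _; rewrite lee_fin.
apply: ge0_le_integral => //.
- by move=> s _; apply: integral_ge0 => y _; rewrite lee_fin mulr_ge0//; case/andP: (hM s y).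
- apply: (measurable_inner_integral (A := fun s y => Q s y * h s y)%R) => //.
    exact: measurable_funM.
  by move=> s y; rewrite mulr_ge0//; case/andP: (hM s y).
- by apply/measurable_EFinP; exact: measurable_funM.
move=> s _; have mQs : measurable_fun setT (Q s).
  exact: (measurableT_comp mQ (measurable_pair1 s)).
have mhs : measurable_fun setT (h s).
  exact: (measurableT_comp mh (measurable_pair1 s)).
apply: (@le_trans _ _ (\int[mu]_y ((Q s y)%:E * (M s)%:E))).
  apply: ge0_le_integral => //.
  - by move=> y _; rewrite lee_fin mulr_ge0//; case/andP: (hM s y).
  - by apply/measurable_EFinP; exact: measurable_funM.
  - by apply/measurable_EFinP; exact: measurable_funM.
  - by move=> y _; rewrite -EFinM lee_fin ler_wpM2l//; case/andP: (hM s y).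
rewrite ge0_integralZr//; last 3 first.
- exact/measurable_EFinP.
- by move=> y _; rewrite lee_fin.
- by rewrite lee_fin.
by rewrite EFinM lee_wpmul2r// lee_fin.
Qed.

Lemma potential_le_mass (Q : Y -> X -> X -> R) (h : Y -> X -> R) (om m : Y -> R) :
  measurable_fun [set: (X * Y) * X] (fun p => Q p.1.2 p.1.1 p.2) ->
  measurable_fun [set: Y * X] (fun p => h p.1 p.2) ->
  measurable_fun [set: Y] om -> measurable_fun [set: Y] m ->
  (forall s x y, 0 <= Q s x y)%R -> (forall s y, 0 <= h s y)%R ->
  (forall s y, \int[mu]_x (Q s x y)%:E <= (om s)%:E) ->
  (forall s, \int[mu]_y (h s y)%:E <= (m s)%:E) ->
  \int[mu]_x \int[nu]_s \int[mu]_y (Q s x y * h s y)%:E <=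
  \int[nu]_s (om s * m s)%:E.
Proof.
move=> mQ mh mom mm Q0 h0 Qom hm.
have m0 s : (0 <= m s)%R.
  rewrite -lee_fin; apply: le_trans (hm s).
  by apply: integral_ge0 => y _; rewrite lee_fin.
have om0 s : (0 <= om s)%R.
  rewrite -lee_fin; apply: le_trans (Qom s point).
  by apply: integral_ge0 => y _; rewrite lee_fin.
have mQh : measurable_fun [set: (X * Y) * X]
    (fun p => Q p.1.2 p.1.1 p.2 * h p.1.2 p.2)%R.
  apply: measurable_funM => //.
  apply: (measurableT_comp (f := fun p : Y * X => h p.1 p.2) mh
    (g := fun p : (X * Y) * X => (p.1.2, p.2))).
  apply: measurable_fun_pair => //.
  exact: (measurableT_comp measurable_snd measurable_fst).
have Qh0 x s y : (0 <= Q s x y * h s y)%R by rewrite mulr_ge0.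
have [mi _] := measurable_iterated_integral (A := fun x s y => Q s x y * h s y)%R mQh Qh0.
rewrite (fubini_tonelli (fun p : X * Y => \int[mu]_y (Q p.2 p.1 y * h p.2 y)%:E))//=; last first.
  by move=> p; apply: integral_ge0 => y _; rewrite lee_fin.
apply: ge0_le_integral => //.
- by move=> s _; apply: integral_ge0 => x _; apply: integral_ge0 => y _; rewrite lee_fin.
- apply: (measurable_fun_fubini_tonelli_G (fun p : X * Y => \int[mu]_y (Q p.2 p.1 y * h p.2 y)%:E)) => //.
  by move=> p; apply: integral_ge0 => y _; rewrite lee_fin.
- by apply/measurable_EFinP; exact: measurable_funM.
move=> s _.
have mxy : measurable_fun [set: X * X] (fun p => ((p.1, s), p.2)).
  by apply: measurable_fun_pair => //; apply: measurable_fun_pair.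
have mhs : measurable_fun setT (h s).
  exact: (measurableT_comp mh (measurable_pair1 s)).
apply: (@le_trans _ _ ((om s)%:E * \int[mu]_y (h s y)%:E)).
  by apply: kernel_mass => //; exact: (measurableT_comp mQ mxy).
by rewrite EFinM lee_wpmul2l// lee_fin.
Qed.

End potentials.

(** * Diffusion kernels and the killed semigroup *)

(** What the fixed point argument uses of the heat kernel. The last field is a
parabolic Harnack bound without shift in space; for the Gaussian it holds with n
the dimension, and it is the only source of regularity in time. *)
Record diffusion_kernel (R : realType) d (X : measurableType d)
    (mu : {measure set X -> \bar R}) (n : nat) (K : R -> X -> X -> R) : Prop := {
  kernel_ge0 : forall t x y, 0 <= K t x y ;
  measurable_kernel : measurable_fun [set: measurableTypeR R * (X * X)]
    (fun p => K p.1 p.2.1 p.2.2) ;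
  integral_kernel : forall t x, 0 < t -> (\int[mu]_y (K t x y)%:E = 1)%E ;
  kernel_sym : forall t x y, K t x y = K t y x ;
  kernel_le : forall t t' x y, 0 < t -> t <= t' ->
    K t x y <= (t' / t) ^+ n * K t' x y }.

(** The diffusion is killed at rate 1. The case t = 0 makes the formula agree by
computation with the heat semigroup of the problem. *)
Definition killed_semigroup (R : realType) d (X : measurableType d)
    (mu : {measure set X -> \bar R}) (K : R -> X -> X -> R) (t : R) (g : X -> R)
    (x : X) : R :=
  if t == 0 then g x else expR (- t) * \int[mu]_y (K t x y * g y).

Section killed_kernel.
Context (R : realType) d (X : measurableType d).
Variable mu : {sigma_finite_measure set X -> \bar R}.
Variables (n : nat) (K : R -> X -> X -> R).
Hypothesis kerK : diffusion_kernel mu n K.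
Local Notation RT := (measurableTypeR R).
Local Notation leb := (@lebesgue_measure R).
Local Notation S := (killed_semigroup mu K).

Implicit Types (t s c M : R) (x y : X) (g : X -> R).

Definition killed_kernel t x y : R := expR (- t) * K t x y.

(** Extended by 0 outside 0 <= s < t, so that the time integral of the Duhamel
term runs over the whole line and kernels at two final times can be subtracted. *)
Definition duhamel_kernel t s x y : R :=
  if (0 <= s) && (s < t) then killed_kernel (t - s) x y else 0.

(** Total mass of duhamel_kernel: the probability of not being killed between s
and t. *)
Definition survival t s : R :=
  if (0 <= s) && (s < t) then expR (- (t - s)) else 0.

Local Notation k := killed_kernel.
Local Notation dk := duhamel_kernel.

Lemma killed_kernel_ge0 t x y : 0 <= k t x y.
Proof. by rewrite mulr_ge0 ?expR_ge0//; exact: (kernel_ge0 kerK). Qed.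

Lemma duhamel_kernel_ge0 t s x y : 0 <= dk t s x y.
Proof. by rewrite /dk; case: ifP => // _; exact: killed_kernel_ge0. Qed.

Lemma survival_ge0 t s : 0 <= survival t s.
Proof. by rewrite /survival; case: ifP => // _; exact: expR_ge0. Qed.

Lemma killed_kernel_sym t x y : k t x y = k t y x.
Proof. by rewrite /k (kernel_sym kerK). Qed.

Lemma duhamel_kernel_sym t s x y : dk t s x y = dk t s y x.
Proof. by rewrite /dk killed_kernel_sym. Qed.

Section measurability.
Context dZ (Z : measurableType dZ).

Lemma measurable_kernel_comp (t : Z -> RT) (x y : Z -> X) :
  measurable_fun setT t -> measurable_fun setT x -> measurable_fun setT y ->
  measurable_fun setT (fun z => K (t z) (x z) (y z)).
Proof.
move=> mt mx my.
apply: (measurableT_comp (measurable_kernel kerK) (g := fun z => (t z, (x z, y z)))).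
by apply: measurable_fun_pair => //; exact: measurable_fun_pair.
Qed.

Lemma measurable_killed_kernel (t : Z -> RT) (x y : Z -> X) :
  measurable_fun setT t -> measurable_fun setT x -> measurable_fun setT y ->
  measurable_fun setT (fun z => k (t z) (x z) (y z)).
Proof.
move=> mt mx my; apply: measurable_funM; last exact: measurable_kernel_comp.
by apply: measurableT_comp => //; exact: measurableT_comp.
Qed.

Lemma measurable_duhamel_kernel (t s : Z -> RT) (x y : Z -> X) :
  measurable_fun setT t -> measurable_fun setT s ->
  measurable_fun setT x -> measurable_fun setT y ->
  measurable_fun setT (fun z => dk (t z) (s z) (x z) (y z)).
Proof.
move=> mt ms mx my; apply: measurable_fun_ifT => //.
  by apply: measurable_and; [exact: measurable_fun_ler|exact: measurable_fun_ltr].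
by apply: measurable_killed_kernel => //; exact: measurable_funB.
Qed.

End measurability.

Lemma measurable_survival t : measurable_fun [set: RT] (survival t).
Proof.
apply: measurable_fun_ifT => //.
  by apply: measurable_and; [exact: measurable_fun_ler|exact: measurable_fun_ltr].
apply: measurableT_comp => //; apply: measurableT_comp => //.
exact: measurable_funB.
Qed.

Lemma integral_killed_kernel t x : 0 < t ->
  (\int[mu]_y (k t x y)%:E = (expR (- t))%:E)%E.
Proof.
move=> t0; rewrite integral_EFinMl ?expR_ge0//.
- by rewrite (integral_kernel kerK)// mule1.
- exact: measurable_kernel_comp.
- exact: (kernel_ge0 kerK).
Qed.

Lemma integral_duhamel_kernel t s x :
  (\int[mu]_y (dk t s x y)%:E = (survival t s)%:E)%E.
Proof.
rewrite /dk /survival; case: ifPn => [/andP[s0 st]|_].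
  by rewrite integral_killed_kernel// subr_gt0.
by rewrite integral0.
Qed.

Lemma integral_duhamel_kernel1 t s y :
  (\int[mu]_x (dk t s x y)%:E = (survival t s)%:E)%E.
Proof. by under eq_integral do rewrite duhamel_kernel_sym; exact: integral_duhamel_kernel. Qed.

(** With b = 2 q - 1 the denominator is 2 q, twice the Lipschitz constant of the
reaction; with b = 0 this is the mass lost to killing. *)
Lemma integral_survivalM t b c : 0 <= t -> 0 < 1 + b -> 0 <= c ->
  (\int[leb]_s (survival t s * (c * expR (b * s)))%:E =
   (c * ((expR (b * t) - expR (- t)) / (1 + b)))%:E)%E.
Proof.
move=> t0 b0 c0.
transitivity (\int[leb]_(s in `[0%R, t[) ((c * expR (- t))%:E * (expR ((1 + b) * s))%:E))%E.
  rewrite [RHS]integral_mkcond; apply: eq_integral => s _.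
  rewrite /patch /survival mem_setE in_itv/=; case: ifP => //= _; last by rewrite mul0r.
  rewrite -EFinM; congr EFin; rewrite mulrCA -expRD -mulrA -expRD; congr (_ * expR _).
  ring.
have mE D : measurable_fun (D : set RT) (fun s : RT => (expR ((1 + b) * s))%:E).
  apply/measurable_EFinP; apply: measurable_funTS; apply: measurableT_comp => //.
rewrite integral_itv_bndo_bndc; last by apply: measurable_funeM; exact: mE.
rewrite ge0_integralZl//; last first.
  by rewrite lee_fin mulr_ge0// expR_ge0.
rewrite integral_expRM// -EFinM; congr EFin.
rewrite -!mulrA; congr (_ * _); rewrite !mulrA; congr (_ / _).
by rewrite mulrBr mulr1 -expRD; congr (expR _ - _); ring.
Qed.

Lemma killed_semigroupE t g x M : 0 < t -> measurable_fun setT g ->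
  (forall y, 0 <= g y <= M) ->
  (S t g x)%:E = (\int[mu]_y (k t x y * g y)%:E)%E.
Proof.
move=> t0 mg gM.
have mKt : measurable_fun setT (K t x) by exact: measurable_kernel_comp.
have M0 : 0 <= M by have /andP[/le_trans] := gM point; apply.
have mKg : measurable_fun setT (fun y => K t x y * g y) by exact: measurable_funM.
have Kg0 y : 0 <= K t x y * g y.
  by rewrite mulr_ge0 ?(kernel_ge0 kerK)//; case/andP: (gM y).
rewrite /S gt_eqF// EFinM /Rintegral fineK; last first.
  rewrite ge0_fin_numE; last by apply: integral_ge0 => y _; rewrite lee_fin.
  apply: (@le_lt_trans _ _ (\int[mu]_y (K t x y * M)%:E)%E).
    apply: le_integral_EFin => //; first exact: measurable_funM.
    by move=> y; rewrite ler_wpM2l ?(kernel_ge0 kerK)//; case/andP: (gM y).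
  rewrite integral_EFinMr//; last exact: (kernel_ge0 kerK).
  by rewrite (integral_kernel kerK)// mul1e ltry.
rewrite -integral_EFinMl ?expR_ge0//.
by under eq_integral do rewrite mulrA.
Qed.

Lemma killed_semigroup_ge0 t g x : (forall y, 0 <= g y) -> 0 <= S t g x.
Proof.
move=> g0; rewrite /S; case: ifP => // _; rewrite mulr_ge0 ?expR_ge0//.
by apply: Rintegral_ge0 => y _; rewrite mulr_ge0 ?(kernel_ge0 kerK).
Qed.

(** An almost everywhere bound on the data gives a bound at every point, because
the kernel has a density. *)
Lemma killed_semigroup_dist t g1 g2 c x : 0 < t ->
  measurable_fun setT g1 -> measurable_fun setT g2 ->
  (forall y, 0 <= g1 y <= 1) -> (forall y, 0 <= g2 y <= 1) ->
  0 <= c -> {ae mu, forall y, `|g1 y - g2 y| <= c} ->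
  `|S t g1 x - S t g2 x| <= expR (- t) * c.
Proof.
move=> t0; wlog suff : g1 g2 / measurable_fun setT g1 -> measurable_fun setT g2 ->
    (forall y, 0 <= g1 y <= 1) -> (forall y, 0 <= g2 y <= 1) ->
    0 <= c -> {ae mu, forall y, `|g1 y - g2 y| <= c} ->
    S t g1 x <= S t g2 x + expR (- t) * c.
  move=> h m1 m2 g1M g2M c0 g12; rewrite ler_norml.
  have g21 : {ae mu, forall y, `|g2 y - g1 y| <= c}.
    by apply: filterS g12 => y; rewrite distrC.
  have := h _ _ m1 m2 g1M g2M c0 g12; have := h _ _ m2 m1 g2M g1M c0 g21.
  by move=> ? ?; apply/andP; split; lra.
move=> m1 m2 g1M g2M c0 g12.
have mk : measurable_fun setT (k t x) by exact: measurable_killed_kernel.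
have kg (g : X -> R) : measurable_fun setT g -> (forall y, 0 <= g y <= 1) ->
    measurable_fun setT (fun y => k t x y * g y) /\ forall y, 0 <= k t x y * g y.
  move=> mg g01; split=> [|y]; first exact: measurable_funM.
  by rewrite mulr_ge0 ?killed_kernel_ge0//; case/andP: (g01 y).
have [mkg1 kg10] := kg _ m1 g1M; have [mkg2 kg20] := kg _ m2 g2M.
rewrite -lee_fin EFinD EFinM -(integral_killed_kernel x t0).
rewrite (killed_semigroupE x t0 m1 g1M) (killed_semigroupE x t0 m2 g2M).
rewrite -integral_EFinMr ?killed_kernel_ge0//; last exact: killed_kernel_ge0.
have mkc : measurable_fun setT (fun y => k t x y * c) by exact: measurable_funM.
have kc0 y : 0 <= k t x y * c by rewrite mulr_ge0 ?killed_kernel_ge0.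
rewrite -integral_EFinD//; apply: ae_ge0_le_integral => //.
- by move=> y _; rewrite lee_fin.
- exact/measurable_EFinP.
- by move=> y _; rewrite lee_fin addr_ge0.
- by apply/measurable_EFinP; exact: measurable_funD.
apply: filterS g12 => y gy _; rewrite lee_fin -mulrDr.
by rewrite ler_wpM2l ?killed_kernel_ge0//; move: gy; rewrite ler_norml => /andP[? ?]; lra.
Qed.

End killed_kernel.

(** * Regularity in time of the kernels *)

Section time_regularity.
Context (R : realType) d (X : measurableType d).
Variable mu : {sigma_finite_measure set X -> \bar R}.
Variables (n : nat) (K : R -> X -> X -> R).
Hypothesis kerK : diffusion_kernel mu n K.
Local Notation RT := (measurableTypeR R).
Local Notation leb := (@lebesgue_measure R).
Local Notation k := (killed_kernel K).
Local Notation dk := (duhamel_kernel K).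
Implicit Types (t s c M eta del : R) (x y : X) (g : X -> R).

(** Relative variation of the killed kernel over a time step del, at times at
least eta. *)
Definition time_modulus eta del : R := (1 + del / eta) ^+ n * expR del - 1.

Lemma time_modulus_ge0 eta del : 0 < eta -> 0 <= del -> 0 <= time_modulus eta del.
Proof.
move=> eta0 del0; rewrite subr_ge0 mulr_ege1//.
  by rewrite exprn_ege1// lerDl divr_ge0// ltW.
by rewrite -[leLHS]expR0 ler_expR.
Qed.

Lemma time_modulus_cvg0 eta : 0 < eta -> time_modulus eta del @[del --> 0] --> 0.
Proof.
move=> eta0; have E0 : time_modulus eta 0 = 0.
  by rewrite /time_modulus mul0r addr0 expr1n expR0 mul1r subrr.
have h : time_modulus eta del @[del --> 0] --> time_modulus eta 0; last by rewrite E0 in h.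
apply: (@cvgB _ R^o); last exact: cvg_cst.
apply: cvgM; last exact: continuous_expR.
apply: (@continuous_comp _ _ _ (fun del : R => 1 + del / eta) (fun z => z ^+ n)).
  by apply: (@cvgD _ R^o); [exact: cvg_cst|apply: cvgMr_tmp; exact: cvg_id].
exact: exprn_continuous.
Qed.

(** The Harnack bound becomes uniform once the earlier time is at least eta, since
t' / t <= 1 + (t' - t) / eta. *)
Lemma killed_kernel_le t t' x y eta : 0 < eta -> eta <= t -> t <= t' ->
  k t x y <= (1 + time_modulus eta (t' - t)) * k t' x y.
Proof.
move=> eta0 etat tt'; have t0 : 0 < t by exact: lt_le_trans etat.
rewrite /time_modulus addrC subrK /killed_kernel.
rewrite (_ : _ * (_ * _) = expR (t' - t) * expR (- t') * ((1 + (t' - t) / eta) ^+ n * K t' x y)); last by ring.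
rewrite -expRD (_ : t' - t - t' = - t); last by ring.
rewrite ler_wpM2l ?expR_ge0//; apply: le_trans (kernel_le kerK x y t0 tt') _.
rewrite ler_wpM2r ?(kernel_ge0 kerK)// lerXn2r// ?nnegrE.
- by rewrite divr_ge0// ltW// (lt_le_trans t0).
- by rewrite addr_ge0// divr_ge0 ?subr_ge0// ltW.
rewrite (_ : t' / t = 1 + (t' - t) / t); last by field; rewrite gt_eqF.
by rewrite lerD2l ler_wpM2l ?subr_ge0// lef_pV2 ?posrE.
Qed.

(** The later kernel has at most the mass of the earlier one, so the pointwise
one-sided comparison already controls the L1 distance. *)
Lemma killed_kernel_dist t t' x eta : 0 < eta -> eta <= t -> eta <= t' ->
  (\int[mu]_y (`|k t' x y - k t x y|)%:E <= (2 * time_modulus eta `|t' - t|)%:E)%E.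
Proof.
move=> eta0; wlog tt' : t t' / t <= t' => [h etat etat'|].
  have [tt'|/ltW t't] := leP t t'; first exact: h.
  rewrite distrC; under eq_integral do rewrite distrC.
  exact: h.
move=> etat etat'; rewrite ger0_norm ?subr_ge0//.
have t0 : 0 < t by exact: lt_le_trans etat.
have t'0 : 0 < t' by exact: lt_le_trans etat'.
set E := time_modulus _ _; have E0 : 0 <= E by rewrite time_modulus_ge0// subr_ge0.
have k0 r z : 0 <= k r x z by exact: (killed_kernel_ge0 kerK).
have mk r : measurable_fun setT (k r x) by exact: (measurable_killed_kernel kerK).
have md : measurable_fun setT (fun y => `|k t' x y - k t x y|).
  by apply: measurableT_comp => //; exact: measurable_funB.
have le y : `|k t' x y - k t x y| + k t x y <= (2 * E + 1) * k t' x y.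
  have := killed_kernel_le x y eta0 etat tt'; rewrite -/E => kk.
  have Ek : 0 <= E * k t' x y by rewrite mulr_ge0.
  by have [?|?] := leP (k t x y) (k t' x y);
    [rewrite ger0_norm ?subr_ge0//|rewrite ltr0_norm ?subr_lt0//]; nra.
have : (\int[mu]_y (`|k t' x y - k t x y| + k t x y)%:E <=
        \int[mu]_y ((2 * E + 1) * k t' x y)%:E)%E.
  apply: le_integral_EFin => //; first exact: measurable_funD.
  - exact: measurable_funM.
  - by move=> y; rewrite addr_ge0.
rewrite integral_EFinD// (integral_EFinMl mu (f := k t' x)) ?addr_ge0 ?mulr_ge0//.
rewrite !(integral_killed_kernel kerK)// -EFinM => h.
have fi : (\int[mu]_y (`|k t' x y - k t x y|)%:E)%E \is a fin_num.
  rewrite ge0_fin_numE; last by apply: integral_ge0 => y _; rewrite lee_fin.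
  apply: le_lt_trans (ltry ((2 * E + 1) * expR (- t'))); apply: le_trans h.
  by rewrite leeDl// lee_fin expR_ge0.
rewrite -(fineK fi) -EFinD !lee_fin in h *.
have : expR (- t') <= expR (- t) by rewrite ler_expR lerN2.
have : expR (- t') <= 1 by rewrite -[leRHS]expR0 ler_expR; lra.
have := expR_ge0 (- t'); nra.
Qed.

(** The kernel is singular when the elapsed time vanishes: for s within eta of
the final time the crude bound 2 by masses is used, and for earlier s the
relative variation. *)
Definition duhamel_modulus eta t t' s : R :=
  2 * \1_`[t - eta, t'] s + 2 * time_modulus eta (t' - t) * \1_`[0, t] s.

Lemma measurable_duhamel_modulus eta t t' :
  measurable_fun [set: RT] (duhamel_modulus eta t t').
Proof.
by apply: measurable_funD; apply: measurable_funM => //;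
  apply: measurable_indic; exact: measurable_itv.
Qed.

Lemma integral_duhamel_modulus eta t t' : 0 < eta -> 0 <= t -> t <= t' ->
  (\int[leb]_s (duhamel_modulus eta t t' s)%:E =
   (2 * (t' - t + eta) + 2 * time_modulus eta (t' - t) * t)%:E)%E.
Proof.
move=> eta0 t0 tt'; have E0 : 0 <= time_modulus eta (t' - t).
  by rewrite time_modulus_ge0// subr_ge0.
have mI a b : measurable_fun [set: RT] (\1_`[a, b] : R -> R).
  by apply: measurable_indic; exact: measurable_itv.
have iI a b : a <= b -> (\int[leb]_s (\1_`[a, b] s)%:E = (b - a)%:E)%E.
  move=> ab; rewrite integral_indic ?setIT//.
  rewrite [LHS](_ : _ = @lebesgue_measure R [set` `[a, b]])//.
  rewrite lebesgue_measure_itv/= lte_fin; case: ltP => // ba.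
  by rewrite (@le_anti _ _ a b) ?ab// subrr.
rewrite integral_EFinD//; last 3 first.
- by apply: measurable_funM.
- by apply: measurable_funM.
- by move=> s; rewrite mulr_ge0// mulr_ge0.
rewrite !integral_EFinMl// ?mulr_ge0// !iI// ?subr0; last by lra.
by rewrite -!EFinM -EFinD; congr EFin; ring.
Qed.

Lemma duhamel_kernel_dist eta t t' s x : 0 < eta -> 0 <= t -> t <= t' ->
  (\int[mu]_y (`|dk t' s x y - dk t s x y|)%:E <=
   (duhamel_modulus eta t t' s)%:E)%E.
Proof.
move=> eta0 t0 tt'; have E0 : 0 <= time_modulus eta (t' - t).
  by rewrite time_modulus_ge0// subr_ge0.
have mdk r : measurable_fun setT (dk r s x) by exact: (measurable_duhamel_kernel kerK).
have rough a b : 0 <= a -> 0 <= b -> (\int[mu]_y (dk t' s x y)%:E <= a%:E)%E ->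
    (\int[mu]_y (dk t s x y)%:E <= b%:E)%E ->
    (\int[mu]_y (`|dk t' s x y - dk t s x y|)%:E <= (a + b)%:E)%E.
  move=> a0 b0 ha hb; rewrite EFinD; apply: le_trans (leeD ha hb).
  rewrite -integral_EFinD//; last 2 first.
  - by move=> y; exact: (duhamel_kernel_ge0 kerK).
  - by move=> y; exact: (duhamel_kernel_ge0 kerK).
  apply: le_integral_EFin => //.
  - by apply: measurableT_comp => //; exact: measurable_funB.
  - exact: measurable_funD.
  - move=> y; apply: le_trans (ler_normB _ _) _.
    by rewrite !ger0_norm ?(duhamel_kernel_ge0 kerK).
have surv1 r : survival r s <= 1.
  rewrite /survival; case: ifP => // /andP[_ sr].
  by rewrite -[leRHS]expR0 ler_expR; lra.
have surv0 r : 0 <= survival r s by exact: survival_ge0.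
have I0 a b : 0 <= (\1_`[a, b] s : R) by rewrite indicE.
have I1 a b : a <= s <= b -> (\1_`[a, b] s : R) = 1.
  by move=> h; rewrite indicE mem_setE in_itv/= h.
have [st|ts] := leP (t - eta) s.
  have [st'|t's] := leP s t'.
    apply: (@le_trans _ _ (1 + 1)%:E).
      by apply: rough => //; rewrite (integral_duhamel_kernel kerK) lee_fin.
    rewrite lee_fin /duhamel_modulus I1 ?st//.
    by have := I0 0 t; nra.
  apply: (@le_trans _ _ (0 + 0)%:E).
    apply: rough => //; rewrite (integral_duhamel_kernel kerK) lee_fin /survival.
    - by rewrite (ltNge s) (ltW t's) andbF.
    - by rewrite (ltNge s) (le_trans tt' (ltW t's)) andbF.
  rewrite lee_fin addr0 /duhamel_modulus addr_ge0 ?mulr_ge0//.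
have [s0|s0] := leP 0 s; last first.
  rewrite /dk !(leNgt 0) s0/= subr0 normr0 integral0 lee_fin.
  by rewrite /duhamel_modulus addr_ge0 ?mulr_ge0.
have tst : s < t by lra.
have tst' : s < t' by lra.
rewrite /dk s0 tst tst'/=.
have h := @killed_kernel_dist (t - s) (t' - s) x eta eta0.
apply: le_trans (h _ _) _; [lra|lra|].
rewrite lee_fin (_ : t' - s - (t - s) = t' - t); last by ring.
rewrite ger0_norm ?subr_ge0// /duhamel_modulus (I1 0 t) ?s0 ?(ltW tst)// mulr1.
by rewrite lerDr mulr_ge0.
Qed.

End time_regularity.

(** * The Duhamel term *)

(** What is used of the reaction: it is nonnegative and subcritical, f v <= v, so
that with killing at rate 1 the interval [0, M] is invariant for each M <= 1. *)
Record unit_lipschitz (R : realType) (q : R) (f : R -> R) : Prop := {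
  lipschitz_gt1 : 1 < q ;
  unit_lipschitz_ge0 : forall v, 0 <= v <= 1 -> 0 <= f v ;
  unit_lipschitz_le : forall v, 0 <= v <= 1 -> f v <= v ;
  unit_lipschitz_dist : forall v w, 0 <= v <= 1 -> 0 <= w <= 1 ->
    `|f v - f w| <= q * `|v - w| }.

(** Nothing is known of f outside [0, 1], so it is composed with the projection
onto [0, 1], which makes it continuous on the line. *)
Lemma measurable_unit_lipschitz (R : realType) (q : R) (f : R -> R) d
  (Z : measurableType d) (g : Z -> R) : unit_lipschitz q f ->
  measurable_fun setT g -> (forall z, 0 <= g z <= 1) ->
  measurable_fun setT (f \o g).
Proof.
move=> lf mg g01; pose c (v : R) := Num.max 0 (Num.min 1 v).
have c01 v : 0 <= c v <= 1 by rewrite /c le_max lexx/= ge_max ler01 ge_min lexx.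
have cE v : [\/ v <= 0 /\ c v = 0, 1 <= v /\ c v = 1 | 0 <= v <= 1 /\ c v = v].
  rewrite /c; have /orP[v0|v0] := le_total v 0.
    by apply: Or31; split=> //; rewrite min_r ?max_l//; lra.
  have /orP[v1|v1] := le_total 1 v; first by apply: Or32; split=> //; rewrite min_l// max_r.
  by apply: Or33; rewrite v0 v1 min_r// max_r.
have cdist v w : `|c v - c w| <= `|v - w|.
  have [[? ->]|[? ->]|[/andP[? ?] ->]] := cE v;
  have [[? ->]|[? ->]|[/andP[? ?] ->]] := cE w; rewrite ler_norml;
  (have [?|?] := leP 0 (v - w); [rewrite ger0_norm//|rewrite ltr0_norm//]);
  apply/andP; split; lra.
have -> : f \o g = (f \o c) \o g.
  apply/funext => z /=; congr f; rewrite /c; have /andP[g0 g1] := g01 z.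
  by rewrite min_r// max_r.
apply: measurableT_comp => //; apply: continuous_measurable_fun => v.
have q0 : 0 < q by apply: lt_trans ltr01 (lipschitz_gt1 lf).
apply/(@cvgrPdist_le _ R^o) => e e0; near=> w.
apply: le_trans (unit_lipschitz_dist lf (c01 v) (c01 w)) _.
rewrite -ler_pdivlMl//; apply: le_trans (cdist v w) _.
near: w; apply: (@cvgr_dist_le _ R^o); first exact: cvg_id.
by rewrite mulr_gt0// invr_gt0.
Unshelve. all: by end_near. Qed.

Section duhamel.
Context (R : realType) d (X : measurableType d).
Variable mu : {sigma_finite_measure set X -> \bar R}.
Variables (n : nat) (K : R -> X -> X -> R).
Hypothesis kerK : diffusion_kernel mu n K.
Local Notation RT := (measurableTypeR R).
Local Notation leb := (@lebesgue_measure R).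
Local Notation S := (killed_semigroup mu K).
Local Notation k := (killed_kernel K).
Local Notation dk := (duhamel_kernel K).
Implicit Types (t s c M eta del : R) (x y : X) (g : X -> R) (h u v w : R -> X -> R).

(** Joint measurability, with the Borel sigma-algebra on the time axis. *)
Definition measurable_field h :=
  measurable_fun [set: RT * X] (fun p => h p.1 p.2).

Definition duhamel h t x : R := \int[leb]_(s in `[0, t]) S (t - s) (h s) x.

(** The same integral as an iterated integral of nonnegative functions over the
whole space, where Tonelli applies without integrability conditions. *)
Definition eduhamel h t x : \bar R :=
  (\int[leb]_s \int[mu]_y (dk t s x y * h s y)%:E)%E.

Lemma measurable_field_section h s : measurable_field h -> measurable_fun setT (h s).
Proof. by move=> mh; exact: (measurableT_comp mh (measurable_pair1 s)). Qed.

Lemma killed_semigroup_le t g x M : 0 <= t -> measurable_fun setT g ->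
  (forall y, 0 <= g y <= M) -> S t g x <= expR (- t) * M.
Proof.
move=> + mg gM; rewrite le_eqVlt => /predU1P[<-|t0].
  by rewrite /S eqxx oppr0 expR0 mul1r; case/andP: (gM x).
have M0 : 0 <= M by have /andP[/le_trans] := gM point; apply.
have mk : measurable_fun setT (k t x) by exact: (measurable_killed_kernel kerK).
rewrite -lee_fin EFinM -(integral_killed_kernel kerK x t0).
rewrite (killed_semigroupE kerK x t0 mg gM) -integral_EFinMr//; last first.
  by move=> y; exact: (killed_kernel_ge0 kerK).
apply: le_integral_EFin => //; [exact: measurable_funM|exact: measurable_funM| |].
- by move=> y; rewrite mulr_ge0 ?(killed_kernel_ge0 kerK)//; case/andP: (gM y).
- by move=> y; rewrite ler_wpM2l ?(killed_kernel_ge0 kerK)//; case/andP: (gM y).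
Qed.

Lemma killed_semigroup01 t g x : 0 <= t -> measurable_fun setT g ->
  (forall y, 0 <= g y <= 1) -> 0 <= S t g x <= 1.
Proof.
move=> t0 mg g01; rewrite (killed_semigroup_ge0 kerK)/=; last first.
  by move=> y; case/andP: (g01 y).
apply: le_trans (killed_semigroup_le x t0 mg g01) _.
by rewrite mulr1 -[leRHS]expR0 ler_expR; lra.
Qed.

Lemma measurable_semigroup_field g : measurable_fun setT g -> (forall y, 0 <= g y) ->
  measurable_fun [set: RT * X] (fun p => S p.1 g p.2).
Proof.
move=> mg g0; apply: measurable_fun_ifT => /=.
- exact: measurable_fun_eqr.
- exact: measurableT_comp.
- apply: measurable_funM.
    by apply: measurableT_comp => //; exact: measurableT_comp.
  apply: measurableT_comp => //.
  apply: (@measurable_inner_integral R d X _ (RT * X)%type mu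
    (fun p y => K p.1 p.2 y * g y)).
    apply: measurable_funM; last exact: measurableT_comp.
    apply: (measurable_kernel_comp kerK) => //.
    + exact: (measurableT_comp measurable_fst measurable_fst).
    + exact: (measurableT_comp measurable_snd measurable_fst).
  by move=> p y; rewrite mulr_ge0 ?(kernel_ge0 kerK).
Qed.

Lemma measurable_semigroup t g : measurable_fun setT g -> (forall y, 0 <= g y) ->
  measurable_fun setT (S t g).
Proof.
move=> mg g0.
exact: (measurableT_comp (measurable_semigroup_field mg g0) (measurable_pair1 (t : RT))).
Qed.

Lemma measurable_duhamel_density h x t : measurable_field h ->
  measurable_fun [set: RT * X] (fun p => dk t p.1 x p.2 * h p.1 p.2).
Proof. by move=> mh; apply: measurable_funM => //; exact: (measurable_duhamel_kernel kerK). Qed.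

Lemma eduhamel_ge0 h t x : (forall s y, 0 <= h s y) -> (0 <= eduhamel h t x)%E.
Proof.
move=> h0; apply: integral_ge0 => s _; apply: integral_ge0 => y _.
by rewrite lee_fin mulr_ge0 ?(duhamel_kernel_ge0 kerK).
Qed.

Lemma eduhamel_le h t x M : 0 <= t -> measurable_field h ->
  (forall s y, 0 <= h s y <= M) -> (eduhamel h t x <= (M * (1 - expR (- t)))%:E)%E.
Proof.
move=> t0 mh hM.
have M0 : 0 <= M by have /andP[/le_trans] := hM 0 point; apply.
have -> : (M * (1 - expR (- t)))%:E =
    (\int[leb]_s (survival t s * (M * expR (0 * s)))%:E)%E.
  by rewrite integral_survivalM ?addr0// mul0r expR0 divr1.
apply: potential_le_sup => //.
- exact: (measurable_duhamel_kernel kerK).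
- exact: measurable_survival.
- apply: measurable_funM => //; apply: measurableT_comp => //; exact: measurable_funM.
- by move=> s y; exact: (duhamel_kernel_ge0 kerK).
- by move=> s y; rewrite mul0r expR0 mulr1.
- by move=> s; rewrite (integral_duhamel_kernel kerK).
Qed.

Lemma eduhamel_lty h t x : 0 <= t -> measurable_field h ->
  (forall s y, 0 <= h s y <= 1) -> (eduhamel h t x < +oo)%E.
Proof. by move=> t0 mh h01; exact: le_lt_trans (eduhamel_le x t0 mh h01) (ltry _). Qed.

Lemma measurable_eduhamel h : measurable_field h -> (forall s y, 0 <= h s y) ->
  measurable_fun [set: RT * X] (fun p => eduhamel h p.1 p.2).
Proof.
move=> mh h0.
have [] := @measurable_iterated_integral R d X _ RT mu leb _ (RT * X)%type
  (fun z s y => dk z.1 s z.2 y * h s y); last by [].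
- apply: measurable_funM.
    apply: (measurable_duhamel_kernel kerK) => //.
    + exact: (measurableT_comp measurable_fst (measurableT_comp measurable_fst measurable_fst)).
    + exact: (measurableT_comp measurable_snd measurable_fst).
    + exact: (measurableT_comp measurable_snd (measurableT_comp measurable_fst measurable_fst)).
  apply: (measurableT_comp mh (g := fun p : ((RT * X) * RT) * X => (p.1.2, p.2))).
  apply: measurable_fun_pair => //.
  exact: (measurableT_comp measurable_snd measurable_fst).
- by move=> z s y; rewrite mulr_ge0 ?(duhamel_kernel_ge0 kerK).
Qed.

Section integrand.
Variables (h : R -> X -> R) (t : R) (x : X).
Hypotheses (mh : measurable_field h) (h01 : forall s y, 0 <= h s y <= 1).

Let duhamel_integrandE s : 0 <= s -> s < t ->
  (S (t - s) (h s) x)%:E = (\int[mu]_y (dk t s x y * h s y)%:E)%E.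
Proof.
move=> s0 st; have ts0 : 0 < t - s by rewrite subr_gt0.
rewrite (killed_semigroupE kerK x ts0 (measurable_field_section s mh) (h01 s)).
by rewrite /duhamel_kernel s0 st.
Qed.

Let measurable_density_integral :
  measurable_fun [set: RT] (fun s => (\int[mu]_y (dk t s x y * h s y)%:E)%E).
Proof.
apply: (@measurable_inner_integral R d X _ RT mu (fun s y => dk t s x y * h s y)).
  exact: measurable_duhamel_density.
by move=> s y; rewrite mulr_ge0 ?(duhamel_kernel_ge0 kerK)//; case/andP: (h01 s y).
Qed.

Lemma measurable_duhamel_integrand :
  measurable_fun (`[0, t]%classic : set RT) (fun s => S (t - s) (h s) x).
Proof.
apply: (eq_measurable_fun (fun s => if s < t
  then fine (\int[mu]_y (dk t s x y * h s y)%:E)%E else h s x)).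
  move=> s; rewrite inE/= in_itv/= => /andP[s0]; rewrite le_eqVlt => /predU1P[->|st].
    by rewrite ltxx subrr /killed_semigroup eqxx.
  by rewrite st -duhamel_integrandE.
apply: measurable_funTS; apply: measurable_fun_ifT.
- exact: measurable_fun_ltr.
- by apply: measurableT_comp => //; exact: measurable_density_integral.
- exact: (measurableT_comp mh (measurable_pair2 x)).
Qed.

Lemma duhamelE : 0 <= t -> (duhamel h t x)%:E = eduhamel h t x.
Proof.
move=> t0; have E : eduhamel h t x = (\int[leb]_(s in `[0%R, t]) (S (t - s) (h s) x)%:E)%E.
  rewrite -integral_itv_bndo_bndc; last first.
    apply/measurable_EFinP; apply: measurable_funS measurable_duhamel_integrand => //.
    by move=> s /=; rewrite !in_itv/= => /andP[-> /ltW].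
  rewrite [RHS]integral_mkcond; apply: eq_integral => s _.
  rewrite /patch mem_setE in_itv/=; case: ifPn => [/andP[s0 st]|st].
    by rewrite duhamel_integrandE.
  by rewrite /duhamel_kernel (negbTE st); under eq_integral do rewrite mul0r; rewrite integral0.
rewrite /duhamel /Rintegral -E fineK// ge0_fin_numE; first exact: eduhamel_lty.
by apply: eduhamel_ge0 => s y; case/andP: (h01 s y).
Qed.

End integrand.

Lemma duhamel_fine h t x : 0 <= t -> measurable_field h ->
  (forall s y, 0 <= h s y <= 1) -> duhamel h t x = fine (eduhamel h t x).
Proof. by move=> t0 mh h01; rewrite -duhamelE. Qed.

Lemma measurable_duhamel h t : 0 <= t -> measurable_field h ->
  (forall s y, 0 <= h s y <= 1) -> measurable_fun setT (duhamel h t).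
Proof.
move=> t0 mh h01; rewrite (_ : duhamel h t = fun x => fine (eduhamel h t x)); last first.
  by apply/funext => x; exact: duhamel_fine.
apply: measurableT_comp => //.
apply: (measurableT_comp (measurable_eduhamel mh _) (measurable_pair1 (t : RT))).
by move=> s y; case/andP: (h01 s y).
Qed.

Lemma duhamel_ge0 h t x : 0 <= t -> measurable_field h ->
  (forall s y, 0 <= h s y <= 1) -> 0 <= duhamel h t x.
Proof.
move=> t0 mh h01; rewrite -lee_fin duhamelE//; apply: eduhamel_ge0 => s y.
by case/andP: (h01 s y).
Qed.

Section contraction.
Variables (q : R) (f : R -> R).
Hypothesis lf : unit_lipschitz q f.

(** Only the time slices of v are measurable, so the time integral of v may be
a lower integral; the sandwich estimate suffices because w is jointly
measurable. The weight expR ((2 * q - 1) * s) makes the map a contraction of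
ratio 1/2 on the whole half-line, because against the decay of the survival
probability its time integral gains the factor 1 / (2 * q). *)
Lemma duhamel_contraction v w t x C : 0 <= t -> 0 <= C ->
  (forall s, 0 <= s -> measurable_fun setT (v s)) ->
  (forall s y, 0 <= s -> 0 <= v s y <= 1) ->
  measurable_field w -> (forall s y, 0 <= w s y <= 1) ->
  (forall s, 0 <= s ->
    {ae mu, forall y, `|v s y - w s y| <= C * expR ((2 * q - 1) * s)}) ->
  `|duhamel (fun s => f \o v s) t x - duhamel (fun s => f \o w s) t x| <=
    C / 2 * expR ((2 * q - 1) * t).
Proof.
move=> t0 C0 mv v01 mw w01 vw.
have q0 : 0 < q by apply: lt_trans ltr01 (lipschitz_gt1 lf).
have f01 r : 0 <= r <= 1 -> 0 <= f r <= 1.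
  move=> r01; rewrite (unit_lipschitz_ge0 lf)//=.
  by apply: le_trans (unit_lipschitz_le lf r01) _; case/andP: r01.
have mfw : measurable_field (fun s => f \o w s).
  by apply: (measurable_unit_lipschitz (g := fun p : RT * X => w p.1 p.2) lf).
have fw01 s y : 0 <= (f \o w s) y <= 1 by exact: f01.
(* The indicator of t covers the end point of the interval: there the semigroup is
the identity, so the bound on v - w, which holds almost everywhere in space, says
nothing about the given point x. *)
pose H (s : R) := \1_[set t] s + q * C * expR (- t) * expR (2 * q * s).
have qC0 : 0 <= q * C * expR (- t) by rewrite mulr_ge0 ?expR_ge0// mulr_ge0// ltW.
have m1 : measurable_fun [set: RT] (fun s => q * C * expR (- t) * expR (2 * q * s)).
  by apply: measurable_funM => //; apply: measurableT_comp => //; exact: measurable_funM.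
have m2 : measurable_fun [set: RT] (\1_[set t] : R -> R).
  by apply: measurable_indic; exact: measurable_set1.
have intH : (\int[leb]_(s in `[0%R, t]) (H s)%:E =
    (q * C * expR (- t) * ((expR (2 * q * t) - 1) / (2 * q)))%:E)%E.
  under eq_integral do rewrite /H EFinD EFinM.
  rewrite ge0_integralD//; last 3 first.
  - by apply/measurable_EFinP; exact: measurable_funTS.
  - by move=> s _; rewrite -EFinM lee_fin mulr_ge0 ?expR_ge0.
  - by apply/measurable_EFinP; exact: measurable_funTS.
  rewrite integral_indic//=.
  rewrite (_ : leb _ = 0%E) ?add0e; last first.
    apply: (@subset_measure0 _ _ _ leb _ [set t]) => //; last by exact: lebesgue_measure_set1.
    by apply: measurableI => //; exact: measurable_set1.
  rewrite ge0_integralZl//; last first.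
    by apply/measurable_EFinP; apply: measurable_funTS; apply: measurableT_comp.
  by rewrite integral_expRM// mulr_gt0.
rewrite -lee_fin; apply: le_trans.
  apply: (@Rintegral_sandwich _ RT R leb `[0, t]%classic
    (fun s => S (t - s) (f \o v s) x) (fun s => S (t - s) (f \o w s) x) H) => //.
  - by rewrite /= lebesgue_measure_itv/=; case: ifP => // _; rewrite -EFinB ltry.
  - exact: measurable_duhamel_integrand.
  - by apply: measurable_funTS; exact: measurable_funD.
  - move=> s; rewrite /= in_itv/= => /andP[s0 st]; apply: killed_semigroup01.
    + by rewrite subr_ge0.
    + by apply: (measurable_unit_lipschitz lf); [exact: mv|move=> y; exact: v01].
    + by move=> y; apply: f01; exact: v01.
  - move=> s; rewrite /= in_itv/= => /andP[s0 st]; apply: killed_semigroup01 => //.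
    + by rewrite subr_ge0.
    + exact: (measurable_field_section (h := fun s => f \o w s)).
  - move=> s; rewrite /= in_itv/= => /andP[s0]; rewrite le_eqVlt => /predU1P[->|st].
      rewrite /killed_semigroup subrr eqxx /H indicE mem_set//=.
      have := f01 _ (v01 t x t0); have := fw01 t x.
      have : 0 <= q * C * expR (- t) * expR (2 * q * t) by rewrite mulr_ge0 ?expR_ge0.
      rewrite /= ler_norml => ? /andP[? ?] /andP[? ?]; apply/andP; split; lra.
    rewrite /H; apply: (@le_trans _ _ (q * C * expR (- t) * expR (2 * q * s))); last first.
      by rewrite lerDr indicE.
    rewrite (_ : _ * expR (2 * q * s) =
      expR (- (t - s)) * (q * (C * expR ((2 * q - 1) * s)))); last first.
      rewrite (_ : expR (2 * q * s) = expR s * expR ((2 * q - 1) * s)); last first.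
        by rewrite -expRD; congr expR; ring.
      by rewrite opprB expRD; ring.
    apply: (killed_semigroup_dist kerK).
    + by rewrite subr_gt0.
    + by apply: (measurable_unit_lipschitz lf); [exact: mv|move=> y; exact: v01].
    + exact: (measurable_field_section (h := fun s => f \o w s)).
    + by move=> y; apply: f01; exact: v01.
    + exact: fw01.
    + by rewrite mulr_ge0 ?mulr_ge0 ?expR_ge0// ltW.
    + apply: filterS (vw s s0) => y vwy /=.
      apply: le_trans (unit_lipschitz_dist lf (v01 _ y s0) (w01 s y)) _.
      by rewrite ler_pM2l.
  - by rewrite intH ltry.
rewrite intH lee_fin (_ : expR ((2 * q - 1) * t) = expR (- t) * expR (2 * q * t)); last first.
  by rewrite -expRD; congr expR; ring.
rewrite (_ : _ * (_ / _) = C / 2 * (expR (- t) * (expR (2 * q * t) - 1))); last first.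
  by field; rewrite gt_eqF.
rewrite ler_wpM2l ?divr_ge0// ler_wpM2l ?expR_ge0//; lra.
Qed.

End contraction.
End duhamel.

(** * Picard iteration *)

Section picard.
Context (R : realType) d (X : measurableType d).
Variable mu : {sigma_finite_measure set X -> \bar R}.
Variables (n : nat) (K : R -> X -> X -> R).
Hypothesis kerK : diffusion_kernel mu n K.
Variables (q : R) (f : R -> R).
Hypothesis lf : unit_lipschitz q f.
Variable phi : X -> R.
Hypothesis mphi : measurable_fun setT phi.
Variable M : R.
Hypotheses (phiM : forall x, 0 <= phi x <= M) (M1 : M <= 1).
Local Notation RT := (measurableTypeR R).
Local Notation S := (killed_semigroup mu K).
Local Notation D := (duhamel mu K).
Implicit Types (t s c eta del : R) (x y : X) (g : X -> R) (h u v w : R -> X -> R).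

Let M0 : 0 <= M. Proof. by have /andP[/le_trans] := phiM point; apply. Qed.

Let phi01 x : 0 <= phi x <= 1.
Proof. by have /andP[-> /le_trans/=] := phiM x; apply. Qed.

Let q0 : 0 < q. Proof. exact: lt_trans ltr01 (lipschitz_gt1 lf). Qed.

(** Extended by 0 to negative times, which keeps the iterates jointly measurable
on the whole time axis. *)
Fixpoint picard m : R -> X -> R :=
  if m is m'.+1 then fun t x =>
    if 0 <= t then S t phi x + D (fun s => f \o picard m' s) t x else 0
  else fun _ _ => 0.

Let f_range (r : R) c : c <= 1 -> 0 <= r <= c -> 0 <= f r <= c.
Proof.
move=> c1 /andP[v0 vc]; have v1 : 0 <= r <= 1 by rewrite v0 (le_trans vc).
by rewrite (unit_lipschitz_ge0 lf)//= (le_trans (unit_lipschitz_le lf v1)).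
Qed.

Lemma measurable_field_reaction h : measurable_field h ->
  (forall s y, 0 <= h s y <= 1) -> measurable_field (fun s => f \o h s).
Proof.
move=> mh h01.
by apply: (measurable_unit_lipschitz (g := fun p : RT * X => h p.1 p.2) lf).
Qed.

Lemma picard_lt0 m t : t < 0 -> picard m t = fun=> 0.
Proof. by move=> t0; case: m => // m; apply/funext => x /=; rewrite leNgt t0. Qed.

(** Invariance of [0, M]: the semigroup contributes at most M * expR (- t) and the
Duhamel term at most M * (1 - expR (- t)). *)
Lemma picardP m : measurable_field (picard m) /\ forall t x, 0 <= picard m t x <= M.
Proof.
elim: m => [|m [mu_ uM]] /=.
  by split=> [|t x]; [exact: measurable_cst|rewrite lexx M0].
have u01 t x : 0 <= picard m t x <= 1 by have /andP[-> /le_trans] := uM t x; apply.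
have mfu := measurable_field_reaction mu_ u01.
have fuM t x : 0 <= (f \o picard m t) x <= M by exact: f_range.
have fu01 t x : 0 <= (f \o picard m t) x <= 1 by exact: f_range.
split=> [|t x].
  rewrite /measurable_field (_ : (fun p => _) = (fun p : RT * X => if 0 <= p.1
      then S p.1 phi p.2 + fine (eduhamel mu K (fun s => f \o picard m s) p.1 p.2)
      else 0)); last first.
    by apply/funext => -[t x] /=; case: ifPn => // t0; rewrite -(duhamelE kerK).
  apply: measurable_fun_ifT => //; first exact: measurable_fun_ler.
  apply: measurable_funD.
    by apply: (measurable_semigroup_field kerK) => // x; case/andP: (phi01 x).
  apply: measurableT_comp => //; apply: (measurable_eduhamel kerK) => //.
  by move=> s y; case/andP: (fu01 s y).
case: ifPn => [t0|_]; last by rewrite lexx M0.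
have D0 : 0 <= D (fun s => f \o picard m s) t x.
  exact: (duhamel_ge0 kerK).
have DM : D (fun s => f \o picard m s) t x <= M * (1 - expR (- t)).
  by rewrite -lee_fin (duhamelE kerK)//; exact: (eduhamel_le kerK).
rewrite addr_ge0//=; last by apply: (killed_semigroup_ge0 kerK) => y; case/andP: (phiM y).
have := killed_semigroup_le kerK x t0 mphi phiM; nra.
Qed.

Lemma measurable_picard m : measurable_field (picard m).
Proof. by case: (picardP m). Qed.

Lemma picard_range m t x : 0 <= picard m t x <= M.
Proof. by case: (picardP m). Qed.

Lemma picard01 m t x : 0 <= picard m t x <= 1.
Proof. by have /andP[-> /le_trans] := picard_range m t x; apply. Qed.

Let weight t : R := expR ((2 * q - 1) * t).

Let weight_ge1 t : 0 <= t -> 1 <= weight t.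
Proof.
move=> t0; rewrite -[leLHS]expR0 ler_expR mulr_ge0//.
by have := lipschitz_gt1 lf; lra.
Qed.

(** The iteration attracts every solution, whatever its measurability in time:
this gives uniqueness. *)
Lemma picard_approx (v : R -> X -> R) :
  (forall t, 0 <= t -> measurable_fun setT (v t)) ->
  (forall t x, 0 <= t -> 0 <= v t x <= 1) ->
  (forall t, 0 <= t ->
    {ae mu, forall x, v t x = S t phi x + D (fun s => f \o v s) t x}) ->
  forall m t, 0 <= t -> {ae mu, forall x, `|v t x - picard m t x| <= 2^-1 ^+ m * weight t}.
Proof.
move=> mv v01 vE; elim=> [|m IH] t t0.
  apply: aeW => x; rewrite /= subr0 mul1r.
  by apply: le_trans (weight_ge1 t0); case/andP: (v01 t x t0) => ? ?; rewrite ger0_norm.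
apply: filterS (vE t t0) => x ->; rewrite /= t0 opprD addrACA subrr add0r.
rewrite exprSr; apply: (duhamel_contraction kerK lf) => //.
- exact: measurable_picard.
- exact: picard01.
Qed.

Lemma picard_cauchy m p t x : 0 <= t ->
  `|picard (m + p) t x - picard m t x| <= 2^-1 ^+ m * weight t.
Proof.
elim: m t x => [|m IH] t x t0.
  rewrite add0n /= subr0 mul1r ger0_norm; last by case/andP: (picard01 p t x).
  by apply: le_trans (weight_ge1 t0); case/andP: (picard01 p t x).
rewrite addSn /= t0 opprD addrACA subrr add0r exprSr.
apply: (duhamel_contraction kerK lf) => //.
- by move=> s _; apply: measurable_field_section; exact: measurable_picard.
- by move=> s y _; exact: picard01.
- exact: measurable_picard.
- exact: picard01.
- by move=> s s0; apply: aeW => y; exact: IH.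
Qed.

Definition picard_limit t x : R := limn (fun m => picard m t x).

Local Notation u := picard_limit.

Let geometric_small (B : R) : 0 <= B -> 2^-1 ^+ m * B @[m --> \oo] --> 0.
Proof.
move=> B0; rewrite -[X in _ --> X](mul0r B); apply: cvgMr_tmp; apply: cvg_expr.
by rewrite ger0_norm// invf_lt1// ltr1n.
Qed.

Lemma cvg_picard t x : picard m t x @[m --> \oo] --> u t x.
Proof.
have [t0|t0] := leP 0 t; last first.
  have E : (fun m => picard m t x) = (fun=> 0).
    by apply/funext => m; rewrite picard_lt0.
  by rewrite /u E; apply: cvgP; exact: cvg_cst.
apply: (@cauchy_cvg R^o); apply: cauchy_exP => e e0.
have := geometric_small (ltW (lt_le_trans ltr01 (weight_ge1 t0))).
move=> /(@cvgrPdist_lt _ R^o)/(_ _ e0)[N _ HN]; exists (picard N t x).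
exists N => // m /= Nm; rewrite /ball/= distrC -(subnKC Nm).
apply: le_lt_trans (picard_cauchy _ _ _ t0) _.
have := HN N (leqnn N); rewrite /= sub0r normrN; apply: le_lt_trans; exact: ler_norm.
Qed.

Lemma picard_limit_dist m t x : 0 <= t ->
  `|u t x - picard m t x| <= 2^-1 ^+ m * weight t.
Proof.
move=> t0; have cu : `|picard (m + p) t x - picard m t x| @[p --> \oo] --> `|u t x - picard m t x|.
  apply: cvg_norm; apply: (@cvgB _ R^o); last exact: cvg_cst.
  under eq_fun do rewrite addnC.
  by have c := @cvg_picard t x; rewrite -(cvg_shiftn m) in c; exact: c.
rewrite -(cvg_lim (@Rhausdorff R) cu); apply: limr_le; first by apply/cvg_ex; eexists; exact: cu.
by apply: nearW => p; exact: picard_cauchy.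
Qed.

Lemma measurable_picard_limit : measurable_field u.
Proof.
apply: (@measurable_fun_cvg _ _ _ _ (fun m (p : RT * X) => picard m p.1 p.2)) => [m|p _].
  exact: measurable_picard.
exact: cvg_picard.
Qed.

Lemma picard_limit_range t x : 0 <= u t x <= M.
Proof.
have c : cvgn (fun m => picard m t x) by apply/cvg_ex; eexists; exact: cvg_picard.
apply/andP; split; [apply: limr_ge => //|apply: limr_le => //]; apply: nearW => m;
by case/andP: (picard_range m t x).
Qed.

Lemma picard_limit01 t x : 0 <= u t x <= 1.
Proof. by have /andP[-> /le_trans] := picard_limit_range t x; apply. Qed.

Let eq_of_geometric (a b B : R) : 0 <= B -> (forall m, `|a - b| <= 2^-1 ^+ m * B) -> a = b.
Proof.
move=> B0 ab; apply/eqP; rewrite -subr_eq0 -normr_le0.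
have c := geometric_small B0.
rewrite -(cvg_lim (@Rhausdorff R) c); apply: limr_ge; first by apply/cvg_ex; eexists; exact: c.
by apply: nearW.
Qed.

(** The equation holds at every point x, not only almost everywhere. *)
Lemma picard_limitE t x : 0 <= t ->
  u t x = S t phi x + D (fun s => f \o u s) t x.
Proof.
move=> t0; apply: (@eq_of_geometric _ _ (weight t)); first by rewrite expR_ge0.
move=> m; have h1 := picard_limit_dist m.+1 x t0.
have h2 : `|D (fun s => f \o u s) t x - D (fun s => f \o picard m s) t x| <=
    2^-1 ^+ m / 2 * weight t.
  apply: (duhamel_contraction kerK lf) => //.
  - by move=> s _; apply: measurable_field_section; exact: measurable_picard_limit.
  - by move=> s y _; exact: picard_limit01.
  - exact: measurable_picard.
  - exact: picard01.
  - by move=> s s0; apply: aeW => y; exact: picard_limit_dist.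
move: h1 h2; rewrite /= t0 exprSr; set a := S t phi x.
set b := D _ t x; set c := D _ t x; rewrite !ler_norml => /andP[? ?] /andP[? ?].
by apply/andP; split; lra.
Qed.

Lemma picard_limit_unique (v : R -> X -> R) :
  (forall t, 0 <= t -> measurable_fun setT (v t)) ->
  (forall t x, 0 <= t -> 0 <= v t x <= 1) ->
  (forall t, 0 <= t ->
    {ae mu, forall x, v t x = S t phi x + D (fun s => f \o v s) t x}) ->
  forall t, 0 <= t -> {ae mu, forall x, v t x = u t x}.
Proof.
move=> mv v01 vE t t0.
have : {ae mu, forall x, forall m, `|v t x - picard m t x| <= 2^-1 ^+ m * weight t}.
  by apply/ae_foralln => m; exact: picard_approx.
apply: filterS => x vx; apply: (@eq_of_geometric _ _ (2 * weight t)).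
  by rewrite mulr_ge0// expR_ge0.
move=> m; have := picard_limit_dist m x t0; have := vx m.
by rewrite !ler_norml => /andP[? ?] /andP[? ?]; apply/andP; split; lra.
Qed.

End picard.

(** * Estimates in mass and in time *)

(** Fatou's lemma, in the form that passes bounds from the iterates to the limit. *)
Lemma le_integral_cvg (R : realType) d (X : measurableType d)
    (mu : {measure set X -> \bar R}) (g_ : nat -> X -> R) (g : X -> R) (c : \bar R) :
  (forall m, measurable_fun setT (g_ m)) -> (forall m x, 0 <= g_ m x) ->
  (forall x, g_ m x @[m --> \oo] --> g x) ->
  (forall m, \int[mu]_x (g_ m x)%:E <= c)%E -> (\int[mu]_x (g x)%:E <= c)%E.
Proof.
move=> mg g0 gg gc.
have -> : (\int[mu]_x (g x)%:E = \int[mu]_x limn_einf (fun m => (g_ m x)%:E))%E.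
  apply: eq_integral => x _; rewrite is_cvg_limn_einfE.
    by apply/esym/cvg_lim => //; apply: cvg_EFin; [exact: nearW|exact: gg].
  by apply/cvg_ex; exists (g x)%:E; apply: cvg_EFin; [exact: nearW|exact: gg].
apply: le_trans.
  apply: fatou => // m; first exact/measurable_EFinP.
  by move=> x _; rewrite lee_fin.
rewrite limn_einf_lim; apply: lime_le; first exact: is_cvg_einfs.
by apply: nearW => m; apply: le_trans (gc m); apply: ereal_inf_lbound; exists m => /=.
Qed.

Section mass.
Context (R : realType) d (X : measurableType d).
Variable mu : {sigma_finite_measure set X -> \bar R}.
Variables (n : nat) (K : R -> X -> X -> R).
Hypothesis kerK : diffusion_kernel mu n K.
Local Notation RT := (measurableTypeR R).
Local Notation leb := (@lebesgue_measure R).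
Local Notation S := (killed_semigroup mu K).
Local Notation k := (killed_kernel K).
Local Notation dk := (duhamel_kernel K).
Local Notation D := (duhamel mu K).
Implicit Types (t s c m eta del : R) (x y : X) (g : X -> R) (h u v w : R -> X -> R).

Let measurable_killed_kernel2 t : measurable_fun [set: X * X] (fun p => k t p.1 p.2).
Proof. exact: (measurable_killed_kernel kerK). Qed.

Let measurable_duhamel_kernel3 t :
  measurable_fun [set: (X * RT) * X] (fun p => dk t p.1.2 p.1.1 p.2).
Proof.
apply: (measurable_duhamel_kernel kerK) => //.
- exact: (measurableT_comp measurable_snd measurable_fst).
- exact: (measurableT_comp measurable_fst measurable_fst).
Qed.

Lemma integral_killed_kernel1 t y : 0 < t ->
  (\int[mu]_x (k t x y)%:E = (expR (- t))%:E)%E.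
Proof.
move=> t0; rewrite -(integral_killed_kernel kerK y t0).
by under eq_integral do rewrite (killed_kernel_sym kerK).
Qed.

Lemma mass_killed_semigroup t g : 0 <= t -> measurable_fun setT g ->
  (forall y, 0 <= g y <= 1) ->
  (\int[mu]_x (S t g x)%:E <= (expR (- t))%:E * \int[mu]_x (g x)%:E)%E.
Proof.
move=> + mg g01; rewrite le_eqVlt => /predU1P[<-|t0].
  by rewrite /killed_semigroup eqxx oppr0 expR0 mul1e.
under eq_integral do rewrite (killed_semigroupE kerK _ t0 mg g01).
apply: kernel_mass => //.
- exact: (killed_kernel_ge0 kerK).
- by move=> y; case/andP: (g01 y).
- by move=> y; rewrite integral_killed_kernel1.
Qed.

Lemma killed_semigroup_dist_mass t g1 g2 : 0 <= t ->
  measurable_fun setT g1 -> measurable_fun setT g2 ->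
  (forall y, 0 <= g1 y <= 1) -> (forall y, 0 <= g2 y <= 1) ->
  (\int[mu]_x (`|S t g1 x - S t g2 x|)%:E <=
   (expR (- t))%:E * \int[mu]_x (`|g1 x - g2 x|)%:E)%E.
Proof.
move=> + m1 m2 g1M g2M; rewrite le_eqVlt => /predU1P[<-|t0].
  by rewrite /killed_semigroup eqxx oppr0 expR0 mul1e.
have mg12 : measurable_fun setT (fun y => `|g1 y - g2 y|).
  by apply: measurableT_comp => //; exact: measurable_funB.
apply: (@le_trans _ _ (\int[mu]_x \int[mu]_y (k t x y * `|g1 y - g2 y|)%:E)%E); last first.
  apply: kernel_mass => //; first exact: (killed_kernel_ge0 kerK).
  by move=> y; rewrite integral_killed_kernel1.
apply: ge0_le_integral => //.
- by apply/measurable_EFinP; apply: measurableT_comp => //; apply: measurable_funB; apply: (measurable_semigroup kerK) => // y;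
    [case/andP: (g1M y)|case/andP: (g2M y)].
- apply: (@measurable_inner_integral R d X _ X mu (fun x y => k t x y * `|g1 y - g2 y|)).
    by apply: measurable_funM => //; exact: (measurableT_comp mg12 measurable_snd).
  by move=> x y; rewrite mulr_ge0// (killed_kernel_ge0 kerK).
move=> x _; have mk : measurable_fun setT (k t x) by exact: (measurable_killed_kernel kerK).
have kS g : measurable_fun setT g -> (forall y, 0 <= g y <= 1) ->
    S t g x = fine (\int[mu]_y (k t x y * g y)%:E)%E.
  by move=> mg g01; rewrite -(killed_semigroupE kerK x t0 mg g01).
rewrite (kS g1)// (kS g2)//; apply: le_trans.
  apply: ge0_integral_dist => //.
  - exact: measurable_funM.
  - exact: measurable_funM.
  - by move=> y; rewrite mulr_ge0 ?(killed_kernel_ge0 kerK)//; case/andP: (g1M y).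
  - by move=> y; rewrite mulr_ge0 ?(killed_kernel_ge0 kerK)//; case/andP: (g2M y).
  - by rewrite -(killed_semigroupE kerK x t0 m1 g1M) ltry.
  - by rewrite -(killed_semigroupE kerK x t0 m2 g2M) ltry.
under eq_integral do rewrite -mulrBr normrM (ger0_norm (killed_kernel_ge0 kerK _ _ _)).
by [].
Qed.

(** The two time regularity estimates, in the supremum norm and in L1, come from
the same pointwise bound. *)
Lemma killed_semigroup_time_dist t t' eta g x : 0 < eta -> eta <= t -> eta <= t' ->
  measurable_fun setT g -> (forall y, 0 <= g y <= 1) ->
  ((`|S t' g x - S t g x|)%:E <= \int[mu]_y (`|k t' x y - k t x y| * g y)%:E)%E.
Proof.
move=> eta0 etat etat' mg g01.
have t0 : 0 < t by exact: lt_le_trans etat.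
have t'0 : 0 < t' by exact: lt_le_trans etat'.
have mk r : measurable_fun setT (k r x) by exact: (measurable_killed_kernel kerK).
have kS r : 0 < r -> S r g x = fine (\int[mu]_y (k r x y * g y)%:E)%E.
  by move=> r0; rewrite -(killed_semigroupE kerK x r0 mg g01).
have kg0 r y : 0 <= k r x y * g y.
  by rewrite mulr_ge0 ?(killed_kernel_ge0 kerK)//; case/andP: (g01 y).
rewrite !kS//; apply: le_trans.
  apply: ge0_integral_dist => //.
  - exact: measurable_funM.
  - exact: measurable_funM.
  - by rewrite -(killed_semigroupE kerK x t'0 mg g01) ltry.
  - by rewrite -(killed_semigroupE kerK x t0 mg g01) ltry.
under eq_integral => y _.
  rewrite -mulrBl normrM (ger0_norm (x := g y)); last by case/andP: (g01 y).
  over.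
by [].
Qed.

Lemma killed_semigroup_time_sup t t' eta g x : 0 < eta -> eta <= t -> eta <= t' ->
  measurable_fun setT g -> (forall y, 0 <= g y <= 1) ->
  `|S t' g x - S t g x| <= 2 * time_modulus n eta `|t' - t|.
Proof.
move=> eta0 etat etat' mg g01; rewrite -lee_fin.
apply: le_trans (killed_semigroup_time_dist x eta0 etat etat' mg g01) _.
apply: le_trans (killed_kernel_dist kerK x eta0 etat etat').
have mk r : measurable_fun setT (k r x) by exact: (measurable_killed_kernel kerK).
have md : measurable_fun setT (fun y => `|k t' x y - k t x y|).
  by apply: measurableT_comp => //; exact: measurable_funB.
apply: le_integral_EFin => //; first exact: measurable_funM.
- by move=> y; rewrite mulr_ge0//; case/andP: (g01 y).
- by move=> y; rewrite ler_piMr//; case/andP: (g01 y).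
Qed.

Lemma killed_semigroup_time_mass t t' eta g : 0 < eta -> eta <= t -> eta <= t' ->
  measurable_fun setT g -> (forall y, 0 <= g y <= 1) ->
  (\int[mu]_x (`|S t' g x - S t g x|)%:E <=
   (2 * time_modulus n eta `|t' - t|)%:E * \int[mu]_x (g x)%:E)%E.
Proof.
move=> eta0 etat etat' mg g01.
have md : measurable_fun [set: X * X] (fun p => `|k t' p.1 p.2 - k t p.1 p.2|).
  by apply: measurableT_comp => //; exact: measurable_funB.
apply: (@le_trans _ _ (\int[mu]_x \int[mu]_y (`|k t' x y - k t x y| * g y)%:E)%E); last first.
  apply: kernel_mass => //; first by move=> y; case/andP: (g01 y).
  move=> y; apply: le_trans (killed_kernel_dist kerK y eta0 etat etat').
  by under eq_integral do rewrite !(killed_kernel_sym kerK _ _ y).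
apply: ge0_le_integral => //.
- apply/measurable_EFinP; apply: measurableT_comp => //.
  by apply: measurable_funB; apply: (measurable_semigroup kerK) => // y; case/andP: (g01 y).
- apply: (@measurable_inner_integral R d X _ X mu (fun x y => `|k t' x y - k t x y| * g y)).
    by apply: measurable_funM => //; exact: measurableT_comp.
  by move=> x y; rewrite mulr_ge0//; case/andP: (g01 y).
by move=> x _; exact: (killed_semigroup_time_dist x eta0).
Qed.

Section duhamel_estimates.
Variable h : R -> X -> R.
Hypotheses (mh : measurable_field h) (h01 : forall s y, 0 <= h s y <= 1).

Let h0 s y : 0 <= h s y. Proof. by case/andP: (h01 s y). Qed.

(** The mass created by the reaction is at most the mass lost to killing. *)
Lemma mass_duhamel t m : 0 <= t -> (forall s, \int[mu]_y (h s y)%:E <= m%:E)%E ->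
  (\int[mu]_x (D h t x)%:E <= (m * (1 - expR (- t)))%:E)%E.
Proof.
move=> t0 hm; under eq_integral do rewrite (duhamelE kerK)//.
have m0 : 0 <= m.
  by rewrite -lee_fin; apply: le_trans (hm 0); apply: integral_ge0 => y _; rewrite lee_fin.
have -> : (m * (1 - expR (- t)))%:E =
    (\int[leb]_s (survival t s * (m * expR (0 * s)))%:E)%E.
  by rewrite integral_survivalM ?addr0// mul0r expR0 divr1.
apply: potential_le_mass => //.
- exact: measurable_survival.
- apply: measurable_funM => //; apply: measurableT_comp => //; exact: measurable_funM.
- by move=> s x y; exact: (duhamel_kernel_ge0 kerK).
- by move=> s y; rewrite (integral_duhamel_kernel1 kerK).
- by move=> s; rewrite mul0r expR0 mulr1.
Qed.

Lemma duhamel_time_dist t t' x : 0 <= t -> 0 <= t' ->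
  ((`|D h t' x - D h t x|)%:E <=
   \int[leb]_s \int[mu]_y (`|dk t' s x y - dk t s x y| * h s y)%:E)%E.
Proof.
move=> t0 t'0; rewrite !(duhamel_fine kerK)//; apply: le_trans.
  apply: (@iterated_integral_dist R d X _ RT mu leb
    (fun s y => dk t' s x y * h s y) (fun s y => dk t s x y * h s y)).
  - exact: (measurable_duhamel_density kerK).
  - exact: (measurable_duhamel_density kerK).
  - by move=> s y; rewrite mulr_ge0 ?(duhamel_kernel_ge0 kerK).
  - by move=> s y; rewrite mulr_ge0 ?(duhamel_kernel_ge0 kerK).
  - exact: (eduhamel_lty kerK).
  - exact: (eduhamel_lty kerK).
under eq_integral do under eq_integral do rewrite -mulrBl normrM (ger0_norm (h0 _ _)).
by [].
Qed.

(** The parameter eta is free: it is chosen first, to make the singular part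
small, and then the time step. *)
Lemma duhamel_time_sup t t' eta x : 0 < eta -> 0 <= t -> t <= t' ->
  `|D h t' x - D h t x| <= 2 * (t' - t + eta) + 2 * time_modulus n eta (t' - t) * t.
Proof.
move=> eta0 t0 tt'; have t'0 := le_trans t0 tt'.
rewrite -lee_fin; apply: le_trans (duhamel_time_dist x t0 t'0) _.
rewrite -integral_duhamel_modulus//.
under [leRHS]eq_integral do rewrite -(mulr1 (duhamel_modulus _ _ _ _ _)).
apply: (@potential_le_sup R d X _ RT mu leb
    (fun s y => `|dk t' s x y - dk t s x y|) h _ (fun=> 1)) => //.
- apply: measurableT_comp => //; apply: measurable_funB;
    exact: (measurable_duhamel_kernel kerK).
- exact: measurable_duhamel_modulus.
- by move=> s; exact: (duhamel_kernel_dist kerK).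
Qed.

Lemma duhamel_time_mass t t' eta m : 0 < eta -> 0 <= t -> t <= t' ->
  (forall s, \int[mu]_y (h s y)%:E <= m%:E)%E ->
  (\int[mu]_x (`|D h t' x - D h t x|)%:E <=
   ((2 * (t' - t + eta) + 2 * time_modulus n eta (t' - t) * t) * m)%:E)%E.
Proof.
move=> eta0 t0 tt' hm; have t'0 := le_trans t0 tt'.
have m0 : 0 <= m.
  by rewrite -lee_fin; apply: le_trans (hm 0); apply: integral_ge0 => y _; rewrite lee_fin.
have mdd : measurable_fun [set: (X * RT) * X]
    (fun p => `|dk t' p.1.2 p.1.1 p.2 - dk t p.1.2 p.1.1 p.2|).
  by apply: measurableT_comp => //; exact: measurable_funB.
rewrite EFinM -integral_duhamel_modulus// -integral_EFinMr//; last 2 first.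
- exact: measurable_duhamel_modulus.
- move=> s; rewrite -lee_fin; apply: le_trans (duhamel_kernel_dist kerK s point eta0 t0 tt').
  by apply: integral_ge0 => y _; rewrite lee_fin.
apply: (@le_trans _ _ (\int[mu]_x \int[leb]_s \int[mu]_y
    (`|dk t' s x y - dk t s x y| * h s y)%:E)%E); last first.
  apply: (@potential_le_mass R d X _ RT mu leb
    (fun s x y => `|dk t' s x y - dk t s x y|) h _ (fun=> m)) => //.
  - exact: measurable_duhamel_modulus.
  - move=> s y; apply: le_trans (duhamel_kernel_dist kerK s y eta0 t0 tt').
    by under eq_integral do rewrite !(duhamel_kernel_sym kerK _ _ _ y).
apply: ge0_le_integral => //.
- apply/measurable_EFinP; apply: measurableT_comp => //.
  by apply: measurable_funB; exact: (measurable_duhamel kerK).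
- have [] := @measurable_iterated_integral R d X _ RT mu leb _ X
    (fun x s y => `|dk t' s x y - dk t s x y| * h s y); last by [].
  + apply: measurable_funM => //.
    apply: (measurableT_comp mh (g := fun p : (X * RT) * X => (p.1.2, p.2))).
    apply: measurable_fun_pair => //.
    exact: (measurableT_comp measurable_snd measurable_fst).
  + by move=> x s y; rewrite mulr_ge0.
by move=> x _; exact: duhamel_time_dist.
Qed.

End duhamel_estimates.
End mass.

(** * Mass of the solution *)

Section picard_mass.
Context (R : realType) d (X : measurableType d).
Variable mu : {sigma_finite_measure set X -> \bar R}.
Variables (n : nat) (K : R -> X -> X -> R).
Hypothesis kerK : diffusion_kernel mu n K.
Variables (q : R) (f : R -> R).
Hypothesis lf : unit_lipschitz q f.
Local Notation RT := (measurableTypeR R).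
Local Notation leb := (@lebesgue_measure R).
Local Notation S := (killed_semigroup mu K).
Local Notation dk := (duhamel_kernel K).
Local Notation D := (duhamel mu K).
Local Notation u := (picard_limit mu K f).
Local Notation picard := (picard mu K f).
Implicit Types (t s : R) (x y : X) (phi : X -> R).

Let q0 : 0 < q. Proof. exact: lt_trans ltr01 (lipschitz_gt1 lf). Qed.

Let field01 phi m : measurable_fun setT phi -> (forall x, 0 <= phi x <= 1) ->
  [/\ measurable_field (picard phi m), forall t x, 0 <= picard phi m t x <= 1,
      measurable_field (fun s => f \o picard phi m s) &
      forall t x, 0 <= (f \o picard phi m t) x <= 1].
Proof.
move=> mphi phi01; have m1 := measurable_picard kerK lf mphi phi01 (lexx 1) m.
have p01 t x := picard01 kerK lf mphi phi01 (lexx 1) m t x.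
split=> //; first exact: (measurable_field_reaction lf).
move=> t x /=; rewrite (unit_lipschitz_ge0 lf)//=.
by apply: le_trans (unit_lipschitz_le lf (p01 t x)) _; case/andP: (p01 t x).
Qed.

(** The bound is preserved by each iteration, since the semigroup keeps at most
the fraction expR (- t) of it and the Duhamel term restores at most the rest. *)
Lemma picard_limit_mass phi (c : R) t : measurable_fun setT phi ->
  (forall x, 0 <= phi x <= 1) -> (\int[mu]_x (phi x)%:E <= c%:E)%E ->
  (\int[mu]_x (u phi t x)%:E <= c%:E)%E.
Proof.
move=> mphi phi01 phic; have c0 : 0 <= c.
  rewrite -lee_fin; apply: le_trans phic; apply: integral_ge0 => x _.
  by rewrite lee_fin; case/andP: (phi01 x).
apply: (@le_integral_cvg _ _ _ _ (fun m => picard phi m t)).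
- move=> m; have [m1 _ _ _] := field01 m mphi phi01; exact: measurable_field_section.
- by move=> m x; have [_ /(_ t x)/andP[]] := field01 m mphi phi01.
- by move=> x; exact: (cvg_picard kerK lf mphi phi01 (lexx 1)).
move=> m; elim: m t => [|m IH] t; first by rewrite /= integral0 lee_fin.
have [m1 p01 m2 f01] := field01 m mphi phi01.
have [t0|t0] := leP 0 t; last first.
  by under eq_integral do rewrite /= leNgt t0; rewrite integral0 lee_fin.
under eq_integral do rewrite /= t0.
have mS : measurable_fun setT (S t phi).
  by apply: (measurable_semigroup kerK) => // x; case/andP: (phi01 x).
have mD : measurable_fun setT (D (fun s => f \o picard phi m s) t).
  exact: (measurable_duhamel kerK).
rewrite integral_EFinD//; last 2 first.
- by move=> x; apply: (killed_semigroup_ge0 kerK) => y; case/andP: (phi01 y).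
- by move=> x; exact: (duhamel_ge0 kerK).
rewrite (_ : c%:E = (expR (- t))%:E * c%:E + (c * (1 - expR (- t)))%:E)%E; last first.
  by rewrite -EFinM -EFinD; congr EFin; ring.
apply: leeD.
  apply: le_trans (mass_killed_semigroup kerK t0 mphi phi01) _.
  by rewrite lee_wpmul2l// lee_fin expR_ge0.
apply: (mass_duhamel kerK) => // s; apply: le_trans (IH s).
apply: le_integral_EFin => //.
- exact: (measurable_field_section s m2).
- exact: measurable_field_section.
- by move=> y; case/andP: (f01 s y).
- by move=> y /=; exact: (unit_lipschitz_le lf).
Qed.

(** The factor 2 makes the bound stable under the iteration: the exponential
weight halves the contribution of the reaction term. *)
Lemma picard_limit_dist_mass phi1 phi2 (c : R) t : 0 <= t ->
  measurable_fun setT phi1 -> measurable_fun setT phi2 ->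
  (forall x, 0 <= phi1 x <= 1) -> (forall x, 0 <= phi2 x <= 1) ->
  (\int[mu]_x (`|phi1 x - phi2 x|)%:E <= c%:E)%E ->
  (\int[mu]_x (`|u phi1 t x - u phi2 t x|)%:E <=
   (2 * c * expR ((2 * q - 1) * t))%:E)%E.
Proof.
move=> t0 mphi1 mphi2 phi101 phi201 phic.
have c0 : 0 <= c.
  by rewrite -lee_fin; apply: le_trans phic; apply: integral_ge0 => x _; rewrite lee_fin.
apply: (@le_integral_cvg _ _ _ _ (fun m x => `|picard phi1 m t x - picard phi2 m t x|)).
- move=> m; have [m1 _ _ _] := field01 m mphi1 phi101; have [m2 _ _ _] := field01 m mphi2 phi201.
  by apply: measurableT_comp => //; apply: measurable_funB; exact: measurable_field_section.
- by [].
- move=> x; apply: cvg_norm; apply: (@cvgB _ R^o).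
    exact: (cvg_picard kerK lf mphi1 phi101 (lexx 1)).
  exact: (cvg_picard kerK lf mphi2 phi201 (lexx 1)).
have B0 s : 0 <= 2 * c * expR ((2 * q - 1) * s) by rewrite mulr_ge0 ?expR_ge0// mulr_ge0.
move=> m; elim: m t t0 => [|m IH] t t0.
  by under eq_integral do rewrite /= subrr normr0; rewrite integral0 lee_fin.
have [m1 p1 mf1 f1] := field01 m mphi1 phi101.
have [m2 p2 mf2 f2] := field01 m mphi2 phi201.
pose h1 s := f \o picard phi1 m s; pose h2 s := f \o picard phi2 m s.
under eq_integral do rewrite /= t0.
have mS1 : measurable_fun setT (S t phi1).
  by apply: (measurable_semigroup kerK) => // x; case/andP: (phi101 x).
have mS2 : measurable_fun setT (S t phi2).
  by apply: (measurable_semigroup kerK) => // x; case/andP: (phi201 x).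
have mD1 : measurable_fun setT (D h1 t) by exact: (measurable_duhamel kerK).
have mD2 : measurable_fun setT (D h2 t) by exact: (measurable_duhamel kerK).
have mSd : measurable_fun setT (fun x => `|S t phi1 x - S t phi2 x|).
  by apply: measurableT_comp => //; exact: measurable_funB.
have mDd : measurable_fun setT (fun x => `|D h1 t x - D h2 t x|).
  by apply: measurableT_comp => //; exact: measurable_funB.
apply: (@le_trans _ _ (\int[mu]_x (`|S t phi1 x - S t phi2 x| + `|D h1 t x - D h2 t x|)%:E)%E).
  apply: le_integral_EFin => //.
  - apply: measurableT_comp => //.
    exact: (measurable_funB (measurable_funD mS1 mD1) (measurable_funD mS2 mD2)).
  - exact: (measurable_funD mSd mDd).
  - by move=> x; rewrite opprD addrACA ler_normD.
rewrite integral_EFinD//.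
have hS : (\int[mu]_x (`|S t phi1 x - S t phi2 x|)%:E <= (expR (- t) * c)%:E)%E.
  apply: le_trans (killed_semigroup_dist_mass kerK t0 mphi1 mphi2 phi101 phi201) _.
  by rewrite EFinM lee_wpmul2l// lee_fin expR_ge0.
have hD : (\int[mu]_x (`|D h1 t x - D h2 t x|)%:E <=
    (q * (2 * c) * ((expR ((2 * q - 1) * t) - expR (- t)) / (1 + (2 * q - 1))))%:E)%E.
  rewrite -integral_survivalM//; last 2 first.
  - by rewrite addrC subrK mulr_gt0.
  - by rewrite !mulr_ge0// ltW.
  have mh12 : measurable_fun [set: RT * X] (fun p => `|h1 p.1 p.2 - h2 p.1 p.2|).
    by apply: measurableT_comp => //; exact: measurable_funB.
  apply: (@le_trans _ _ (\int[mu]_x \int[leb]_s \int[mu]_y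
      (dk t s x y * `|h1 s y - h2 s y|)%:E)%E); last first.
    apply: (@potential_le_mass R d X _ RT mu leb (fun s x y => dk t s x y)
      (fun s y => `|h1 s y - h2 s y|)
      _ (fun s => q * (2 * c) * expR ((2 * q - 1) * s))) => //.
    - apply: (measurable_duhamel_kernel kerK) => //.
      + exact: (measurableT_comp measurable_snd measurable_fst).
      + exact: (measurableT_comp measurable_fst measurable_fst).
    - exact: measurable_survival.
    - by apply: measurable_funM => //; apply: measurableT_comp => //; exact: measurable_funM.
    - by move=> s x y; exact: (duhamel_kernel_ge0 kerK).
    - by move=> s y; rewrite (integral_duhamel_kernel1 kerK).
    move=> s; have [s0|s0] := leP 0 s; last first.
      under eq_integral => y _.
        rewrite /h1 /h2 !picard_lt0//.
        rewrite subrr normr0; over.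
      by rewrite integral0 lee_fin !mulr_ge0// ?expR_ge0// ltW.
    rewrite -mulrA EFinM; apply: le_trans (lee_wpmul2l _ (IH s s0)); last by rewrite lee_fin ltW.
    have mp : measurable_fun setT (fun y => `|picard phi1 m s y - picard phi2 m s y|).
      by apply: measurableT_comp => //; apply: measurable_funB; exact: measurable_field_section.
    apply: (@le_trans _ _ (\int[mu]_y (q * `|picard phi1 m s y - picard phi2 m s y|)%:E)%E); last first.
      by rewrite integral_EFinMl// ltW.
    apply: le_integral_EFin => //.
    - apply: measurableT_comp => //.
      exact: (measurable_funB (measurable_field_section s mf1) (measurable_field_section s mf2)).
    - exact: measurable_funM.
    - by move=> y; exact: (unit_lipschitz_dist lf).
  have mi := @measurable_iterated_integral R d X _ RT mu leb _ X
    (fun x s y => dk t s x y * `|h1 s y - h2 s y|).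
  apply: ge0_le_integral => //.
  - exact/measurable_EFinP.
  - apply: (mi _ _).2.
    + apply: measurable_funM.
        apply: (measurable_duhamel_kernel kerK) => //.
        * exact: (measurableT_comp measurable_snd measurable_fst).
        * exact: (measurableT_comp measurable_fst measurable_fst).
      apply: (measurableT_comp mh12 (g := fun p : (X * RT) * X => (p.1.2, p.2))).
      apply: measurable_fun_pair => //.
      exact: (measurableT_comp measurable_snd measurable_fst).
    + by move=> x s y; rewrite mulr_ge0 ?(duhamel_kernel_ge0 kerK).
  move=> x _; rewrite !(duhamel_fine kerK)//; apply: le_trans.
    apply: (@iterated_integral_dist R d X _ RT mu leb
      (fun s y => dk t s x y * h1 s y) (fun s y => dk t s x y * h2 s y)).
    - exact: (measurable_duhamel_density kerK).
    - exact: (measurable_duhamel_density kerK).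
    - by move=> s y; rewrite mulr_ge0 ?(duhamel_kernel_ge0 kerK)//; case/andP: (f1 s y).
    - by move=> s y; rewrite mulr_ge0 ?(duhamel_kernel_ge0 kerK)//; case/andP: (f2 s y).
    - exact: (eduhamel_lty kerK).
    - exact: (eduhamel_lty kerK).
  under eq_integral do under eq_integral do
    rewrite -mulrBr normrM (ger0_norm (duhamel_kernel_ge0 kerK _ _ _ _)).
  by [].
apply: le_trans (leeD hS hD) _; rewrite -EFinD lee_fin.
rewrite (_ : q * (2 * c) * _ = c * (expR ((2 * q - 1) * t) - expR (- t))); last first.
  by field; rewrite addrC subrK mulf_neq0// gt_eqF.
have : 0 <= c * expR ((2 * q - 1) * t) by rewrite mulr_ge0 ?expR_ge0.
lra.
Qed.

End picard_mass.

(** * The Gaussian kernel on R^d *)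

Section lebesgue_Rd_integral.
Context (R : realType).
Local Notation leb := (@lebesgue_measure R).
Local Notation RT := (measurableTypeR R).

(** The measure on R^(d+1) is defined by the iterated integral in one order of the
variables; uniqueness of the product measure gives Tonelli in the other. *)
Lemma ge0_integral_Rd_cons d (g : Rd R d.+1 -> \bar R) :
  measurable_fun setT g -> (forall x, 0 <= g x)%E ->
  (\int[lebesgue_Rd R d.+1]_x g x =
   \int[leb]_r \int[lebesgue_Rd R d]_y g (rd_cons (r, y)))%E.
Proof.
move=> mg g0.
have mgc : measurable_fun setT (g \o @rd_cons R d).
  exact: (measurableT_comp mg (@measurable_rd_cons R d)).
rewrite -(fubini_tonelli1 (g \o @rd_cons R d))//; last by move=> p; exact: g0.
transitivity (\int[leb \x^ lebesgue_Rd R d]_p (g \o @rd_cons R d) p)%E.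
  rewrite [LHS](ge0_integral_pushforward (@measurable_rd_cons R d))//.
apply: eq_measure_integral => A mA _; apply/esym/product_measure_unique => //.
by move=> B C mB mC; exact: product_measure2E.
Qed.

Lemma tnth_rd_cons d (r : R) (y : Rd R d) (i : 'I_d) :
  tnth (rd_cons (r, y)) (lift ord0 i) = tnth y i.
Proof. by rewrite tnthS; congr tnth; apply: val_inj. Qed.

Lemma integral_Rd_prod1 d (F : 'I_d -> R -> R) :
  (forall i, measurable_fun [set: RT] (F i)) -> (forall i r, 0 <= F i r) ->
  (forall i, \int[leb]_r (F i r)%:E = 1)%E ->
  (\int[lebesgue_Rd R d]_y (\prod_(i < d) F i (tnth y i))%:E = 1)%E.
Proof.
elim: d F => [|d IH] F mF F0 F1.
  under eq_integral do rewrite big_ord0.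
  rewrite integral_cst// mul1e.
  rewrite (_ : setT = @rd_box R 0 (fun=> setT)); last by apply/seteqP; split.
  by rewrite [LHS](@lebesgue_Rd_box R 0 (fun=> setT))// big_ord0.
have mP m (G : 'I_m -> R -> R) : (forall i, measurable_fun [set: RT] (G i)) ->
    measurable_fun [set: Rd R m] (fun y => \prod_(i < m) G i (tnth y i)).
  move=> mG; apply: measurable_prod => i _.
  exact: (measurableT_comp (mG i) (measurable_tnth i)).
rewrite ge0_integral_Rd_cons; last 2 first.
- by apply/measurable_EFinP; exact: mP.
- by move=> x; rewrite lee_fin prodr_ge0.
rewrite -[RHS](F1 ord0); apply: eq_integral => r _.
under eq_integral => y _.
  rewrite big_ord_recl; under eq_bigr do rewrite tnth_rd_cons.
  rewrite (_ : tnth _ ord0 = r)//.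
  over.
rewrite (integral_EFinMl (lebesgue_Rd R d)
  (f := fun y : Rd R d => \prod_(i < d) F (lift ord0 i) (tnth y i)))//.
- by rewrite (IH (fun i => F (lift ord0 i))) ?mule1.
- by apply: (mP d (fun i => F (lift ord0 i))) => i.
- by move=> y; rewrite prodr_ge0.
Qed.

End lebesgue_Rd_integral.

Section gaussian.
Context (R : realType) (d : nat).
Local Notation leb := (@lebesgue_measure R).
Local Notation RT := (measurableTypeR R).
Local Notation mu := (lebesgue_Rd R d).
Implicit Types (t r a : R) (x y : Rd R d).

Definition gaussian t r : R := (4 * pi * t) `^ (- 2^-1) * expR (- (r ^+ 2 / (4 * t))).

Lemma tnth_rd_sub x y i : tnth (rd_sub x y) i = tnth x i - tnth y i :> R.
Proof. by rewrite tnth_mktuple. Qed.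

(** Factorization reduces the normalization of the heat kernel to that of the
one-dimensional normal density of variance 2 t. *)
Lemma heat_kernel_prod t x : 0 < t -> heat_kernel t x = \prod_(i < d) gaussian t (tnth x i).
Proof.
move=> t0; rewrite /heat_kernel /gaussian big_split/= prodr_const card_ord.
congr (_ * _).
  rewrite -powR_mulrn ?powR_ge0// -powRrM; congr (_ `^ _).
  by rewrite mulNr mulrC.
by rewrite -expR_sum sumrN -mulr_suml.
Qed.

Lemma integral_gaussian t a : 0 < t ->
  (\int[leb]_r (gaussian t (a - r))%:E = 1)%E.
Proof.
move=> t0; have s0 : Num.sqrt (2 * t) != 0 :> R by rewrite gt_eqF// sqrtr_gt0 mulr_gt0.
rewrite -(integral_normal_pdf a (Num.sqrt (2 * t))); apply: eq_integral => r _.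
rewrite normal_pdfE// /gaussian /normal_peak /normal_fun sqr_sqrtr ?mulr_ge0 ?ltW//.
congr (_ * expR _)%:E.
  rewrite powRN powR12_sqrt ?mulr_ge0 ?ltW// ?pi_gt0//; congr (_^-1); congr Num.sqrt.
  by rewrite -[RHS]mulr_natr; ring.
by rewrite mulNr; congr (- _); rewrite -mulr_natr; field; rewrite gt_eqF.
Qed.

(** The inverse is discontinuous at 0; it is r times a power of r ^ 2, and the
powers are measurable on the whole line. *)
Lemma measurable_inv : measurable_fun [set: RT] (fun r : R => r^-1).
Proof.
have -> : (fun r : R => r^-1) = (fun r => r * (r ^+ 2) `^ (-1)).
  apply/funext => r; rewrite powR_inv1 ?sqr_ge0//.
  have [->|r0] := eqVneq r 0; first by rewrite invr0 mul0r.
  by field.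
apply: measurable_funM => //.
apply: (measurableT_comp (measurable_powR (-1)) (g := fun r : RT => r ^+ 2)).
exact: measurable_funX.
Qed.

Lemma rd_sqnorm_ge0 x : 0 <= rd_sqnorm x.
Proof. by apply: sumr_ge0 => i _; exact: sqr_ge0. Qed.

Lemma rd_sqnorm_subC x y : rd_sqnorm (rd_sub x y) = rd_sqnorm (rd_sub y x).
Proof. by apply: eq_bigr => i _; rewrite !tnth_rd_sub -opprB sqrrN. Qed.

Lemma measurable_rd_sqnorm_sub :
  measurable_fun [set: Rd R d * Rd R d] (fun p => rd_sqnorm (rd_sub p.1 p.2)).
Proof.
rewrite /rd_sqnorm; under eq_fun do under eq_bigr do rewrite tnth_rd_sub.
apply: measurable_sum => i; apply: measurable_funX; apply: measurable_funB.
- exact: (measurableT_comp (measurable_tnth i) measurable_fst).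
- exact: (measurableT_comp (measurable_tnth i) measurable_snd).
Qed.

Lemma heat_kernel_ge0 t x : 0 <= heat_kernel t x.
Proof. by rewrite mulr_ge0 ?powR_ge0 ?expR_ge0. Qed.

Lemma heat_kernel_rescale t t' x : 0 < t -> 0 < t' ->
  heat_kernel t x = (t' / t) `^ (d%:R / 2) *
    expR (rd_sqnorm x / (4 * t') - rd_sqnorm x / (4 * t)) * heat_kernel t' x.
Proof.
move=> t0 t'0; rewrite /heat_kernel.
have p0 : 0 < 4 * pi * t' :> R by rewrite !mulr_gt0// pi_gt0.
have -> : 4 * pi * t = 4 * pi * t' * (t' / t)^-1 by field; rewrite !gt_eqF.
rewrite powRM ?ltW// ?invr_gt0 ?divr_gt0//.
rewrite -(powR_inv1 (a := t' / t)) ?divr_ge0 ?ltW// -powRrM mulN1r opprK.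
rewrite (_ : expR (- (rd_sqnorm x / (4 * t))) =
  expR (rd_sqnorm x / (4 * t') - rd_sqnorm x / (4 * t)) * expR (- (rd_sqnorm x / (4 * t')))).
  ring.
by rewrite -expRD; congr expR; ring.
Qed.

(** The Gaussian factor increases with time, so only the normalization loses; the
exact power d / 2 of t' / t is rounded up to d to stay with natural exponents. *)
Lemma heat_kernel_le t t' x : 0 < t -> t <= t' ->
  heat_kernel t x <= (t' / t) ^+ d * heat_kernel t' x.
Proof.
move=> t0 tt'; have t'0 : 0 < t' by exact: lt_le_trans tt'.
have r1 : 1 <= t' / t by rewrite ler_pdivlMr// mul1r.
rewrite (heat_kernel_rescale _ t0 t'0) ler_wpM2r ?heat_kernel_ge0//.
rewrite -[leRHS]mulr1; apply: ler_pM; rewrite ?powR_ge0 ?expR_ge0//.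
  rewrite -(@powR_mulrn _ (t' / t) d) ?divr_ge0 ?(ltW t0) ?(ltW t'0)//.
  apply: ler_powR => //.
  by rewrite ler_pdivrMr// ler_peMr// ler1n.
rewrite -[leRHS]expR0 ler_expR subr_le0 ler_wpM2l ?rd_sqnorm_ge0//.
by rewrite lef_pV2 ?posrE ?mulr_gt0// ler_pM2l.
Qed.

Lemma diffusion_heat_kernel :
  diffusion_kernel mu d (fun t x y => heat_kernel t (rd_sub x y)).
Proof.
split.
- by move=> t x y; exact: heat_kernel_ge0.
- apply: measurable_funM.
    apply: (measurableT_comp (measurable_powR _)).
    by apply: measurable_funM => //; exact: measurable_fst.
  apply: measurableT_comp => //; apply: measurableT_comp => //.
  apply: measurable_funM.
    exact: (measurableT_comp measurable_rd_sqnorm_sub measurable_snd).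
  apply: (measurableT_comp measurable_inv).
  by apply: measurable_funM => //; exact: measurable_fst.
- move=> t x t0; under eq_integral do rewrite heat_kernel_prod//.
  under eq_integral do under eq_bigr do rewrite tnth_rd_sub.
  apply: (integral_Rd_prod1 (F := fun i r => gaussian t (tnth x i - r))).
  + move=> i; apply: measurable_funM => //; apply: measurableT_comp => //.
    apply: measurableT_comp => //; apply: measurable_funM => //.
    by apply: measurable_funX; exact: measurable_funB.
  + by move=> i r; rewrite mulr_ge0 ?powR_ge0 ?expR_ge0.
  + by move=> i; exact: integral_gaussian.
- by move=> t x y; rewrite /heat_kernel rd_sqnorm_subC.
- by move=> t t' x y; exact: heat_kernel_le.
Qed.

End gaussian.

(** * Approximate identities in L1 *)

Section approximate_identity.
Context (R : realType) d (X : measurableType d).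
Variable mu : {sigma_finite_measure set X -> \bar R}.
Variables (n : nat) (K : R -> X -> X -> R).
Hypothesis kerK : diffusion_kernel mu n K.
Hypothesis bounded_kernel : forall t, 0 < t -> exists B, forall x y, K t x y <= B.
Implicit Types (t c e : R) (x y : X) (g h : X -> R).

Local Notation L1 g := (mu.-integrable setT (fun x => (g x)%:E)).

Definition smoothing t g x : R := \int[mu]_y (K t x y * g y).

Local Notation P := smoothing.

Lemma integrable_kernelM t g x : 0 < t -> L1 g -> L1 (fun y => K t x y * g y).
Proof.
move=> t0 ig; have [B KB] := bounded_kernel t0.
have mg : measurable_fun setT g by apply/measurable_EFinP; exact: (measurable_int mu).
have mK : measurable_fun setT (K t x) by exact: (measurable_kernel_comp kerK).
have B0 : 0 <= B by apply: le_trans (KB point point); exact: (kernel_ge0 kerK).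
apply: (@le_integrable _ _ _ mu setT measurableT _ (fun y => B%:E * (g y)%:E)%E).
- by apply/measurable_EFinP; exact: measurable_funM.
- move=> y _; rewrite -EFinM !abse_EFin lee_fin !normrM.
  by rewrite ler_wpM2r// !ger0_norm// (kernel_ge0 kerK).
- exact: integrableZl.
Qed.

(** Joint integrability, which opens the way to Fubini for data that change sign. *)
Lemma integrable_kernel2 t g : 0 < t -> L1 g ->
  (mu \x mu)%E.-integrable [set: X * X] (fun p => (K t p.1 p.2 * g p.2)%:E).
Proof.
move=> t0 ig.
have mg : measurable_fun setT g by apply/measurable_EFinP; exact: (measurable_int mu).
have mK : measurable_fun [set: X * X] (fun p => K t p.1 p.2).
  exact: (measurable_kernel_comp kerK).
apply/integrable12ltyP; first by apply/measurable_EFinP; apply: measurable_funM => //;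
  exact: (measurableT_comp mg measurable_snd).
have mng : measurable_fun setT (fun y => `|g y|) by exact: measurableT_comp.
under eq_integral do under eq_integral do
  rewrite abse_EFin normrM ger0_norm ?(kernel_ge0 kerK)//.
apply: (@le_lt_trans _ _ (1%:E * \int[mu]_y (`|g y|)%:E)%E).
  apply: (@kernel_mass R d X mu (K t) (fun y => `|g y|)) => //.
    exact: (kernel_ge0 kerK).
  move=> y; under eq_integral do rewrite (kernel_sym kerK).
  by rewrite (integral_kernel kerK).
by rewrite mul1e; case/integrableP: ig => _; under eq_integral do rewrite abse_EFin.
Qed.

Lemma measurable_smoothing t g : 0 < t -> L1 g -> measurable_fun setT (P t g).
Proof.
move=> t0 ig; apply: measurableT_comp => //.
exact: (measurable_fubini_F (integrable_kernel2 t0 ig)).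
Qed.

Lemma smoothing_mass t g : 0 < t -> L1 g ->
  (\int[mu]_x (`|P t g x|)%:E <= \int[mu]_x (`|g x|)%:E)%E.
Proof.
move=> t0 ig.
have mg : measurable_fun setT g by apply/measurable_EFinP; exact: (measurable_int mu).
have mK : measurable_fun [set: X * X] (fun p => K t p.1 p.2).
  exact: (measurable_kernel_comp kerK).
have mng : measurable_fun setT (fun y => `|g y|) by exact: measurableT_comp.
apply: (@le_trans _ _ (\int[mu]_x \int[mu]_y (K t x y * `|g y|)%:E)%E); last first.
  rewrite -[leRHS]mul1e; apply: kernel_mass => //; first exact: (kernel_ge0 kerK).
  move=> y; under eq_integral do rewrite (kernel_sym kerK).
  by rewrite (integral_kernel kerK).
apply: ge0_le_integral => //.
- apply/measurable_EFinP; apply: measurableT_comp => //; exact: measurable_smoothing.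
- apply: (@measurable_inner_integral R d X _ X mu (fun x y => K t x y * `|g y|)).
    by apply: measurable_funM => //; exact: (measurableT_comp mng measurable_snd).
  by move=> x y; rewrite mulr_ge0 ?(kernel_ge0 kerK).
move=> x _; rewrite /smoothing EFin_normr_Rintegral//; last exact: integrable_kernelM.
apply: le_trans (le_abse_integral _ _ _) _ => //.
  by apply: (measurable_int mu); exact: integrable_kernelM.
by under eq_integral do rewrite abse_EFin normrM ger0_norm ?(kernel_ge0 kerK)//.
Qed.

Lemma smoothingD t g h c x : 0 < t -> L1 g -> L1 h ->
  P t (fun y => g y + c * h y) x = P t g x + c * P t h x.
Proof.
move=> t0 ig ih; rewrite /smoothing.
have ikg := integrable_kernelM x t0 ig; have ikh := integrable_kernelM x t0 ih.
rewrite -RintegralZl// -RintegralD//.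
- by apply: eq_Rintegral => y _; rewrite mulrDr mulrCA.
- by rewrite /comp; under eq_fun do rewrite EFinM; exact: integrableZl.
Qed.

Definition smoothing_error t g : \bar R := (\int[mu]_x (`|P t g x - g x|)%:E)%E.

(** The data at which the semigroup is strongly continuous in L1. The next lemmas
show that they form a closed subspace, stable under dominated limits. *)
Definition l1_regular g := forall e, 0 < e ->
  \forall t \near 0^'+, (smoothing_error t g <= e%:E)%E.

Lemma integrableDM g h c : L1 g -> L1 h -> L1 (fun x => g x + c * h x).
Proof.
move=> ig ih; rewrite (_ : (fun x => _) = (fun x => (g x)%:E + c%:E * (h x)%:E)%E) //.
by apply: integrableD => //; exact: integrableZl.
Qed.

Let mL1 g : L1 g -> measurable_fun setT g.
Proof. by move=> ig; apply/measurable_EFinP; exact: (measurable_int mu). Qed.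

Lemma l1_regularD g h c : L1 g -> L1 h -> l1_regular g -> l1_regular h ->
  l1_regular (fun x => g x + c * h x).
Proof.
move=> ig ih rg rh e e0.
have c0 : 0 < `|c| + 1 by rewrite ltr_wpDl.
near=> t; have t0 : 0 < t by near: t; exact: nbhs_right_gt.
have mPg := measurable_smoothing t0 ig; have mPh := measurable_smoothing t0 ih.
have mg := mL1 ig; have mh := mL1 ih.
have md1 : measurable_fun setT (fun x => `|P t g x - g x|).
  by apply: measurableT_comp => //; exact: measurable_funB.
have md2 : measurable_fun setT (fun x => `|P t h x - h x|).
  by apply: measurableT_comp => //; exact: measurable_funB.
apply: (@le_trans _ _ (\int[mu]_x (`|P t g x - g x| + (`|c| + 1) * `|P t h x - h x|)%:E)%E).
  apply: le_integral_EFin => //.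
  - apply: measurableT_comp => //; apply: measurable_funB.
      by apply: measurable_smoothing => //; exact: integrableDM.
    by apply: measurable_funD => //; exact: measurable_funM.
  - by apply: measurable_funD => //; exact: measurable_funM.
  move=> x; rewrite smoothingD// opprD addrACA -mulrBr.
  apply: le_trans (ler_normD _ _) _; rewrite lerD2l normrM ler_wpM2r//.
  by rewrite lerDl.
rewrite integral_EFinD//; last first.
  exact: measurable_funM.
rewrite integral_EFinMl ?(ltW c0)//.
have h1 : (smoothing_error t g <= (e / 2)%:E)%E.
  by near: t; apply: rg; rewrite divr_gt0.
have h2 : (smoothing_error t h <= (e / 2 / (`|c| + 1))%:E)%E.
  by near: t; apply: rh; rewrite !divr_gt0.
apply: le_trans (leeD h1 (lee_wpmul2l _ h2)) _; first by rewrite lee_fin ltW.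
rewrite -EFinM -EFinD lee_fin (_ : (_ + 1) * _ = e / 2); last by field; rewrite gt_eqF.
by rewrite -splitr.
Unshelve. all: by end_near. Qed.

(** Closedness in L1 follows from the contraction property of smoothing. *)
Lemma l1_regular_approx g : L1 g ->
  (forall e, 0 < e -> exists h, [/\ L1 h, l1_regular h &
     (\int[mu]_x (`|g x - h x|)%:E <= e%:E)%E]) -> l1_regular g.
Proof.
move=> ig happ e e0; have e3 : 0 < e / 3 by rewrite divr_gt0.
have [h [ih rh gh]] := happ _ e3.
near=> t; have t0 : 0 < t by near: t; exact: nbhs_right_gt.
have igh : L1 (fun x => g x + (-1) * h x) by exact: integrableDM.
have ghE x : g x + (-1) * h x = g x - h x by rewrite mulN1r.
have m1 : measurable_fun setT (fun x => `|P t (fun x => g x + (-1) * h x) x|).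
  by apply: measurableT_comp => //; exact: measurable_smoothing.
have m2 : measurable_fun setT (fun x => `|P t h x - h x|).
  apply: measurableT_comp => //; apply: measurable_funB; last exact: mL1.
  exact: measurable_smoothing.
have m3 : measurable_fun setT (fun x => `|g x - h x|).
  by apply: measurableT_comp => //; apply: measurable_funB; exact: mL1.
apply: (@le_trans _ _ (\int[mu]_x (`|P t (fun x => g x + (-1) * h x) x| +
    `|P t h x - h x| + `|g x - h x|)%:E)%E).
  apply: le_integral_EFin => //.
  - apply: measurableT_comp => //; apply: measurable_funB; last exact: mL1.
    exact: measurable_smoothing.
  - by apply: measurable_funD => //; exact: measurable_funD.
  move=> x; rewrite smoothingD// (distrC (g x)).
  rewrite (_ : P t g x - g x = (P t g x + -1 * P t h x) + (P t h x - h x) + (h x - g x)); last by ring.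
  by apply: le_trans (ler_normD _ _) _; rewrite lerD2r ler_normD.
rewrite integral_EFinD//; last exact: measurable_funD.
rewrite integral_EFinD//.
have h1 : (\int[mu]_x (`|P t (fun x => g x + (-1) * h x) x|)%:E <= (e / 3)%:E)%E.
  apply: le_trans (smoothing_mass t0 igh) _.
  by under eq_integral do rewrite ghE.
have h2 : (smoothing_error t h <= (e / 3)%:E)%E by near: t; exact: rh.
apply: le_trans (leeD (leeD h1 h2) gh) _; rewrite -!EFinD lee_fin.
by rewrite le_eqVlt; apply/orP; left; apply/eqP; field.
Unshelve. all: by end_near. Qed.

Lemma l1_regular_dominated (g_ : nat -> X -> R) g h : L1 h -> measurable_fun setT g ->
  (forall m, L1 (g_ m)) -> (forall m, l1_regular (g_ m)) ->
  (forall x, g_ m x @[m --> \oo] --> g x) -> (forall m x, `|g_ m x| <= h x) ->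
  L1 g /\ l1_regular g.
Proof.
move=> ih mg ig rg gg gh.
have [] := @dominated_convergence _ X R mu setT measurableT
  (fun m x => (g_ m x)%:E) (fun x => (g x)%:E) (fun x => (h x)%:E).
- by move=> m; exact: (measurable_int mu).
- exact/measurable_EFinP.
- by apply: aeW => x _; apply: cvg_EFin; [exact: nearW|exact: gg].
- exact: ih.
- by apply: aeW => x m _; rewrite abse_EFin lee_fin.
move=> iig cvg0 _; split=> //; apply: l1_regular_approx => // e e0.
move/fine_cvgP: cvg0 => [fin /cvgrPdist_le/(_ e e0) near_e].
have [m [fm em]] : exists m, (\int[mu]_x `|(g_ m x)%:E - (g x)%:E|)%E \is a fin_num /\
    `|0 - fine (\int[mu]_x `|(g_ m x)%:E - (g x)%:E|)%E| <= e.
  have [N _ HN] : \forall m \near \oo, (\int[mu]_x `|(g_ m x)%:E - (g x)%:E|)%E \is a fin_num /\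
    `|0 - fine (\int[mu]_x `|(g_ m x)%:E - (g x)%:E|)%E| <= e by apply: filterI.
  by exists N; apply: HN => /=.
exists (g_ m); split=> //.
under eq_integral do rewrite distrC -abse_EFin EFinB.
rewrite -(fineK fm) lee_fin; apply: le_trans em; rewrite sub0r normrN.
exact: ler_norm.
Qed.

(** Smoothing does not create mass, so what appears outside U has left U: the total
error is at most twice the error inside. Hence pointwise convergence inside U
suffices, by dominated convergence. *)
Lemma l1_regular_concentrated (U : set X) : measurable U -> (mu U < +oo)%E ->
  (forall x, U x -> P t (\1_U) x @[t --> 0^'+] --> (1 : R)) ->
  l1_regular \1_U.
Proof.
move=> mU Uoo PU.
have iU : L1 (\1_U : X -> R).
  apply/integrableP; split; first by apply/measurable_EFinP.
  under eq_integral do rewrite abse_EFin ger0_norm//.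
  by rewrite integral_indic// setIT.
have mI : measurable_fun setT (\1_U : X -> R) by [].
have P01 t x : 0 < t -> 0 <= P t \1_U x <= 1.
  move=> t0; apply/andP; split.
    by apply: Rintegral_ge0 => y _; rewrite mulr_ge0 ?(kernel_ge0 kerK).
  rewrite -lee_fin /smoothing /Rintegral fineK; last first.
    by apply: integrable_fin_num => //; exact: integrable_kernelM.
  rewrite -(integral_kernel kerK x t0); apply: le_integral_EFin => //.
  - by apply/mL1; exact: integrable_kernelM.
  - exact: (measurable_kernel_comp kerK).
  - by move=> y; rewrite mulr_ge0 ?(kernel_ge0 kerK).
  - by move=> y; rewrite ler_piMr ?(kernel_ge0 kerK)// indicE lern1 leq_b1.
pose D t x : R := \1_U x * (1 - P t \1_U x).
have D0 t x : 0 < t -> 0 <= D t x by move=> t0; have /andP[_ ?] := P01 t x t0; rewrite mulr_ge0 ?subr_ge0.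
have mD t : 0 < t -> measurable_fun setT (D t).
  by move=> t0; apply: measurable_funM => //; apply: measurable_funB => //; exact: measurable_smoothing.
have err t : 0 < t -> (smoothing_error t \1_U <= 2%:E * \int[mu]_x (D t x)%:E)%E.
  move=> t0; have mP := measurable_smoothing t0 iU.
  have md : measurable_fun setT (fun x => `|P t \1_U x - \1_U x|).
    by apply: measurableT_comp => //; exact: measurable_funB.
  (* On U the error is 1 - P, so error + 1_U = 2 (1 - P) + P; outside U all terms
  but the two copies of P vanish. *)
  have h : (smoothing_error t \1_U + \int[mu]_x (\1_U x)%:E =
      2%:E * \int[mu]_x (D t x)%:E + \int[mu]_x (P t \1_U x)%:E)%E.
    rewrite -integral_EFinD// -integral_EFinMl//; last 2 first.
    - exact: mD.
    - by move=> x; exact: D0.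
    rewrite -integral_EFinD//; last 3 first.
    - by apply: measurable_funM => //; exact: mD.
    - by move=> x; rewrite mulr_ge0// D0.
    - by move=> x; case/andP: (P01 t x t0).
    apply: eq_integral => x _; congr EFin; have /andP[? ?] := P01 t x t0.
    rewrite /D indicE; case: (x \in U); rewrite /= ?mul1r ?mul0r ?subr0.
      by rewrite ler0_norm ?subr_le0//; ring.
    by rewrite ger0_norm//; ring.
  have hP : (\int[mu]_x (P t \1_U x)%:E <= \int[mu]_x (\1_U x)%:E)%E.
    rewrite (_ : \int[mu]_x (P t \1_U x)%:E = \int[mu]_x (`|P t \1_U x|)%:E)%E; last first.
      by apply: eq_integral => x _; rewrite ger0_norm//; case/andP: (P01 t x t0).
    rewrite (_ : \int[mu]_x (\1_U x)%:E = \int[mu]_x (`|\1_U x|)%:E)%E; last first.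
      by apply: eq_integral => x _; rewrite ger0_norm.
    exact: smoothing_mass.
  have fU : (\int[mu]_x (\1_U x)%:E)%E \is a fin_num by exact: integrable_fin_num.
  rewrite -(leeD2rE _ _ fU) h; exact: leeD2l.
move=> e e0.
have DU s : 0 < s -> (\int[mu]_x (D s x)%:E)%E \is a fin_num.
  move=> s0; apply: integrable_fin_num => //; apply: (le_integrable measurableT _ _ iU).
    by apply/measurable_EFinP; exact: mD.
  move=> x _; rewrite !abse_EFin lee_fin ger0_norm ?D0// ger0_norm// /D.
  by rewrite ler_piMr//; have /andP[? ?] := P01 s x s0; lra.
have cD : fine (\int[mu]_x (D s x)%:E)%E @[s --> 0^'+] --> (0 : R).
  apply/cvg_at_rightP => v [v0 vcvg].
  have [] := @dominated_convergence _ X R mu setT measurableT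
    (fun m x => (D (v m) x)%:E) (fun=> 0%E) (fun x => (\1_U x)%:E).
  - by move=> m; apply/measurable_EFinP; exact: mD.
  - by [].
  - apply: aeW => x _; apply: cvg_EFin; first exact: nearW.
    have : D (v m) x @[m --> \oo] --> (0 : R); last by [].
    have [xU|xU] := boolP (x \in U); last first.
      rewrite (_ : (fun m => D (v m) x) = (fun=> 0)); first exact: cvg_cst.
      by apply/funext => m; rewrite /D indicE (negbTE xU) mul0r.
    rewrite (_ : (fun m => D (v m) x) = (fun m => 1 - P (v m) \1_U x)); last first.
      by apply/funext => m; rewrite /D indicE xU mul1r.
    rewrite -[X in _ --> X](subrr (1 : R)); apply: (@cvgB _ R^o); first exact: cvg_cst.
    by move/cvg_at_rightP: (PU x (set_mem xU)); apply.
  - exact: iU.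
  - apply: aeW => x m _; rewrite abse_EFin lee_fin ger0_norm ?D0// /D.
    by rewrite ler_piMr//; have /andP[? ?] := P01 (v m) x (v0 m); lra.
  by move=> _ _; rewrite integral0 => /fine_cvgP[].
have e2 : 0 < 2^-1 * e by rewrite mulr_gt0.
move/(@cvgrPdist_le _ R^o)/(_ _ e2) : cD => cD.
near=> t; have t0 : 0 < t by near: t; exact: nbhs_right_gt.
apply: le_trans (err t t0) _.
rewrite -(fineK (DU _ t0)) -EFinM lee_fin -ler_pdivlMl//.
have : `|0 - fine (\int[mu]_x (D t x)%:E)%E| <= 2^-1 * e by near: t; exact: cD.
by rewrite sub0r normrN; apply: le_trans; exact: ler_norm.
Unshelve. all: by end_near. Qed.

End approximate_identity.

(** * The heat kernel is an approximate identity *)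

Lemma l1_regular_sum (R : realType) d (X : measurableType d)
    (mu : {sigma_finite_measure set X -> \bar R}) n (K : R -> X -> X -> R)
    (kerK : diffusion_kernel mu n K)
    (bK : forall t, 0 < t -> exists B, forall x y, K t x y <= B)
    (I : Type) (s : seq I) (c : I -> R) (g : I -> X -> R) :
  (forall i, mu.-integrable setT (fun x => (g i x)%:E)) ->
  (forall i, l1_regular mu K (g i)) ->
  mu.-integrable setT (fun x => (\sum_(i <- s) c i * g i x)%:E) /\
  l1_regular mu K (fun x => \sum_(i <- s) c i * g i x).
Proof.
move=> ig rg; elim: s => [|i s [IH1 IH2]].
  split; first by under eq_fun do rewrite big_nil; exact: integrable0.
  rewrite (_ : (fun x => _) = (fun=> 0)); last by apply/funext => x; rewrite big_nil.
  move=> e e0; near=> t; rewrite /smoothing_error /smoothing.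
  under eq_integral => x _.
    rewrite (_ : \int[mu]_y _ = 0); last first.
      by rewrite /Rintegral; under eq_integral do rewrite mulr0; rewrite integral0.
    rewrite subrr normr0; over.
  by rewrite integral0 lee_fin ltW.
have E : (fun x => \sum_(j <- i :: s) c j * g j x) =
    (fun x => \sum_(j <- s) c j * g j x + c i * g i x).
  by apply/funext => x; rewrite big_cons addrC.
split; last by rewrite E; exact: (l1_regularD kerK bK).
by under eq_fun do rewrite big_cons addrC; exact: integrableDM.
Unshelve. all: by end_near. Qed.

Section heat_kernel_regular.
Import HBSimple.
Context (R : realType) (d : nat).
Local Notation RT := (measurableTypeR R).
Local Notation mu := (lebesgue_Rd R d).
Implicit Types (t r a e : R) (x y : Rd R d) (U A : set (Rd R d)).

Definition heat_K t x y : R := heat_kernel t (rd_sub x y).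

Local Notation K := heat_K.
Local Notation L1 g := (mu.-integrable setT (fun x => (g x)%:E)).
Local Notation regular := (l1_regular mu heat_K).

Let kerK : diffusion_kernel mu d K. Proof. exact: diffusion_heat_kernel. Qed.

Lemma bounded_heat_kernel t : 0 < t -> exists B, forall x y, K t x y <= B.
Proof.
move=> t0; exists ((4 * pi * t) `^ (- (d%:R / 2))) => x y.
rewrite /heat_K /heat_kernel ler_piMr ?powR_ge0// -[leRHS]expR0 ler_expR oppr_le0.
by rewrite divr_ge0 ?rd_sqnorm_ge0// mulr_ge0// ltW.
Qed.

(** Away from the origin the kernel at time 2 t leaves the surplus
exp(- r / (8 t)) <= 8 t / r, and doubling the time costs at most 2 ^ d. *)
Lemma heat_kernel_tail t r (z : Rd R d) : 0 < t -> 0 < r -> r <= rd_sqnorm z ->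
  heat_kernel t z <= 2 ^+ d * (8 * t / r) * heat_kernel (2 * t) z.
Proof.
move=> t0 r0 rz; have t20 : 0 < 2 * t by rewrite mulr_gt0.
rewrite (heat_kernel_rescale z t0 t20) ler_wpM2r ?heat_kernel_ge0//.
rewrite (_ : 2 * t / t = 2); last by field; rewrite gt_eqF.
apply: ler_pM; rewrite ?powR_ge0 ?expR_ge0//.
  rewrite -(@powR_mulrn _ 2 d)//; apply: ler_powR; first by rewrite ler1n.
  by rewrite ler_pdivrMr// ler_peMr// ler1n.
rewrite (_ : _ - _ = - (rd_sqnorm z / (8 * t))); last by field; rewrite gt_eqF.
have s0 : 0 < rd_sqnorm z / (8 * t) by rewrite divr_gt0 ?mulr_gt0// (lt_le_trans r0).
apply: (@le_trans _ _ ((rd_sqnorm z / (8 * t))^-1)).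
  rewrite expRN lef_pV2 ?posrE ?expR_gt0//.
  by apply: le_trans (expR_ge1Dx _); rewrite lerDr.
rewrite invf_div ler_pM2l ?mulr_gt0// lef_pV2 ?posrE//.
exact: lt_le_trans rz.
Qed.

(** At an interior point the mass that leaves the neighbourhood is a Gaussian tail,
bounded by a multiple of t times a kernel of mass 1. *)
Lemma smoothing_heat_interior U x r : measurable U -> (mu U < +oo)%E -> 0 < r ->
  (forall y, rd_sqnorm (rd_sub x y) < r -> U y) ->
  smoothing mu K t \1_U x @[t --> 0^'+] --> (1 : R).
Proof.
move=> mU Uoo r0 xU.
have iU : L1 (\1_U : Rd R d -> R).
  apply/integrableP; split; first by apply/measurable_EFinP.
  under eq_integral do rewrite abse_EFin ger0_norm//.
  by rewrite integral_indic// setIT.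
apply/(@cvgrPdist_le _ R^o) => e e0.
have e1 : 0 < e * r / (2 ^+ d * 8) by rewrite divr_gt0 ?mulr_gt0 ?exprn_gt0.
near=> t; have t0 : 0 < t by near: t; exact: nbhs_right_gt.
have te : t <= e * r / (2 ^+ d * 8) by near: t; exact: nbhs_right_le.
have t20 : 0 < 2 * t by rewrite mulr_gt0.
have mK s : measurable_fun setT (K s x) by exact: (measurable_kernel_comp kerK).
have K0 s y : 0 <= K s x y by exact: (kernel_ge0 kerK).
have mI : measurable_fun setT (\1_U : Rd R d -> R) by [].
have mKI : measurable_fun setT (fun y => K t x y * \1_U y) by exact: measurable_funM.
have KI0 y : 0 <= K t x y * \1_U y by rewrite mulr_ge0.
have c0 : 0 <= 2 ^+ d * (8 * t / r).
  by rewrite mulr_ge0 ?exprn_ge0// divr_ge0 ?mulr_ge0// ltW.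
have PE : (smoothing mu K t \1_U x)%:E = (\int[mu]_y (K t x y * \1_U y)%:E)%E.
  rewrite /smoothing /Rintegral fineK//; apply: integrable_fin_num => //.
  exact: (integrable_kernelM kerK bounded_heat_kernel).
have P1 : smoothing mu K t \1_U x <= 1.
  rewrite -lee_fin PE -(integral_kernel kerK x t0); apply: le_integral_EFin => // y.
  by rewrite ler_piMr// indicE lern1 leq_b1.
have : (1 <= smoothing mu K t \1_U x + 2 ^+ d * (8 * t / r)).
  rewrite -lee_fin EFinD PE -[X in (X <= _)%E](integral_kernel kerK x t0).
  rewrite -[X in (_ + X)%E]mule1 -(integral_kernel kerK x t20) -integral_EFinMl//.
  rewrite -integral_EFinD//; last 2 first.
  - exact: measurable_funM.
  - by move=> y; rewrite mulr_ge0.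
  apply: le_integral_EFin => //.
    by apply: measurable_funD => //; exact: measurable_funM.
  move=> y; rewrite indicE; have [yU|yU] := boolP (y \in U).
    by rewrite mulr1 lerDl mulr_ge0.
  rewrite mulr0 add0r; apply: heat_kernel_tail => //; rewrite leNgt.
  by apply/negP => /xU /mem_set; rewrite (negbTE yU).
move=> h; rewrite ger0_norm ?subr_ge0//.
have : 2 ^+ d * (8 * t / r) <= e; last by lra.
rewrite mulrA ler_pdivrMr// mulrA mulrC.
by rewrite ler_pdivlMr ?mulr_gt0 ?exprn_gt0// in te.
Unshelve. all: by end_near. Qed.

Lemma rd_box_interior (A : 'I_d -> set R) x :
  (forall i, exists2 r, 0 < r & forall s, `|tnth x i - s| < r -> A i s) ->
  exists2 r, 0 < r & forall y, rd_sqnorm (rd_sub x y) < r -> rd_box A y.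
Proof.
move=> hA.
have hA' (i : 'I_d) : exists r : R, 0 < r /\ forall s : R, `|tnth x i - s| < r -> A i s.
  by have [r r0 hr] := hA i; exists r.
have [rho hrho] := choice hA'.
pose m := \big[Order.min/1]_(i < d) rho i.
have m0 : 0 < m by apply: lt_bigmin => // i _; case: (hrho i).
exists (m ^+ 2) => [|y xy i]; first by rewrite exprn_gt0.
have [_] := hrho i; apply; apply: (@lt_le_trans _ _ m); last exact: bigmin_le.
rewrite -(ltr_pXn2r (n := 2))// ?nnegrE ?(ltW m0)//; apply: le_lt_trans xy.
rewrite real_normK ?num_real// /rd_sqnorm (bigD1 i)//= tnth_rd_sub lerDl.
by apply: sumr_ge0 => j _; exact: sqr_ge0.
Qed.

Definition cube (m : nat) : set (Rd R d) := rd_box (fun=> `]- m%:R, m%:R[%classic).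

Lemma measurable_cube m : measurable (cube m).
Proof. by apply: measurable_rd_box => i; exact: measurable_itv. Qed.

Lemma cube_lty m : (mu (cube m) < +oo)%E.
Proof.
rewrite lebesgue_Rd_box; last by move=> i; exact: measurable_itv.
pose J : set R := `]- m%:R, m%:R[%classic.
suff [] : (\prod_(i < d) lebesgue_measure J < +oo /\
    0 <= \prod_(i < d) lebesgue_measure J)%E by [].
elim/big_ind: _ => [|a b [aoo a0] [boo b0]|i _].
- by rewrite ltry.
- by split; [rewrite lte_mul_pinfty// ge0_fin_numE|exact: mule_ge0].
- split; last exact: measure_ge0.
  by rewrite lebesgue_measure_itv/=; case: ifP => // _; rewrite -EFinB ltry.
Qed.

Lemma cube_cover x : \forall m \near \oo, cube m x.
Proof.
pose M := \big[maxn/0%N]_(i < d) (Num.truncn `|tnth x i : R|%R).+1%N.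
exists M => // m /= Mm i; rewrite /= in_itv/= -ltr_norml.
apply: (lt_le_trans (truncnS_gt _)); rewrite ler_nat; apply: leq_trans Mm.
exact: (@leq_bigmax _ (fun i : 'I_d => (Num.truncn `|tnth x i : R|).+1)).
Qed.

(** An intersection-stable family that generates the Borel sets of R^d and consists
of open sets. *)
Definition octants : set (set (Rd R d)) :=
  [set A | exists a : 'I_d -> R, A = rd_box (fun i => `]a i, +oo[%classic)].

Lemma setI_closed_octants : setI_closed octants.
Proof.
move=> _ _ [a ->] [b ->]; exists (fun i => Num.max (a i) (b i)).
apply/seteqP; split=> [x [xa xb] i|x xab].
  by have := xa i; have := xb i; rewrite /= !in_itv/= !andbT gt_max => -> ->.
by split=> i; have := xab i; rewrite /= !in_itv/= !andbT gt_max => /andP[].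
Qed.

Lemma measurable_octants : @measurable _ (Rd R d) `<=` <<s octants >>.
Proof.
have coord (i : 'I_d) (A : set RT) : measurable A -> <<s octants >> ((fun x : Rd R d => tnth x i) @^-1` A).
  move=> mA0; have mA : (@ocitv R).-sigma.-measurable A := mA0.
  rewrite RGenOInfty.measurableE in mA.
  have sub : @RGenOInfty.G R `<=` [set A | <<s octants >> ((fun x : Rd R d => tnth x i) @^-1` A)].
    move=> _ [a ->] /=.
    rewrite (_ : _ @^-1` _ = \bigcup_m rd_box (fun j => `](if j == i then a else - m%:R), +oo[%classic)).
      by apply: sigma_algebra_bigcup => m; apply: sub_sigma_algebra; eexists; reflexivity.
    apply/seteqP; split=> [x|x [m _ /(_ i)]]; last by rewrite /= eqxx.
    rewrite /= in_itv/= andbT => ax; have [m _ /(_ _ (leqnn m)) xm] := cube_cover x.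
    exists m => // j; rewrite /= in_itv/= andbT; case: eqP => [->//|_].
    by have := xm j; rewrite /= in_itv/= => /andP[].
  move: A {mA0} mA; apply: smallest_sub => //; split => /=.
  - by rewrite preimage_set0; exact: sigma_algebra0.
  - by move=> A hA; rewrite setTD preimage_setC -setTD; exact: sigma_algebraCD.
  - by move=> A hA; rewrite preimage_bigcup; exact: sigma_algebra_bigcup.
apply: smallest_sub; first exact: smallest_sigma_algebra.
move=> B; rewrite -bigcup_seq => -[i _ [A mA <-]]; rewrite setTI.
exact: coord.
Qed.

Let integrable_indic_lty U : measurable U -> (mu U < +oo)%E -> L1 (\1_U : Rd R d -> R).
Proof.
move=> mU Uoo; apply/integrableP; split; first by apply/measurable_EFinP.
under eq_integral do rewrite abse_EFin ger0_norm//.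
by rewrite integral_indic// setIT.
Qed.

Let cubeI_lty A m : measurable A -> (mu (A `&` cube m) < +oo)%E.
Proof.
move=> mA; apply: le_lt_trans (cube_lty m); apply: le_measure; rewrite ?inE.
- by apply: measurableI => //; exact: measurable_cube.
- exact: measurable_cube.
- exact: subIsetr.
Qed.

Lemma regular_octant A m : octants A -> regular \1_(A `&` cube m).
Proof.
move=> [a ->]; rewrite /cube.
have mA : measurable (rd_box (fun i : 'I_d => `]a i, +oo[%classic : set RT)).
  by apply: measurable_rd_box => i; exact: measurable_itv.
have AI : rd_box (fun i => `]a i, +oo[%classic) `&` cube m =
    rd_box (fun i => `]a i, +oo[%classic `&` `]- m%:R, m%:R[%classic).
  apply/seteqP; split=> [x [xa xb] i|x xab]; first by split; [exact: xa|exact: xb].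
  by split=> i; case: (xab i).
apply: (l1_regular_concentrated kerK bounded_heat_kernel).
- by apply: measurableI => //; exact: measurable_cube.
- exact: (cubeI_lty m).
move=> x xA; have [r r0 hr] : exists2 r, 0 < r &
    forall y, rd_sqnorm (rd_sub x y) < r -> rd_box (fun i => `]a i, +oo[%classic `&` `]- m%:R, m%:R[%classic) y.
  apply: rd_box_interior => i; rewrite -/(cube m) AI in xA.
  have [/=] := xA i; rewrite !in_itv/= andbT => ax /andP[mx xm].
  exists (Num.min (tnth x i - a i) (Num.min (tnth x i + m%:R) (m%:R - tnth x i))).
    by rewrite !lt_min; apply/and3P; split; lra.
  move=> s; rewrite !lt_min => /and3P[] /ltr_normlP[? ?] /ltr_normlP[? ?] /ltr_normlP[? ?].
  by rewrite /= !in_itv/= andbT; split; [lra|apply/andP; split; lra].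
apply: (smoothing_heat_interior (r := r)) => //.
- by apply: measurableI => //; exact: measurable_cube.
- exact: (cubeI_lty m).
- by rewrite -/(cube m) AI.
Qed.

(** Sets whose truncations are regular form a lambda-system, so the pi-lambda
theorem passes from octants to all measurable sets. *)
Lemma regular_cube A m : measurable A -> regular \1_(A `&` cube m).
Proof.
move=> mA; pose H := [set A | measurable A /\ forall m, regular \1_(A `&` cube m)].
suff : @measurable _ (Rd R d) `<=` H by move=> /(_ _ mA)[].
apply: subset_trans measurable_octants _.
have rcube j : regular \1_([set: Rd R d] `&` cube j).
  have -> : [set: Rd R d] `&` cube j = rd_box (fun=> `]- j%:R, +oo[%classic) `&` cube j.
    apply/seteqP; split=> [x [_ xj]|x [_ xj]]; split=> // i.
    by have := xj i; rewrite /= !in_itv/= andbT => /andP[].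
  by apply: regular_octant; exists (fun=> - j%:R).
apply: (@lambda_system_subset _ octants setI_closed_octants setT H) => //; last first.
  move=> _ [a ->]; split=> [|j]; first by apply: measurable_rd_box => i; exact: measurable_itv.
  by apply: regular_octant; exists a.
split=> //.
- move=> B A' AB [mB rB] [mA' rA]; split=> [|j]; first exact: measurableD.
  rewrite (_ : \1__ = (fun x => \1_(B `&` cube j) x + (-1) * \1_(A' `&` cube j) x : R)).
    apply: (l1_regularD kerK bounded_heat_kernel) => //; apply: integrable_indic_lty.
    + by apply: measurableI => //; exact: measurable_cube.
    + exact: cubeI_lty.
    + by apply: measurableI => //; exact: measurable_cube.
    + exact: cubeI_lty.
  apply/funext => x; rewrite !indicE setDE !in_setI in_setC mulN1r.
  have [xA|xA] := boolP (x \in A'); last by rewrite /= subr0 andbT.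
  by rewrite (mem_set (AB _ (set_mem xA)))/= subrr.
- move=> F ndF HF; split=> [|j].
    by apply: bigcup_measurable => k _; case: (HF k).
  have mF k : measurable (F k) by case: (HF k).
  have [] := @l1_regular_dominated R _ (Rd R d) mu d heat_K kerK bounded_heat_kernel
    (fun k => \1_(F k `&` cube j)) (\1_(\bigcup_i F i `&` cube j) : Rd R d -> R) (\1_(cube j) : Rd R d -> R);
    last by [].
  + by apply: integrable_indic_lty; [exact: measurable_cube|exact: cube_lty].
  + apply: measurable_indic; apply: measurableI; last exact: measurable_cube.
    exact: bigcup_measurable.
  + move=> k; apply: integrable_indic_lty; last exact: cubeI_lty.
    by apply: measurableI => //; exact: measurable_cube.
  + by move=> k; case: (HF k).
  + move=> x; have [[[k _ Fkx] xj]|nx] := pselect ((\bigcup_i F i `&` cube j) x).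
      rewrite indicE mem_set; last by split=> //; exists k.
      apply: cvg_near_cst; exists k => // l /= kl; rewrite indicE mem_set//; split=> //.
      by move/subsetPset: (ndF _ _ kl); apply.
    rewrite indicE memNset//; apply: cvg_near_cst; apply: nearW => k.
    by rewrite indicE memNset// => -[Fkx xj]; apply: nx; split=> //; exists k.
  + move=> k x; rewrite !indicE in_setI ger0_norm//.
    by case: (x \in cube j); rewrite ?andbT ?andbF// lern1 leq_b1.
Qed.

(** Simple functions are handled by linearity on each cube and then by dominated
convergence; they are dense in L1. *)
Theorem heat_kernel_l1_regular (g : Rd R d -> R) : L1 g -> regular g.
Proof.
have simple (f : {sfun (Rd R d) >-> R}) : L1 (f : Rd R d -> R) -> regular (f : Rd R d -> R).
  move=> intf; have mf : measurable_fun setT f by [].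
  apply: (l1_regular_dominated kerK bounded_heat_kernel
    (g_ := fun m x => f x * \1_(cube m) x) (h := fun x => `|f x|) _ mf _ _ _ _).2.
  - by have := integrable_abse intf.
  - move=> m; apply: (le_integrable measurableT _ _ intf).
      apply/measurable_EFinP; apply: measurable_funM => //.
      by apply: measurable_indic; exact: measurable_cube.
    by move=> x _; rewrite !abse_EFin lee_fin normrM ler_piMr// indicE ger0_norm// lern1 leq_b1.
  - move=> m; pose s := finmap.enum_fset (fset_set (range f)).
    have fE : (fun x => f x * \1_(cube m) x) =
        (fun x => \sum_(c <- s) c * \1_(f @^-1` [set c] `&` cube m) x).
      apply/funext => x; rewrite [f x]fimfunE fsbig_finite//= mulr_suml; apply: eq_bigr => c _.
      by rewrite -mulrA; congr (_ * _); rewrite !indicE in_setI -mulnb natrM.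
    rewrite fE; apply: (l1_regular_sum kerK bounded_heat_kernel s id _ _).2 => i.
      apply: integrable_indic_lty; last exact: cubeI_lty.
      by apply: measurableI => //; exact: measurable_cube.
    exact: regular_cube.
  - move=> x; have [N _ HN] := cube_cover x; apply: cvg_near_cst; exists N => // m Nm.
    by rewrite indicE mem_set ?mulr1//; exact: HN.
  - by move=> m x; rewrite normrM ler_piMr// indicE ger0_norm// lern1 leq_b1.
move=> ig; apply: (l1_regular_approx kerK bounded_heat_kernel) => // e e0.
have [g_ [ig_ _ cvg0]] := approximation_sfun_integrable measurableT ig.
move/fine_cvgP: cvg0 => [fin /cvgrPdist_le/(_ e e0) near_e].
have [N _ HN] : \forall m \near \oo, (\int[mu]_x `|(g x)%:E - (g_ m x)%:E|)%E \is a fin_num /\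
  `|0 - fine (\int[mu]_x `|(g x)%:E - (g_ m x)%:E|)%E| <= e by apply: filterI.
have [fN eN] := HN N (leqnn N); exists (g_ N); split; [exact: ig_|by apply: simple; exact: ig_|].
under eq_integral do rewrite -abse_EFin EFinB.
rewrite -(fineK fN) lee_fin; apply: le_trans eN; rewrite sub0r normrN.
exact: ler_norm.
Qed.

End heat_kernel_regular.

(** * Essential bounds and limits of norms *)

Lemma cvge0_le (R : realType) T (F : set_system T) {FF : Filter F} (N : T -> \bar R) :
  (forall t, 0 <= N t)%E -> (forall e : R, 0 < e -> \forall t \near F, (N t <= e%:E)%E) ->
  N t @[t --> F] --> 0%E.
Proof.
move=> N0 Ne; apply/fine_cvgP; split.
  apply: filterS (Ne 1 ltr01) => t Nt; rewrite ge0_fin_numE//.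
  exact: le_lt_trans Nt (ltry _).
apply/cvgrPdist_le => e e0; apply: filterS (Ne e e0) => t Nt.
rewrite sub0r normrN /= ger0_norm ?fine_ge0// -lee_fin fineK//.
by rewrite ge0_fin_numE//; exact: le_lt_trans Nt (ltry _).
Qed.

Lemma cvge0_near_le (R : realType) T (F : set_system T) {FF : Filter F} (N : T -> \bar R) :
  N t @[t --> F] --> 0%E -> forall e : R, 0 < e -> \forall t \near F, (N t <= e%:E)%E.
Proof.
move=> /fine_cvgP[fN /cvgrPdist_le cN] e e0.
apply: filterS2 fN (cN e e0) => t fNt; rewrite sub0r normrN /= => h.
by rewrite -(fineK fNt) lee_fin; apply: le_trans h; exact: ler_norm.
Qed.

Lemma near_within_right (R : realType) (P : R -> Prop) : P 0 ->
  (\forall s \near 0^'+, P s) -> \forall s \near within `[0, +oo[ (nbhs (0 : R)), P s.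
Proof.
move=> P0 Pr; rewrite near_withinE.
have Pr' : \forall s \near nbhs (0 : R), 0 < s -> P s by exact: Pr.
apply: filterS Pr' => s Ps; rewrite /= in_itv/= andbT le_eqVlt => /predU1P[<-//|].
exact: Ps.
Qed.

Section infinity_norm.
Context (R : realType) d (X : measurableType d) (mu : {measure set X -> \bar R}).
Implicit Types (g : X -> R) (c : R).

Lemma Lnormoo_le_ereal (F : X -> \bar R) c : 0 <= c ->
  {ae mu, forall x, (`|F x| <= c%:E)%E} -> ('N[mu]_+oo[F] <= c%:E)%E.
Proof.
move=> c0 Fc; rewrite unlock; case: ifPn => _; last by rewrite lee_fin.
by apply/ess_supP; exact: Fc.
Qed.

Lemma Lnormoo_le g c : 0 <= c -> {ae mu, forall x, `|g x| <= c} ->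
  ('N[mu]_+oo[EFin \o g] <= c%:E)%E.
Proof.
by move=> c0 gc; apply: Lnormoo_le_ereal => //; apply: filterS gc => x; rewrite /= lee_fin.
Qed.

Lemma Lnormoo_ae g c : ('N[mu]_+oo[EFin \o g] <= c%:E)%E -> {ae mu, forall x, `|g x| <= c}.
Proof.
rewrite unlock; case: ifPn => [_ /ess_supP|mu0 _].
  by apply: filterS => x /=; rewrite lee_fin.
exists setT; split=> //; apply/eqP.
by rewrite eq_le measure_ge0 andbT leNgt.
Qed.

Lemma Lfunoo_bounded g c : measurable_fun setT g -> {ae mu, forall x, `|g x| <= c} ->
  g \in Lfun mu +oo%E.
Proof.
move=> mg gc; rewrite inE; apply/andP; split; rewrite inE//=.
apply: (@le_lt_trans _ _ (`|c|%:E)); last exact: ltry.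
apply: Lnormoo_le => //; apply: filterS gc => x /le_trans; apply; exact: ler_norm.
Qed.

Lemma Lfun_measurable p g : g \in Lfun mu p -> measurable_fun setT g.
Proof. by rewrite inE => /andP[]; rewrite inE. Qed.

End infinity_norm.

Lemma near_time_modulus (R : realType) n (t eta e : R) : 0 < eta -> 0 < e ->
  \forall s \near t, time_modulus n eta `|s - t| <= e.
Proof.
move=> eta0 e0.
have c : `|s - t| @[s --> t] --> (0 : R).
  rewrite -[X in _ --> X](@normr0 R R) -(subrr t); apply: cvg_norm.
  by apply: (@cvgB _ R^o); [exact: cvg_id|exact: cvg_cst].
have /cvgrPdist_le/(_ e e0) := cvg_comp _ _ c (time_modulus_cvg0 n eta0).
apply: filterS => s; rewrite sub0r normrN; apply: le_trans; exact: ler_norm.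
Qed.

(** The free parameter eta takes e / 8 of the singular part; the time step then
has to be small depending on eta. *)
Lemma near_duhamel_modulus (R : realType) n (t e : R) : 0 <= t -> 0 < e ->
  exists2 eta : R, 0 < eta & \forall s \near t,
    2 * (`|s - t| + eta) + 2 * time_modulus n eta `|s - t| * t <= e.
Proof.
move=> t0 e0; have e8 : 0 < e / 8 by rewrite divr_gt0.
have et : 0 < e / (4 * (t + 1)) by rewrite divr_gt0// mulr_gt0// ltr_wpDl.
exists (e / 8) => //.
have h1 : \forall s \near t, `|s - t| <= e / 8.
  have /cvgrPdist_le/(_ _ e8) : s @[s --> t] --> t by exact: cvg_id.
  by apply: filterS => s; rewrite distrC.
apply: filterS2 h1 (near_time_modulus n t e8 et) => s h1 h2.
have h3 : time_modulus n (e / 8) `|s - t| * t <= e / 4.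
  apply: le_trans (ler_wpM2r t0 h2) _.
  rewrite -mulrA ler_wpM2l ?(ltW e0)// invfM -mulrA ler_piMr// mulrC.
  by rewrite ler_pdivrMr ?mul1r ?lerDl// ltr_wpDl.
by rewrite -mulrA; lra.
Qed.

(** * Continuity in time of the solution *)

Section solution_continuity.
Context (R : realType) d (X : measurableType d).
Variable mu : {sigma_finite_measure set X -> \bar R}.
Variables (n : nat) (K : R -> X -> X -> R).
Hypothesis kerK : diffusion_kernel mu n K.
Hypothesis bounded_kernel : forall t, 0 < t -> exists B, forall x y, K t x y <= B.
Local Notation RT := (measurableTypeR R).
Local Notation S := (killed_semigroup mu K).
Local Notation D := (duhamel mu K).
Local Notation L1 g := (mu.-integrable setT (fun x => (g x)%:E)).
Local Notation nonneg t := (within `[0, +oo[ (nbhs (t : R))).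
Implicit Types (t s e : R) (x y : X) (g phi : X -> R).

Let near_ge0 t : \forall s \near nonneg t, 0 <= s.
Proof. by rewrite near_withinE; apply: nearW => s; rewrite /= in_itv/= andbT. Qed.

Let mL1 g : L1 g -> measurable_fun setT g.
Proof. by move=> ig; apply/measurable_EFinP; exact: (measurable_int mu). Qed.

Let nbhs_ge_lt t a : a < t -> \forall s \near t, a <= s.
Proof. by move=> at_; apply: filterS (lt_nbhsr at_) => s /ltW. Qed.

Lemma killed_semigroup_smoothing s g x : 0 < s ->
  S s g x = expR (- s) * smoothing mu K s g x.
Proof. by move=> s0; rewrite /killed_semigroup gt_eqF. Qed.

Lemma measurable_killed_smoothing s g : 0 <= s -> L1 g -> measurable_fun setT (S s g).
Proof.
rewrite le_eqVlt => /predU1P[<-|s0] ig.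
  by rewrite /killed_semigroup eqxx; exact: mL1.
rewrite (_ : S s g = (fun x => expR (- s) * smoothing mu K s g x)); last first.
  by apply/funext => x; rewrite killed_semigroup_smoothing.
by apply: measurable_funM => //; exact: (measurable_smoothing kerK).
Qed.

(** The killing factor only adds an error of at most s times the mass of g. *)
Lemma near0_mass_semigroup g e : L1 g -> l1_regular mu K g -> 0 < e ->
  \forall s \near nonneg 0, (\int[mu]_x (`|S s g x - S 0 g x|)%:E <= e%:E)%E.
Proof.
move=> ig rg e0; have S0 x : S 0 g x = g x by rewrite /killed_semigroup eqxx.
apply: near_within_right.
  under eq_integral do rewrite subrr normr0.
  by rewrite integral0 lee_fin ltW.
have e2 : 0 < e / 2 by rewrite divr_gt0.
have mg := mL1 ig.
have fg : (\int[mu]_x (`|g x|)%:E)%E \is a fin_num.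
  by apply: integrable_fin_num => //; exact: (integrable_abse ig).
pose m := fine (\int[mu]_x (`|g x|)%:E)%E.
have m0 : 0 <= m by rewrite fine_ge0//; apply: integral_ge0 => x _; rewrite lee_fin.
near=> s; have s0 : 0 < s by near: s; exact: nbhs_right_gt.
have mP := measurable_smoothing kerK s0 ig.
have mS := measurable_killed_smoothing (ltW s0) ig.
apply: (@le_trans _ _ (\int[mu]_x (`|smoothing mu K s g x - g x| + s * `|g x|)%:E)%E).
  apply: le_integral_EFin => //.
  - by apply: measurableT_comp => //; apply: measurable_funB => //; rewrite (funext S0).
  - apply: measurable_funD.
      by apply: measurableT_comp => //; exact: measurable_funB.
    by apply: measurable_funM => //; exact: measurableT_comp.
  move=> x; rewrite S0 killed_semigroup_smoothing//.
  rewrite (_ : _ - g x = expR (- s) * (smoothing mu K s g x - g x) + (expR (- s) - 1) * g x); last by ring.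
  apply: le_trans (ler_normD _ _) _; rewrite !normrM; apply: lerD.
    by rewrite ler_piMl// ger0_norm ?expR_ge0// -[leRHS]expR0 ler_expR oppr_le0 ltW.
  apply: ler_wpM2r => //; rewrite ler0_norm ?opprB; last first.
    by rewrite subr_le0 -[leRHS]expR0 ler_expR oppr_le0 ltW.
  by rewrite lerBlDr -lerBlDl; exact: expR_ge1Dx.
rewrite integral_EFinD//; last 3 first.
- by apply: measurableT_comp => //; exact: measurable_funB.
- by apply: measurable_funM => //; exact: measurableT_comp.
- by move=> x; rewrite mulr_ge0// ltW.
rewrite integral_EFinMl ?(ltW s0)//; last exact: measurableT_comp.
rewrite (splitr e) EFinD; apply: leeD; first by near: s; exact: rg.
rewrite -(fineK fg) -EFinM lee_fin -/m.
have sm : s <= e / 2 / (m + 1).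
  by near: s; apply: nbhs_right_le; rewrite divr_gt0// ltr_wpDl.
apply: le_trans (ler_wpM2r m0 sm) _.
rewrite (_ : _ * m = e / 2 * (m / (m + 1))); last by ring.
by rewrite ler_piMr ?(ltW e2)// ler_pdivrMr ?ltr_wpDl// mul1r lerDl.
Unshelve. all: by end_near. Qed.

(** Uniform continuity fails at time 0 for discontinuous data, so t is positive. *)
Lemma near_sup_semigroup t e g : measurable_fun setT g -> (forall y, 0 <= g y <= 1) ->
  0 < t -> 0 < e -> \forall s \near t, forall x, `|S s g x - S t g x| <= e.
Proof.
move=> mg g01 t0 e0; have t2 : 0 < t / 2 by rewrite divr_gt0.
have e2 : 0 < e / 2 by rewrite divr_gt0.
have ht : \forall s \near t, t / 2 <= s by apply: nbhs_ge_lt; rewrite ltr_pdivrMr// ltr_pMr// ltr1n.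
apply: filterS2 ht (near_time_modulus n t t2 e2) => s ts hs x.
apply: le_trans (killed_semigroup_time_sup kerK x t2 _ ts mg g01) _.
  by rewrite ler_pdivrMr// ler_peMr ?ler1n// ltW.
by lra.
Qed.

Lemma near_mass_semigroup t e g : measurable_fun setT g -> (forall y, 0 <= g y <= 1) ->
  L1 g -> l1_regular mu K g -> 0 <= t -> 0 < e ->
  \forall s \near nonneg t, (\int[mu]_x (`|S s g x - S t g x|)%:E <= e%:E)%E.
Proof.
move=> mg g01 ig rg + e0; rewrite le_eqVlt => /predU1P[<-|t0].
  exact: near0_mass_semigroup.
have fg : (\int[mu]_x (g x)%:E)%E \is a fin_num by exact: integrable_fin_num.
pose m := fine (\int[mu]_x (g x)%:E)%E.
have m0 : 0 <= m.
  by rewrite fine_ge0//; apply: integral_ge0 => x _; rewrite lee_fin; case/andP: (g01 x).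
have t2 : 0 < t / 2 by rewrite divr_gt0.
have e2 : 0 < e / 2 / (m + 1) by rewrite !divr_gt0// ltr_wpDl.
have ht : \forall s \near nonneg t, t / 2 <= s.
  by apply: cvg_within; apply: nbhs_ge_lt; rewrite ltr_pdivrMr// ltr_pMr// ltr1n.
have hm : \forall s \near nonneg t, time_modulus n (t / 2) `|s - t| <= e / 2 / (m + 1).
  by apply: cvg_within; exact: near_time_modulus.
apply: filterS2 ht hm => s ts hs.
apply: le_trans (killed_semigroup_time_mass kerK t2 _ ts mg g01) _.
  by rewrite ler_pdivrMr// ler_peMr ?ler1n// ltW.
rewrite -(fineK fg) -EFinM lee_fin -/m.
apply: (@le_trans _ _ (2 * (e / 2 / (m + 1)) * (m + 1))).
  apply: ler_pM => //; last by rewrite lerDl.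
    by rewrite mulr_ge0// time_modulus_ge0.
  by rewrite ler_wpM2l.
by rewrite le_eqVlt; apply/orP; left; apply/eqP; field; rewrite gt_eqF// ltr_wpDl.
Qed.

(** The kernel is symmetric; this moves the semigroup from bounded data, at which
it is not strongly continuous, onto integrable test functions, at which it is. *)
Lemma killed_semigroup_adjoint s phi g : measurable_fun setT phi ->
  (forall y, 0 <= phi y <= 1) -> L1 g -> 0 <= s ->
  \int[mu]_x (S s phi x * g x) = \int[mu]_x (phi x * S s g x).
Proof.
move=> mphi phi01 ig; rewrite le_eqVlt => /predU1P[<-|s0].
  by rewrite /killed_semigroup eqxx.
have mg := mL1 ig.
pose F (p : X * X) : \bar R := (phi p.1 * (K s p.1 p.2 * g p.2))%:E.
have iF : (mu \x mu)%E.-integrable setT F.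
  apply: le_integrable (integrable_kernel2 kerK s0 ig) => //.
    apply/measurable_EFinP; apply: measurable_funM; first exact: (measurableT_comp mphi).
    apply: measurable_funM; last exact: (measurableT_comp mg).
    exact: (measurable_kernel_comp kerK).
  move=> p _; rewrite !abse_EFin lee_fin normrM ler_piMl// ger0_norm.
    by case/andP: (phi01 p.1).
  by case/andP: (phi01 p.1).
have iphi x : L1 (fun y => K s x y * phi y).
  apply: (le_integrable measurableT _ (g := fun y => (K s x y)%:E)).
  - by apply/measurable_EFinP; apply: measurable_funM => //; exact: (measurable_kernel_comp kerK).
  - move=> y _; rewrite !abse_EFin lee_fin normrM ler_piMr// ger0_norm.
      by case/andP: (phi01 y).
    by case/andP: (phi01 y).
  - apply/integrableP; split.
      by apply/measurable_EFinP; exact: (measurable_kernel_comp kerK).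
    under eq_integral do rewrite abse_EFin ger0_norm ?(kernel_ge0 kerK)//.
    by rewrite (integral_kernel kerK)// ltry.
have mK : measurable_fun [set: X * X] (fun p => K s p.1 p.2).
  exact: (measurable_kernel_comp kerK).
have E1 : (\int[mu]_x \int[mu]_y F (x, y) = \int[mu]_x (phi x * smoothing mu K s g x)%:E)%E.
  apply: eq_integral => x _; rewrite EFinM /smoothing /Rintegral fineK; last first.
    by apply: integrable_fin_num => //; exact: (integrable_kernelM kerK bounded_kernel).
  rewrite -integralZl//; exact: (integrable_kernelM kerK bounded_kernel).
have E2 : (\int[mu]_y \int[mu]_x F (x, y) = \int[mu]_y (smoothing mu K s phi y * g y)%:E)%E.
  apply: eq_integral => y _; rewrite EFinM /smoothing /Rintegral fineK; last exact: integrable_fin_num.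
  rewrite -integralZr//; apply: eq_integral => x _; rewrite -EFinM; congr EFin.
  by rewrite /= (kernel_sym kerK); ring.
have P01 x : 0 <= smoothing mu K s phi x <= 1.
  apply/andP; split.
    by apply: Rintegral_ge0 => y _; rewrite mulr_ge0 ?(kernel_ge0 kerK)//; case/andP: (phi01 y).
  rewrite -lee_fin /smoothing /Rintegral fineK; last exact: integrable_fin_num.
  rewrite -(integral_kernel kerK x s0); apply: le_integral_EFin => //.
  - by apply/mL1.
  - exact: (measurable_kernel_comp kerK).
  - by move=> y; rewrite mulr_ge0 ?(kernel_ge0 kerK)//; case/andP: (phi01 y).
  - by move=> y; rewrite ler_piMr ?(kernel_ge0 kerK)//; case/andP: (phi01 y).
have mP : measurable_fun setT (smoothing mu K s phi).
  rewrite (_ : smoothing mu K s phi = (fun x => expR s * S s phi x)).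
    apply: measurable_funM => //; apply: (measurable_semigroup kerK) => // y.
    by case/andP: (phi01 y).
  by apply/funext => x; rewrite killed_semigroup_smoothing// mulrA -expRD subrr expR0 mul1r.
have i1 : L1 (fun x => smoothing mu K s phi x * g x).
  apply: (le_integrable measurableT _ _ ig).
    by apply/measurable_EFinP; exact: measurable_funM.
  move=> x _; rewrite !abse_EFin lee_fin normrM ler_piMl//.
  by rewrite ger0_norm; case/andP: (P01 x).
have i2 : L1 (fun x => phi x * smoothing mu K s g x).
  have mPg := measurable_smoothing kerK s0 ig.
  apply: (le_integrable measurableT _ (g := fun x => (smoothing mu K s g x)%:E)).
  - by apply/measurable_EFinP; exact: measurable_funM.
  - move=> x _; rewrite !abse_EFin lee_fin normrM ler_piMl//.
    by rewrite ger0_norm; case/andP: (phi01 x).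
  apply/integrableP; split; first exact/measurable_EFinP.
  under eq_integral do rewrite abse_EFin.
  apply: le_lt_trans (smoothing_mass kerK bounded_kernel s0 ig) _.
  by case/integrableP: ig => _; under eq_integral do rewrite abse_EFin.
under [LHS]eq_Rintegral do rewrite killed_semigroup_smoothing// -mulrA.
under [RHS]eq_Rintegral do rewrite killed_semigroup_smoothing// mulrCA.
rewrite !RintegralZl//; congr (_ * _).
by rewrite /Rintegral -E1 -E2 Fubini.
Qed.

Lemma bounded_pairing_small g e : L1 g -> 0 < e -> exists2 c : R, 0 < c &
  forall a : X -> R, measurable_fun setT a -> (forall x, `|a x| <= c) ->
  `|\int[mu]_x (a x * g x)| <= e.
Proof.
move=> ig e0; have mg := mL1 ig.
have fg : (\int[mu]_x (`|g x|)%:E)%E \is a fin_num.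
  by apply: integrable_fin_num => //; exact: (integrable_abse ig).
pose m := fine (\int[mu]_x (`|g x|)%:E)%E.
have m0 : 0 <= m by rewrite fine_ge0//; apply: integral_ge0 => x _; rewrite lee_fin.
have em : 0 < e / (m + 1) by rewrite divr_gt0// ltr_wpDl.
exists (e / (m + 1)) => // a ma ac.
have iag : L1 (fun x => a x * g x).
  apply: (le_integrable measurableT _ _ (integrableZl measurableT (e / (m + 1)) ig)).
    by apply/measurable_EFinP; exact: measurable_funM.
  move=> x _; rewrite -EFinM !abse_EFin lee_fin !normrM ler_wpM2r//.
  by rewrite -normrM (ger0_norm (ltW em)).
rewrite -lee_fin EFin_normr_Rintegral//.
apply: le_trans (le_abse_integral _ _ _) _ => //; first exact: (measurable_int mu).
apply: (@le_trans _ _ (\int[mu]_x ((e / (m + 1)) * `|g x|)%:E)%E).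
  apply: le_integral_EFin => //.
  - by apply: measurableT_comp => //; exact: measurable_funM.
  - by apply: measurable_funM => //; exact: measurableT_comp.
  - by move=> x; rewrite normrM ler_wpM2r.
rewrite integral_EFinMl ?(ltW em)//; last exact: measurableT_comp.
rewrite -(fineK fg) -EFinM lee_fin -/m (_ : _ * m = e * (m / (m + 1))); last by ring.
by rewrite ler_piMr ?(ltW e0)// ler_pdivrMr ?ltr_wpDl// mul1r lerDl.
Qed.

(** Weak-* continuity up to time 0, by duality with the strong continuity in L1. *)
Lemma near_weak_semigroup t e phi g : measurable_fun setT phi ->
  (forall y, 0 <= phi y <= 1) -> L1 g -> l1_regular mu K g -> 0 <= t -> 0 < e ->
  \forall s \near nonneg t, `|\int[mu]_x ((S s phi x - S t phi x) * g x)| <= e.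
Proof.
move=> mphi phi01 ig rg + e0; have mg := mL1 ig.
have phi0 y : 0 <= phi y by case/andP: (phi01 y).
have iSg r : 0 <= r -> L1 (fun x => S r phi x * g x).
  move=> r0; apply: (le_integrable measurableT _ _ ig).
    by apply/measurable_EFinP; apply: measurable_funM => //; exact: (measurable_semigroup kerK).
  move=> x _; rewrite !abse_EFin lee_fin normrM ler_piMl//.
  by rewrite ger0_norm; case/andP: (killed_semigroup01 kerK x r0 mphi phi01).
rewrite le_eqVlt => /predU1P[<-|t0].
  have h := near0_mass_semigroup ig rg e0.
  apply: filterS2 (near_ge0 0) h => s s0 hs.
  have iphiS r : 0 <= r -> L1 (S r g).
    rewrite le_eqVlt => /predU1P[<-|r0]; first by rewrite /killed_semigroup eqxx.
    have mP := measurable_smoothing kerK r0 ig.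
    apply/integrableP; split; first by apply/measurable_EFinP; exact: measurable_killed_smoothing (ltW r0) ig.
    under eq_integral do rewrite abse_EFin killed_semigroup_smoothing// normrM ger0_norm ?expR_ge0//.
    rewrite integral_EFinMl ?expR_ge0//; last exact: measurableT_comp.
    apply: lte_mul_pinfty; [by rewrite lee_fin expR_ge0|by []|].
    apply: le_lt_trans (smoothing_mass kerK bounded_kernel r0 ig) _.
    by case/integrableP: ig => _; under eq_integral do rewrite abse_EFin.
  have iphiSg r : 0 <= r -> L1 (fun x => phi x * S r g x).
    move=> r0; apply: (le_integrable measurableT _ _ (iphiS r r0)).
      by apply/measurable_EFinP; apply: measurable_funM => //; exact: measurable_killed_smoothing.
    move=> x _; rewrite !abse_EFin lee_fin normrM ler_piMl//.
    by rewrite ger0_norm; case/andP: (phi01 x).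
  under eq_Rintegral do rewrite mulrBl.
  rewrite RintegralB//; [|exact: iSg|exact: iSg].
  rewrite !killed_semigroup_adjoint// -RintegralB//; [|exact: iphiSg|exact: iphiSg].
  under eq_Rintegral do rewrite -mulrBr.
  have ma : measurable_fun setT (fun x => S s g x - S 0 g x).
    by apply: measurable_funB; exact: measurable_killed_smoothing.
  have iB : L1 (fun x => phi x * (S s g x - S 0 g x)).
    under eq_fun do rewrite mulrBr EFinB.
    by apply: integrableB => //; exact: iphiSg.
  rewrite -lee_fin EFin_normr_Rintegral//; apply: le_trans hs.
  apply: le_trans (le_abse_integral _ _ _) _ => //; first exact: (measurable_int mu).
  apply: le_integral_EFin => //.
  - by apply: measurableT_comp => //; exact: measurable_funM.
  - exact: measurableT_comp.
  - move=> x; rewrite normrM ler_piMl//.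
    by rewrite ger0_norm; case/andP: (phi01 x).
have [c c0 hc] := bounded_pairing_small ig e0.
apply: cvg_within; apply: filterS2 (nbhs_ge_lt t0) (near_sup_semigroup mphi phi01 t0 c0) => s s0 hs.
by apply: hc => //; apply: measurable_funB; exact: (measurable_semigroup kerK).
Qed.

Section source.
Variable h : R -> X -> R.
Hypotheses (mh : measurable_field h) (h01 : forall s y, 0 <= h s y <= 1).

(** The Duhamel term is continuous up to time 0 in the supremum norm, whatever the
data: its kernel has mass at most t. *)
Lemma near_sup_duhamel t e : 0 <= t -> 0 < e ->
  \forall s \near nonneg t, forall x, `|D h s x - D h t x| <= e.
Proof.
move=> t0 e0; have [eta eta0 heta] := near_duhamel_modulus n t0 e0.
have {}heta : \forall s \near nonneg t,
    2 * (`|s - t| + eta) + 2 * time_modulus n eta `|s - t| * t <= e by exact: cvg_within.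
apply: filterS2 (near_ge0 t) heta => s s0 hs x; apply: le_trans hs.
have [ts|/ltW st] := leP t s.
  apply: le_trans (duhamel_time_sup kerK mh h01 x eta0 t0 ts) _.
  by rewrite ger0_norm// subr_ge0.
rewrite distrC; apply: le_trans (duhamel_time_sup kerK mh h01 x eta0 s0 st) _.
rewrite ler0_norm ?subr_le0// opprB lerD2l; apply: ler_wpM2l => //.
by rewrite mulr_ge0// time_modulus_ge0// subr_ge0.
Qed.

Lemma near_mass_duhamel t e m : (forall s, \int[mu]_y (h s y)%:E <= m%:E)%E ->
  0 <= t -> 0 < e ->
  \forall s \near nonneg t, (\int[mu]_x (`|D h s x - D h t x|)%:E <= e%:E)%E.
Proof.
move=> hm t0 e0.
have m0 : 0 <= m.
  rewrite -lee_fin; apply: le_trans (hm 0); apply: integral_ge0 => y _.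
  by rewrite lee_fin; case/andP: (h01 0 y).
have em : 0 < e / (m + 1) by rewrite divr_gt0// ltr_wpDl.
have [eta eta0 heta] := near_duhamel_modulus n t0 em.
have {}heta : \forall s \near nonneg t,
    2 * (`|s - t| + eta) + 2 * time_modulus n eta `|s - t| * t <= e / (m + 1) by exact: cvg_within.
apply: filterS2 (near_ge0 t) heta => s s0 hs.
apply: (@le_trans _ _ ((2 * (`|s - t| + eta) + 2 * time_modulus n eta `|s - t| * t) * m)%:E).
  have [ts|/ltW st] := leP t s.
    apply: le_trans (duhamel_time_mass kerK mh h01 eta0 t0 ts hm) _.
    by rewrite ger0_norm// subr_ge0.
  under eq_integral do rewrite distrC.
  apply: le_trans (duhamel_time_mass kerK mh h01 eta0 s0 st hm) _.
  rewrite lee_fin ler_wpM2r// ler0_norm ?subr_le0// opprB lerD2l; apply: ler_wpM2l => //.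
  by rewrite mulr_ge0// time_modulus_ge0// subr_ge0.
rewrite lee_fin; apply: le_trans (ler_wpM2r m0 hs) _.
rewrite (_ : _ * m = e * (m / (m + 1))); last by ring.
by rewrite ler_piMr ?(ltW e0)// ler_pdivrMr ?ltr_wpDl// mul1r lerDl.
Qed.

End source.

Variables (q : R) (f : R -> R).
Hypothesis lf : unit_lipschitz q f.
Variable phi : X -> R.
Hypotheses (mphi : measurable_fun setT phi) (phi01 : forall x, 0 <= phi x <= 1).
Local Notation u := (picard_limit mu K f phi).

Let u01 t x : 0 <= u t x <= 1.
Proof. exact: (picard_limit01 kerK lf mphi phi01 (lexx 1)). Qed.

Let mu_ : measurable_field u.
Proof. exact: (measurable_picard_limit kerK lf mphi phi01 (lexx 1)). Qed.

Let mfu : measurable_field (fun s => f \o u s).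
Proof. by apply: (measurable_unit_lipschitz (g := fun p : RT * X => u p.1 p.2) lf). Qed.

Let fu01 s y : 0 <= (f \o u s) y <= 1.
Proof.
rewrite /= (unit_lipschitz_ge0 lf)//=.
by apply: le_trans (unit_lipschitz_le lf (u01 s y)) _; case/andP: (u01 s y).
Qed.

Lemma solution_reaction t x : 0 <= t -> u t x - S t phi x = D (fun s => f \o u s) t x.
Proof. by move=> t0; rewrite (picard_limitE kerK lf mphi phi01 (lexx 1))// addrC addKr. Qed.

Lemma near_sup_solution_reaction t e : 0 <= t -> 0 < e ->
  \forall s \near nonneg t, forall x,
  `|(u s x - S s phi x) - (u t x - S t phi x)| <= e.
Proof.
move=> t0 e0; apply: filterS2 (near_ge0 t) (near_sup_duhamel mfu fu01 t0 e0) => s s0 hs x.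
by rewrite !solution_reaction.
Qed.

Let split_dist (a b a' b' : R) : a - b = (a - a' - (b - b')) + (a' - b').
Proof. by ring. Qed.

Lemma near_sup_solution t e : 0 < t -> 0 < e ->
  \forall s \near nonneg t, forall x, `|u s x - u t x| <= e.
Proof.
move=> t0 e0; have e2 : 0 < e / 2 by rewrite divr_gt0.
apply: filterS2 (cvg_within _ (near_sup_semigroup mphi phi01 t0 e2))
  (near_sup_solution_reaction (ltW t0) e2) => s h1 h2 x.
rewrite (split_dist _ _ (S s phi x) (S t phi x)) [e]splitr.
by apply: le_trans (ler_normD _ _) _; exact: lerD.
Qed.

Lemma near_mass_solution t e : L1 phi -> l1_regular mu K phi -> 0 <= t -> 0 < e ->
  \forall s \near nonneg t, (\int[mu]_x (`|u s x - u t x|)%:E <= e%:E)%E.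
Proof.
move=> iphi rphi t0 e0; have e2 : 0 < e / 2 by rewrite divr_gt0.
have phi0 y : 0 <= phi y by case/andP: (phi01 y).
have fphi : (\int[mu]_x (phi x)%:E)%E \is a fin_num by exact: integrable_fin_num.
have hm s : (\int[mu]_y (u s y)%:E <= (fine (\int[mu]_x (phi x)%:E))%:E)%E.
  by apply: (picard_limit_mass kerK lf) => //; rewrite fineK.
have msec s : measurable_fun setT (u s) by exact: (measurable_field_section _ mu_).
have mfsec s : measurable_fun setT (f \o u s).
  exact: (measurable_field_section s mfu).
have hfm s : (\int[mu]_y ((f \o u s) y)%:E <= (fine (\int[mu]_x (phi x)%:E))%:E)%E.
  apply: le_trans (hm s); apply: le_integral_EFin => //.
    by move=> y; case/andP: (fu01 s y).
  by move=> y; exact: (unit_lipschitz_le lf).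
apply: filterS3 (near_ge0 t) (near_mass_semigroup mphi phi01 iphi rphi t0 e2)
  (near_mass_duhamel mfu fu01 hfm t0 e2) => s s0 h1 h2.
have mS r : measurable_fun setT (S r phi) by exact: (measurable_semigroup kerK).
have mW r : measurable_fun setT (fun x => u r x - S r phi x) by exact: measurable_funB.
have m1 : measurable_fun setT (fun x => `|(u s x - S s phi x) - (u t x - S t phi x)|).
  by apply: measurableT_comp => //; exact: measurable_funB.
have m2 : measurable_fun setT (fun x => `|S s phi x - S t phi x|).
  by apply: measurableT_comp => //; exact: measurable_funB.
apply: (@le_trans _ _ (\int[mu]_x (`|(u s x - S s phi x) - (u t x - S t phi x)| +
    `|S s phi x - S t phi x|)%:E)%E).
  apply: le_integral_EFin => //.
  - by apply: measurableT_comp => //; exact: measurable_funB.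
  - exact: measurable_funD.
  - by move=> x; rewrite [X in `|X|](split_dist _ _ (S s phi x) (S t phi x)); exact: ler_normD.
rewrite integral_EFinD// (splitr e) EFinD; apply: leeD => //.
by under eq_integral do rewrite !solution_reaction//.
Qed.

Lemma near_weak_solution t e g : L1 g -> l1_regular mu K g -> 0 <= t -> 0 < e ->
  \forall s \near nonneg t, `|\int[mu]_x (u s x * g x) - \int[mu]_x (u t x * g x)| <= e.
Proof.
move=> ig rg t0 e0; have e2 : 0 < e / 2 by rewrite divr_gt0.
have phi0 y : 0 <= phi y by case/andP: (phi01 y).
have [c c0 hc] := bounded_pairing_small ig e2.
apply: filterS3 (near_ge0 t) (near_weak_semigroup mphi phi01 ig rg t0 e2)
  (near_sup_solution_reaction t0 c0) => s s0 h1 h2.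
have mg := mL1 ig.
have msec r : measurable_fun setT (u r) by exact: (measurable_field_section _ mu_).
have mS r : measurable_fun setT (S r phi) by exact: (measurable_semigroup kerK).
have mW r : measurable_fun setT (fun x => u r x - S r phi x) by exact: measurable_funB.
have i01 (a b : X -> R) : measurable_fun setT a -> measurable_fun setT b ->
    (forall x, 0 <= a x <= 1) -> (forall x, 0 <= b x <= 1) -> L1 (fun x => (a x - b x) * g x).
  move=> ma mb a01 b01; apply: (le_integrable measurableT _ _ ig).
    by apply/measurable_EFinP; apply: measurable_funM => //; exact: measurable_funB.
  move=> x _; rewrite !abse_EFin lee_fin normrM ler_piMl// ler_norml.
  by have /andP[? ?] := a01 x; have /andP[? ?] := b01 x; apply/andP; split; lra.
have iu r : L1 (fun x => u r x * g x).
  have := @i01 (u r) (cst 0) (msec r) (measurable_cst _) (u01 r).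
  by under eq_fun do rewrite /= subr0; apply => x /=; rewrite lexx ler01.
have S01 r x : 0 <= r -> 0 <= S r phi x <= 1.
  by move=> r0; exact: (killed_semigroup01 kerK x r0 mphi phi01).
have iS : L1 (fun x => (S s phi x - S t phi x) * g x).
  by apply: i01 => // x; exact: S01.
have iD : L1 (fun x => (u s x - u t x) * g x) by exact: i01.
have -> : \int[mu]_x (u s x * g x) - \int[mu]_x (u t x * g x) =
    \int[mu]_x ((u s x - u t x) * g x).
  rewrite -RintegralB//; [|exact: iu|exact: iu].
  by apply: eq_Rintegral => x _; rewrite mulrBl.
have E x : (u s x - u t x) * g x =
    ((u s x - S s phi x) - (u t x - S t phi x)) * g x + (S s phi x - S t phi x) * g x.
  by rewrite -mulrDl -split_dist.
have iV : L1 (fun x => ((u s x - S s phi x) - (u t x - S t phi x)) * g x).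
  rewrite (_ : (fun x => _) = (fun x => ((u s x - u t x) * g x)%:E - ((S s phi x - S t phi x) * g x)%:E)%E).
    exact: integrableB.
  by apply/funext => x; rewrite -EFinB E addrK.
under eq_Rintegral do rewrite E.
rewrite RintegralD// (splitr e); apply: le_trans (ler_normD _ _) _; apply: lerD => //.
by apply: hc => //; exact: measurable_funB.
Qed.

End solution_continuity.

(** * The solution of the problem *)

(** Data with values in [0, M] almost everywhere are replaced by data with values
in [0, M] everywhere, on which the iteration is run. *)
Definition clamp (R : realType) (M v : R) : R := Num.max 0 (Num.min M v).

Section clamp.
Context (R : realType).
Implicit Types (M v : R).

Lemma clamp_range M v : 0 <= M -> 0 <= clamp M v <= M.
Proof. by move=> M0; rewrite /clamp le_max lexx/= ge_max M0 ge_min lexx. Qed.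

Lemma clamp_id M v : 0 <= v <= M -> clamp M v = v.
Proof. by move=> /andP[v0 vM]; rewrite /clamp min_r// max_r. Qed.

Lemma normr_clamp_le M v : 0 <= M -> `|clamp M v| <= `|v|.
Proof.
move=> M0; rewrite ger0_norm; last by case/andP: (clamp_range v M0).
by rewrite /clamp ge_max normr_ge0 ge_min ler_norm orbT.
Qed.

Lemma measurable_clamp d (X : measurableType d) M (g : X -> R) :
  measurable_fun setT g -> measurable_fun setT (clamp M \o g).
Proof. by move=> mg; apply: measurable_maxr => //; exact: measurable_minr. Qed.

End clamp.

Lemma ae_killed_semigroup (R : realType) d (X : measurableType d)
    (mu : {sigma_finite_measure set X -> \bar R}) n (K : R -> X -> X -> R)
    (kerK : diffusion_kernel mu n K) t (g1 g2 : X -> R) :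
  measurable_fun setT g1 -> measurable_fun setT g2 ->
  {ae mu, forall x, g1 x = g2 x} ->
  {ae mu, forall x, killed_semigroup mu K t g1 x = killed_semigroup mu K t g2 x}.
Proof.
move=> m1 m2 g12; rewrite /killed_semigroup; case: eqP => // _.
apply: aeW => x; congr (_ * fine _).
have mK : measurable_fun setT (K t x) by exact: (measurable_kernel_comp kerK).
apply: ae_eq_integral => //; try by apply/measurable_EFinP; exact: measurable_funM.
by apply: filterS g12 => y -> _.
Qed.

Section construction.
Context (R : realType) (d : nat) (qk : nat -> R) (q : R).
Hypothesis law : offspring_law qk q.
Local Notation mu := (lebesgue_Rd R d).
Local Notation K := (@heat_K R d).
Local Notation S := (killed_semigroup mu K).
Local Notation L1 g := (mu.-integrable setT (fun x => (g x)%:E)).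
Local Notation solution phi := (picard_limit mu K (reaction qk) phi).

Let kerK : diffusion_kernel mu d K. Proof. exact: diffusion_heat_kernel. Qed.

Let bK := @bounded_heat_kernel R d.

Lemma unit_lipschitz_reaction : unit_lipschitz q (reaction qk).
Proof.
split; first by case: law.
- exact: (reaction_ge0 law).
- exact: (reaction_le law).
- exact: (reaction_lipschitz law).
Qed.

Let lf := unit_lipschitz_reaction.

(** The semigroup and the mild equation of the problem are by definition the
abstract ones for the Gaussian kernel. *)
Lemma heat_semigroupE t g : heat_semigroup t g = S t g.
Proof. by []. Qed.

Lemma mild_solutionE phi u : mild_solution qk phi u = forall t, 0 <= t ->
  {ae mu, forall x, u t x = S t phi x +
    duhamel mu K (fun s => reaction qk \o u s) t x}.
Proof. by []. Qed.

Lemma Loo_continuous_near (I : set R) (w : R -> Rd R d -> R) :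
  (forall t e, I t -> 0 < e -> \forall s \near within I (nbhs t),
    {ae mu, forall x, `|w s x - w t x| <= e}) -> Lp_continuous_on +oo%E I w.
Proof.
move=> hw t It; apply: cvge0_le => [s|e e0]; first exact: Lnorm_ge0.
by apply: filterS (hw t e It e0) => s hs; apply: Lnormoo_le => //; exact: ltW.
Qed.

(** The mild equation depends on the data only through their class, hence phi may
be replaced by phi0; the attraction of the Picard iteration then applies. *)
Lemma global_solution_unique (phi phi0 : Rd R d -> R) (u : R -> Rd R d -> R) : measurable_fun setT phi ->
  measurable_fun setT phi0 -> (forall x, 0 <= phi0 x <= 1) ->
  {ae mu, forall x, phi x = phi0 x} -> global_solution qk phi u ->
  forall t, 0 <= t -> {ae mu, forall x, u t x = solution phi0 t x}.
Proof.
move=> mphi mphi0 phi01 phiE [uoo _ _ mild u01].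
apply: (picard_limit_unique kerK lf mphi0 phi01 (lexx 1)) => [t t0|t x t0|t t0].
- exact: (Lfun_measurable (uoo t t0)).
- exact: u01.
- apply: filterS2 (mild t t0) (ae_killed_semigroup kerK t mphi mphi0 phiE) => x.
  by rewrite heat_semigroupE => -> ->.
Qed.

Section solution.
Variables (phi phi0 : Rd R d -> R) (M : R).
Hypotheses (mphi : measurable_fun setT phi) (mphi0 : measurable_fun setT phi0).
Hypotheses (phiM : forall x, 0 <= phi0 x <= M) (M1 : M <= 1).
Hypothesis phiE : {ae mu, forall x, phi x = phi0 x}.
Local Notation u := (solution phi0).

Let phi01 x : 0 <= phi0 x <= 1.
Proof. by have /andP[-> /le_trans] := phiM x; apply. Qed.

Let measurable_u t : measurable_fun setT (u t).
Proof. exact: (measurable_field_section _ (measurable_picard_limit kerK lf mphi0 phi01 (lexx 1))). Qed.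

Let u01 t x : 0 <= u t x <= 1.
Proof. exact: (picard_limit01 kerK lf mphi0 phi01 (lexx 1)). Qed.

Let ae_S t : {ae mu, forall x, S t phi x = S t phi0 x}.
Proof. exact: (ae_killed_semigroup kerK). Qed.

Let near_pos t P : (\forall s \near within `[0, +oo[ (nbhs t), P s) ->
  \forall s \near within `]0, +oo[ (nbhs (t : R)), P s.
Proof.
rewrite !near_withinE; apply: filterS => s Ps; rewrite /= in_itv/= andbT => s0.
by apply: Ps; rewrite /= in_itv/= andbT ltW.
Qed.

Lemma global_solution_picard : global_solution qk phi u.
Proof.
split.
- move=> t t0; apply: (@Lfunoo_bounded _ _ _ _ _ 1) => //.
  by apply: aeW => x; rewrite ger0_norm; case/andP: (u01 t x).
- apply: Loo_continuous_near => t e; rewrite /= in_itv/= andbT => t0 e0.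
  apply: near_pos; apply: filterS (near_sup_solution kerK lf mphi0 phi01 t0 e0) => s hs.
  exact: aeW.
- move=> t; rewrite /= in_itv/= andbT => t0 g /Lfun1_integrable ig.
  have rg : l1_regular mu K g by exact: heat_kernel_l1_regular.
  apply/cvgrPdist_le => e e0.
  have := near_weak_solution kerK bK lf mphi0 phi01 ig rg t0 e0.
  by apply: filterS => s; rewrite distrC.
- rewrite mild_solutionE => t t0; apply: filterS (ae_S t) => x ->.
  exact: (picard_limitE kerK lf mphi0 phi01 (lexx 1)).
- by move=> t x _; exact: u01.
Qed.

Lemma reaction_part_Loo_continuous :
  Lp_continuous_on +oo%E `[0, +oo[ (fun t => u t \- heat_semigroup t phi).
Proof.
apply: Loo_continuous_near => t e; rewrite /= in_itv/= andbT => t0 e0.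
apply: filterS (near_sup_solution_reaction kerK lf mphi0 phi01 t0 e0) => s hs.
by apply: filterS2 (ae_S s) (ae_S t) => x; rewrite /= !heat_semigroupE => -> ->.
Qed.

(** The Duhamel term being continuous in norm at 0, the solution is as continuous
there as the semigroup is on phi. *)
Lemma Loo_continuous_at0 :
  'N[mu]_+oo[EFin \o (heat_semigroup t phi \- phi)%R]%E @[t --> 0^'+] --> 0%E ->
  Lp_continuous_on +oo%E `[0, +oo[ u.
Proof.
move=> phi_cvg; apply: Loo_continuous_near => t e; rewrite /= in_itv/= andbT.
rewrite le_eqVlt => /predU1P[<-|t0] e0; last first.
  by apply: filterS (near_sup_solution kerK lf mphi0 phi01 t0 e0) => s hs; exact: aeW.
have e2 : 0 < e / 2 by rewrite divr_gt0.
have hS : \forall s \near within `[0, +oo[ (nbhs (0 : R)),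
    {ae mu, forall x, `|S s phi0 x - S 0 phi0 x| <= e / 2}.
  apply: near_within_right.
    by apply: aeW => x; rewrite subrr normr0 ltW.
  apply: filterS (cvge0_near_le phi_cvg e2) => s /Lnormoo_ae hs.
  apply: filterS3 hs (ae_S s) phiE => x /=.
  rewrite heat_semigroupE => + <- phix.
  by rewrite /killed_semigroup eqxx -phix.
apply: filterS2 hS (near_sup_solution_reaction kerK lf mphi0 phi01 (lexx 0) e2) => s h1 h2.
apply: filterS h1 => x h1.
rewrite (_ : _ - _ = (u s x - S s phi0 x - (u 0 x - S 0 phi0 x)) +
  (S s phi0 x - S 0 phi0 x)); last by ring.
by rewrite (splitr e); apply: le_trans (ler_normD _ _) _; exact: lerD.
Qed.

Lemma solution_Lnormoo_le t : ('N[mu]_+oo[EFin \o u t] <= M%:E)%E.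
Proof.
have uM x := picard_limit_range kerK lf mphi0 phiM M1 t x.
apply: Lnormoo_le; first by have /andP[/le_trans] := phiM point; apply.
by apply: aeW => x; have /andP[? ?] := uM x; rewrite ger0_norm.
Qed.

Section integrable_data.
Hypothesis iphi : L1 phi0.

Let iphi_fin : (\int[mu]_x (phi0 x)%:E)%E \is a fin_num.
Proof. exact: integrable_fin_num. Qed.

Lemma solution_mass t :
  (\int[mu]_x (u t x)%:E <= \int[mu]_x (phi0 x)%:E)%E.
Proof.
by rewrite -[leRHS]fineK//; apply: (picard_limit_mass kerK lf) => //; rewrite fineK.
Qed.

Lemma integrable_solution t : L1 (u t).
Proof.
apply/integrableP; split; first exact/measurable_EFinP.
rewrite (eq_integral (fun x => (u t x)%:E)); last first.
  by move=> x _; rewrite abse_EFin ger0_norm//; case/andP: (u01 t x).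
by apply: le_lt_trans (solution_mass t) _; rewrite ltey_eq iphi_fin.
Qed.

Lemma solution_L1_continuous : Lp_continuous_on 1%E `[0, +oo[ u.
Proof.
move=> t; rewrite /= in_itv/= andbT => t0.
apply: cvge0_le => [s|e e0]; first exact: Lnorm_ge0.
have rphi : l1_regular mu K phi0 by exact: heat_kernel_l1_regular.
have := near_mass_solution kerK lf mphi0 phi01 iphi rphi t0 e0.
by apply: filterS => s; rewrite Lnorm1.
Qed.

Lemma solution_Rintegral_le t : \int[mu]_x u t x <= \int[mu]_x phi x.
Proof.
rewrite /Rintegral; have -> : (\int[mu]_x (phi x)%:E = \int[mu]_x (phi0 x)%:E)%E.
  apply: ae_eq_integral => //; try exact/measurable_EFinP.
  by apply: filterS phiE => x -> _.
apply: fine_le => //; last exact: solution_mass.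
by apply: integrable_fin_num => //; exact: integrable_solution.
Qed.

End integrable_data.
End solution.

Lemma solution_dist_Lnorm1 (phi1 phi2 : Rd R d -> R) (u1 u2 : R -> Rd R d -> R) t :
  phi1 \in Lfun mu 1 -> phi2 \in Lfun mu 1 ->
  {ae mu, forall x, 0 <= phi1 x <= 1} -> {ae mu, forall x, 0 <= phi2 x <= 1} ->
  global_solution qk phi1 u1 -> global_solution qk phi2 u2 -> 0 <= t ->
  ('N[mu]_1[EFin \o (u1 t \- u2 t)%R] <=
   (2 * expR ((2 * q - 1) * t))%:E * 'N[mu]_1[EFin \o (phi1 \- phi2)%R])%E.
Proof.
move=> l1 l2 phi1_01 phi2_01 sol1 sol2 t0.
have m1 := Lfun_measurable l1; have m2 := Lfun_measurable l2.
pose c1 := clamp 1 \o phi1; pose c2 := clamp 1 \o phi2.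
have mc1 : measurable_fun setT c1 by exact: measurable_clamp.
have mc2 : measurable_fun setT c2 by exact: measurable_clamp.
have c1_01 x : 0 <= c1 x <= 1 by exact: clamp_range.
have c2_01 x : 0 <= c2 x <= 1 by exact: clamp_range.
have c1E : {ae mu, forall x, phi1 x = c1 x}.
  by apply: filterS phi1_01 => x h; rewrite /c1 /= clamp_id.
have c2E : {ae mu, forall x, phi2 x = c2 x}.
  by apply: filterS phi2_01 => x h; rewrite /c2 /= clamp_id.
have w1 := global_solution_unique m1 mc1 c1_01 c1E sol1 t0.
have w2 := global_solution_unique m2 mc2 c2_01 c2E sol2 t0.
have mu1 : measurable_fun setT (u1 t) by case: sol1 => /(_ t t0) /Lfun_measurable.
have mu2 : measurable_fun setT (u2 t) by case: sol2 => /(_ t t0) /Lfun_measurable.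
have mw (c : Rd R d -> R) : measurable_fun setT c -> (forall x, 0 <= c x <= 1) ->
    measurable_fun setT (solution c t).
  move=> mc c01.
  exact: (measurable_field_section _ (measurable_picard_limit kerK lf mc c01 (lexx 1))).
have ed : (\int[mu]_x (`|c1 x - c2 x|)%:E = 'N[mu]_1[EFin \o (phi1 \- phi2)%R])%E.
  rewrite Lnorm1; apply: ae_eq_integral => //.
  - apply/measurable_EFinP; apply: measurableT_comp => //; exact: measurable_funB.
  - apply: measurableT_comp => //; apply/measurable_EFinP; exact: measurable_funB.
  - by apply: filterS2 c1E c2E => x h1 h2 _; rewrite /= h1 h2.
have -> : 'N[mu]_1[EFin \o (u1 t \- u2 t)%R]%E =
    (\int[mu]_x (`|solution c1 t x - solution c2 t x|)%:E)%E.
  rewrite Lnorm1; apply: ae_eq_integral => //.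
  - apply: measurableT_comp => //; apply/measurable_EFinP; exact: measurable_funB.
  - apply/measurable_EFinP; apply: measurableT_comp => //.
    by apply: measurable_funB; exact: mw.
  - by apply: filterS2 w1 w2 => x h1 h2 _; rewrite /= h1 h2.
have Nfin : 'N[mu]_1[EFin \o (phi1 \- phi2)%R]%E \is a fin_num.
  rewrite Lnorm1; apply: integrable_fin_num => //; apply: integrable_abse.
  move/Lfun1_integrable : l1 => i1; move/Lfun1_integrable : l2 => i2.
  exact: (integrableB _ i1 i2).
rewrite -(fineK Nfin) in ed *.
apply: le_trans (picard_limit_dist_mass kerK lf t0 mc1 mc2 c1_01 c2_01 _) _.
  by rewrite ed.
by rewrite -EFinM lee_fin mulrAC.
Qed.

End construction.

Lemma LooL1_norm_le (R : realType) (d : nat) (T c : R) (w : R -> Rd R d -> R) : 0 <= c ->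
  (forall t : R, 0 <= t -> t <= T -> ('N[lebesgue_Rd R d]_1[EFin \o w t] <= c%:E)%E) ->
  (LooL1_norm T w <= c%:E)%E.
Proof.
move=> c0 wc; apply: Lnormoo_le_ereal => //; exists (~` `[0, T]); split.
- by apply: measurableC; exact: measurable_itv.
- by rewrite /= /mrestr (_ : _ `&` _ = set0) ?measure0//; apply/seteqP; split=> // t [].
- move=> t /= nt; rewrite in_itv/= => /andP[t0 tT]; apply: nt.
  by rewrite gee0_abs ?Lnorm_ge0//; exact: wc.
Qed.

Theorem theorem1p1 (R : realType) :
  exists C : R -> R -> R,
  forall (d : nat) (qk : nat -> R) (q : R),
  (1 <= d)%N -> offspring_law qk q ->
  (forall phi : Rd R d -> R,
     phi \in Lfun (lebesgue_Rd R d) +oo%E -> {ae (lebesgue_Rd R d), forall x, 0 <= phi x <= 1} ->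
     exists u : R -> Rd R d -> R,
     [/\ [/\ global_solution qk phi u,
             Lp_continuous_on +oo%E `[0, +oo[
               (fun t => u t \- heat_semigroup t phi)
           & 'N[lebesgue_Rd R d]_+oo[EFin \o (heat_semigroup t phi \- phi)%R]%E
               @[t --> 0^'+] --> 0%E ->
             Lp_continuous_on +oo%E `[0, +oo[ u],
         forall t, 0 <= t ->
           ('N[lebesgue_Rd R d]_+oo[EFin \o u t] <= 'N[lebesgue_Rd R d]_+oo[EFin \o phi])%E,
         forall v, global_solution qk phi v ->
           forall t, 0 <= t -> {ae (lebesgue_Rd R d), forall x, v t x = u t x}
       & phi \in Lfun (lebesgue_Rd R d) 1 ->
         [/\ forall t, 0 <= t -> u t \in Lfun (lebesgue_Rd R d) 1,
             Lp_continuous_on 1%E `[0, +oo[ u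
           & forall t, 0 <= t ->
               \int[lebesgue_Rd R d]_x u t x <= \int[lebesgue_Rd R d]_x phi x]]) /\
  (forall (phi1 phi2 : Rd R d -> R) (u1 u2 : R -> Rd R d -> R),
     phi1 \in Lfun (lebesgue_Rd R d) 1 -> phi2 \in Lfun (lebesgue_Rd R d) 1 ->
     {ae (lebesgue_Rd R d), forall x, 0 <= phi1 x <= 1} ->
     {ae (lebesgue_Rd R d), forall x, 0 <= phi2 x <= 1} ->
     global_solution qk phi1 u1 -> global_solution qk phi2 u2 ->
     forall T : R, 0 < T ->
     (LooL1_norm T (fun t => u1 t \- u2 t)%R
        <= (C T q)%:E * 'N[lebesgue_Rd R d]_1[EFin \o (phi1 \- phi2)%R])%E).
Proof.
exists (fun T q => 2 * expR ((2 * q - 1) * T)) => d qk q _ law; split; last first.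
  move=> phi1 phi2 u1 u2 l1 l2 phi1_01 phi2_01 sol1 sol2 T T0.
  have q1 : 1 < q by case: law.
  have Nfin : 'N[lebesgue_Rd R d]_1[EFin \o (phi1 \- phi2)%R]%E \is a fin_num.
    rewrite Lnorm1; apply: integrable_fin_num => //; apply: integrable_abse.
    move/Lfun1_integrable : l1 => i1; move/Lfun1_integrable : l2 => i2.
    exact: (integrableB _ i1 i2).
  rewrite -(fineK Nfin) -EFinM; apply: LooL1_norm_le => [|t t0 tT].
    by rewrite mulr_ge0 ?mulr_ge0 ?expR_ge0// fine_ge0// Lnorm_ge0.
  apply: le_trans (solution_dist_Lnorm1 law l1 l2 phi1_01 phi2_01 sol1 sol2 t0) _.
  rewrite -(fineK Nfin) -EFinM lee_fin ler_wpM2r ?fine_ge0 ?Lnorm_ge0//.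
  by rewrite ler_wpM2l// ler_expR ler_wpM2l//; lra.
move=> phi lphi phi01.
set mu := lebesgue_Rd R d in lphi phi01 *.
have mphi := Lfun_measurable lphi.
have N1 : ('N[mu]_+oo[EFin \o phi] <= 1%:E)%E.
  apply: Lnormoo_le => //; apply: filterS phi01 => x /andP[? ?].
  by rewrite ger0_norm.
have Nfin : 'N[mu]_+oo[EFin \o phi]%E \is a fin_num.
  by rewrite ge0_fin_numE ?Lnorm_ge0//; exact: le_lt_trans N1 (ltry _).
pose M := fine 'N[mu]_+oo[EFin \o phi]%E.
have NE : 'N[mu]_+oo[EFin \o phi]%E = M%:E by rewrite fineK.
have M0 : 0 <= M by rewrite fine_ge0// Lnorm_ge0.
have M1 : M <= 1 by rewrite -lee_fin -NE.
pose phi0 := clamp M \o phi.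
have mphi0 : measurable_fun setT phi0 by exact: measurable_clamp.
have phiM x : 0 <= phi0 x <= M by exact: clamp_range.
have phi0_01 x : 0 <= phi0 x <= 1 by have /andP[-> /le_trans] := phiM x; apply.
have phiE : {ae mu, forall x, phi x = phi0 x}.
  have := @Lnormoo_ae _ _ _ mu phi M; rewrite NE lexx => /(_ isT) phi_le.
  apply: filterS2 phi01 phi_le => x /andP[x0 _] xM.
  by rewrite /phi0 /= clamp_id// x0 (le_trans (ler_norm _) xM).
exists (picard_limit mu (@heat_K R d) (reaction qk) phi0); split.
- split.
  + exact: (global_solution_picard law mphi mphi0 phiM M1 phiE).
  + exact: (reaction_part_Loo_continuous law mphi mphi0 phiM M1 phiE).
  + exact: (Loo_continuous_at0 law mphi mphi0 phiM M1 phiE).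
- by move=> t _; rewrite NE; exact: (solution_Lnormoo_le law mphi0 phiM M1).
- move=> v sol; exact: (global_solution_unique law mphi mphi0 phi0_01 phiE sol).
- move=> /Lfun1_integrable iphi.
  have iphi0 : mu.-integrable setT (fun x => (phi0 x)%:E).
    apply: (le_integrable measurableT _ _ iphi); first exact/measurable_EFinP.
    by move=> x _; rewrite !abse_EFin lee_fin; exact: normr_clamp_le.
  split=> [t t0||t t0].
  + apply/Lfun1_integrable; exact: (integrable_solution law mphi0 phiM M1).
  + exact: (solution_L1_continuous law mphi0 phiM M1).
  + exact: (solution_Rintegral_le law mphi mphi0 phiM M1).
Qed.
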